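(* Let $\Phi$ be an irreducible root system and $\Phi^+$ a choice of positive system. The maximal size of a really abelian subset of $\Phi^+$, and thus the Helly number $h_{\mathbb{R}}(\Phi^+)$ of $\Phi^+$ for convex closure $\mathrm{cone}_{\mathbb{R}}$, is given according to the type of $\Phi$ as follows: $\lfloor (n+1)^2/4\rfloor$ for $A_n$ ($n\ge1$); $\binom n2+1$ for $B_n/C_n$ ($n\ge2$); $\binom n2$ for $D_n$ ($n\ge4$); $16$ for $E_6$; $27$ for $E_7$; $36$ for $E_8$; $6$ for $F_4$; $2$ for $G_2$; $2$ for $I_2(m)$; $5$ for $H_3$; $8$ for $H_4$.
   Context: A root system $\Phi$ in a finite-dimensional real Euclidean space $V$ is a finite spanning set of nonzero vectors such that for every $\alpha\in\Phi$: $\mathbb{R}\alpha\cap\Phi=\{\alpha,-\alpha\}$, and $s_\alpha(\Phi)=\Phi$, where $s_\alpha(v)=v-\frac{2(v,\alpha)}{(\alpha,\alpha)}\alpha$ (so $\Phi$ need not be crystallographic). $\Phi$ is irreducible if it is not the orthogonal union of two or more root systems. A positive system $\Phi^+$ is the set of elements of $\Phi$ that are positive for some total ordering of $V$ compatible with addition and scalar multiplication. For $A\subseteq\Phi^+$, $\mathrm{cone}_{\mathbb{R}}(A)=\mathbb{R}_{\ge0}A\cap\Phi^+$, where $\mathbb{R}_{\ge0}A$ is the set of linear combinations of elements of $A$ with nonnegative real coefficients; this is a closure operator on $\Phi^+$ (convex closure). A subset $A\subseteq\Phi^+$ is really abelian if it is free for $\mathrm{cone}_{\mathbb{R}}$,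 i.e. every subset $B$ of $A$ is closed: $\mathrm{cone}_{\mathbb{R}}(B)=B$. Helly number: let $S$ be a closure space with closure operator $\mathrm{cl}$ and $\mathrm{cl}(\varnothing)=\varnothing$. A family $(A_i)_{i\in I}$ of nonempty subsets of $S$ is Helly independent if $\bigcap_J \mathrm{cl}(\bigcup_{j\in J}A_j)=\varnothing$, where $J$ ranges over $I$ and all sets $I\setminus\{i\}$, $i\in I$. The Helly number of $S$ is the maximal size of a finite Helly independent family. *)

(* Defs.v *)
From HB Require Import structures.
From mathcomp Require Import all_boot all_order all_algebra.
From mathcomp Require Import sesquilinear.
From mathcomp Require Import finmap.
From mathcomp Require Import all_classical reals.

Set Implicit Arguments.
Unset Strict Implicit.
Unset Printing Implicit Defensive.

Import Order.TTheory GRing.Theory Num.Theory.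

Local Open Scope classical_set_scope.
Local Open Scope ring_scope.

(* A Euclidean space is a [V : vectType R] over [R : realType] together with a
   positive definite symmetric bilinear form [ip : {dot V for idfun}]. *)

Section RootSystems.
Variables (R : realType) (V : vectType R) (ip : {dot V for idfun}).

Definition reflection (alpha v : V) : V :=
  v - (2 * ip v alpha / ip alpha alpha) *: alpha.

Record root_system_in (U : {vspace V}) (Phi : set V) : Prop := RootSystemIn {
  rs_finite : finite_set Phi;
  rs_span : <<fset_set Phi>>%VS = U;
  rs_nonzero : forall alpha, Phi alpha -> alpha != 0;
  rs_line : forall alpha, Phi alpha ->
    [set c *: alpha | c in [set: R]] `&` Phi = [set alpha; - alpha];
  rs_reflection : forall alpha, Phi alpha -> reflection alpha @` Phi = Phi }.

Definition root_system (Phi : set V) : Prop := root_system_in fullv Phi.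

(* Two parts suffice: an orthogonal union of more than two root systems is an
   orthogonal union of two, by grouping parts. *)
Definition irreducible (Phi : set V) : Prop :=
  ~ exists (U1 U2 : {vspace V}) (Phi1 Phi2 : set V),
      [/\ Phi1 !=set0 /\ Phi2 !=set0,
          root_system_in U1 Phi1 /\ root_system_in U2 Phi2,
          (forall u v, u \in U1 -> v \in U2 -> ip u v = 0)
        & Phi = Phi1 `|` Phi2].

Record compatible_total_order (le : rel V) : Prop := CompatibleTotalOrder {
  cto_refl : reflexive le;
  cto_anti : antisymmetric le;
  cto_trans : transitive le;
  cto_total : total le;
  cto_add : forall u v w, le u v -> le (u + w) (v + w);
  cto_scale : forall (c : R) u v, 0 <= c -> le u v -> le (c *: u) (c *: v) }.

Definition positive_system (Phi P : set V) : Prop :=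
  exists2 le : rel V, compatible_total_order le
    & P = [set alpha | Phi alpha /\ le 0 alpha /\ alpha != 0].

Definition nonneg_span (A : set V) : set V :=
  [set v | exists (k : nat) (a : 'I_k -> V) (c : 'I_k -> R),
     [/\ forall i, A (a i), forall i, 0 <= c i & v = \sum_i c i *: a i]].

Definition cone (P A : set V) : set V := nonneg_span A `&` P.

Definition really_abelian (P A : set V) : Prop :=
  A `<=` P /\ forall B, B `<=` A -> cone P B = B.

Definition max_really_abelian_size (P : set V) (N : nat) : Prop :=
  (exists2 A, really_abelian P A & (A #= `I_N)%card) /\
  (forall A, really_abelian P A -> (A #<= `I_N)%card).

End RootSystems.

Section Helly.
Variable T : Type.

(* The index set [J] ranges over [I] itself and all complements of points; for
   [I] empty or a point this uses [cl set0 = set0]. *)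
Definition helly_independent (S : set T) (cl : set T -> set T)
    (I : Type) (A : I -> set T) : Prop :=
  (forall i, A i !=set0 /\ A i `<=` S) /\
  \bigcap_(J in [set: I] |` [set [set~ i] | i in [set: I]])
    cl (\bigcup_(j in J) A j) = set0.

Definition helly_number (S : set T) (cl : set T -> set T) (h : nat) : Prop :=
  (exists (I : finType) (A : I -> set T),
     helly_independent S cl A /\ #|I| = h) /\
  (forall (I : finType) (A : I -> set T),
     helly_independent S cl A -> (#|I| <= h)%N).

End Helly.

(* Root systems need not be crystallographic and root lengths are immaterial, so
   the type is the type of the Coxeter matrix, whose entry at (i, j) is the order
   of the product of the i-th and j-th simple reflections. In particular B_n and
   C_n coincide, G_2 is I_2(6), and A_2, B_2 are I_2(3), I_2(4). *)
Variant root_type :=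
  | type_A of nat | type_BC of nat | type_D of nat
  | type_E6 | type_E7 | type_E8 | type_F4 | type_G2
  | type_I2 of nat | type_H3 | type_H4.

Definition valid_type (T : root_type) : bool :=
  match T with
  | type_A n => 1 <= n
  | type_BC n => 2 <= n
  | type_D n => 4 <= n
  | type_I2 m => 3 <= m
  | _ => true
  end%N.

Definition rank_of (T : root_type) : nat :=
  match T with
  | type_A n | type_BC n | type_D n => n
  | type_E6 => 6 | type_E7 => 7 | type_E8 => 8 | type_F4 => 4
  | type_G2 | type_I2 _ => 2
  | type_H3 => 3 | type_H4 => 4
  end%N.

(* Labels for [i < j], where [2] means that [i] and [j] are not joined.
   [chain_label s]: the path 0 - 1 - ... whose edge {i, i+1} has label s_i.
   [fork_label n k]: the path 0 - ... - (n-2) and the node n-1 joined to k,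
   with all edges labelled 3. *)
Definition chain_label (s : seq nat) (i j : nat) : nat :=
  if j == i.+1 then nth 2%N s i else 2%N.

Definition fork_label (n k i j : nat) : nat :=
  if (j == i.+1) && (j < n.-1)%N || (j == n.-1) && (i == k)
  then 3%N else 2%N.

Definition edge_label (T : root_type) : nat -> nat -> nat :=
  match T with
  | type_A n => chain_label (nseq n.-1 3)
  | type_BC n => chain_label (rcons (nseq n.-2 3) 4)
  | type_D n => fork_label n (n - 3)
  | type_E6 => fork_label 6 2
  | type_E7 => fork_label 7 2
  | type_E8 => fork_label 8 2
  | type_F4 => chain_label [:: 3; 4; 3]
  | type_G2 => chain_label [:: 6]
  | type_I2 m => chain_label [:: m]
  | type_H3 => chain_label [:: 3; 5]
  | type_H4 => chain_label [:: 3; 3; 5]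
  end%N.

Definition coxeter_matrix (T : root_type) (i j : nat) : nat :=
  if i == j then 1%N else edge_label T (minn i j) (maxn i j).

Definition map_order (X : Type) (f : X -> X) (m : nat) : Prop :=
  [/\ (0 < m)%N, iter m f =1 id
    & forall k, (0 < k < m)%N -> ~ iter k f =1 id].

Section Types.
Variables (R : realType) (V : vectType R) (ip : {dot V for idfun}).

Definition simple_system (Phi : set V) (n : nat) (Delta : n.-tuple V) : Prop :=
  [/\ basis_of fullv Delta,
      forall i, Phi (tnth Delta i)
    & forall beta, Phi beta ->
        (forall i, 0 <= coord Delta i beta) \/
        (forall i, coord Delta i beta <= 0)].

Definition has_type (Phi : set V) (T : root_type) : Prop :=
  exists2 Delta : (rank_of T).-tuple V, simple_system Phi Delta
    & forall i j, map_order
        (reflection ip (tnth Delta i) \o reflection ip (tnth Delta j))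
        (coxeter_matrix T i j).

End Types.

Definition table_value (T : root_type) : nat :=
  match T with
  | type_A n => n.+1 ^ 2 %/ 4
  | type_BC n => 'C(n, 2) + 1
  | type_D n => 'C(n, 2)
  | type_E6 => 16
  | type_E7 => 27
  | type_E8 => 36
  | type_F4 => 6
  | type_G2 => 2
  | type_I2 _ => 2
  | type_H3 => 5
  | type_H4 => 8
  end%N.

(* Main.v *)
(* In a convex geometry the Helly number is the largest size of a free set, so both claims
   say that [table_value T] is the largest size of a free set of positive roots. Choosing
   the simple system inside [P] and rescaling the simple roots, the Coxeter matrix fixes
   the Gram matrix, hence the positive roots up to positive factors, in each type.

   Lower bounds: every root is separated from the other members of an explicit set by a
   linear form. Upper bounds: in type A the left and right ends of the members of a free
   set are disjoint, so that it is a bipartite graph; in types B and D it is an oriented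
   graph, up to a correction; in type E a free set has no negative inner products, and
   can be shifted, keeping this, to an up-closed set, for which a search is short. In
   types F4, H3 and H4 relations between few roots give a hypergraph, and a recorded
   search tree bounds its independent sets. In H4 two members of a free set have inner
   product phi, 1 or 0, and the Weyl group brings such a pair to a standard position
   before the search. *)

From Stdlib Require Import ZArith NArith.
Require Import Defs.
From mathcomp Require Import all_boot all_order all_algebra all_fingroup.
From mathcomp Require Import sesquilinear.
From mathcomp Require Import all_classical reals.
From mathcomp Require Import ring lra zify ssrZ.

Set Implicit Arguments.
Unset Strict Implicit.
Unset Printing Implicit Defensive.

Import Order.TTheory GRing.Theory Num.Theory.

Local Open Scope ring_scope.

(** * Convex geometries *)

(** The closure is a convex geometry because a linear height is positive on all positive roots,
    which gives anti-exchange. Freeness depends only on the rays of the roots, so each type is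
    settled on one normalised model, with vectors chosen for convenient arithmetic. A model is
    compared with [Phi] only through its simple vectors: in a finite set stable under simple
    reflections whose members each have coordinates of one sign, a nonnegative vector is lowered to
    a multiple of a simple one, so model and [Phi] are swept out from the same directions. The types
    [I2(m)], whose cosines fit no fixed table, need no model: being in a plane is enough. [H3] and
    [H4] force exact arithmetic in [Z[phi]], faithful because [phi] is irrational. In type E the
    search bounds the larger class of sets without negative inner products, whose maximum turns out
    to be the same. In [H4] the Weyl group moves sets out of the positive roots, so freeness is
    first transported to the whole root system, opposites included. *)

Section ConvexGeometry.
Variables (T : finType) (cl : {set T} -> {set T}).
Hypothesis cl_ext : forall A : {set T}, A \subset cl A.
Hypothesis cl_mono : forall A B : {set T}, A \subset B -> cl A \subset cl B.
Hypothesis cl_idem : forall A : {set T}, cl (cl A) = cl A.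
Hypothesis cl_antiexchange : forall (A : {set T}) x y,
  x != y -> x \notin cl A -> y \notin cl A -> y \in cl (x |: A) ->
  x \notin cl (y |: A).

(** Take a maximal closed [Y] between [B] and [X] that avoids [x]. Any other point [y] of [X]
    outside [Y] lies in [cl (x |: Y)], so by anti-exchange [cl (y |: Y)] still avoids [x], against
    maximality. Hence [Y] is [X :\ x], which is therefore closed. *)
Lemma extreme_point (B : {set T}) x :
  x \notin cl B -> x \notin cl (cl (x |: B) :\ x).
Proof.
move=> xB; set X := cl (x |: B).
pose p (Y : {set T}) := [&& cl Y == Y, B \subset Y, Y \subset X & x \notin Y].
have p0 : p (cl B).
  rewrite /p cl_idem eqxx cl_ext xB !andbT /=; apply: cl_mono.
  exact: finset.subsetUr.
have [Y /maxsetP[/and4P[/eqP clY BY YX xY] maxY] _] := maxset_exists p0.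
suff <- : Y = X :\ x by rewrite clY.
apply/eqP; rewrite finset.eqEsubset; apply/andP; split; first by rewrite finset.subsetD1 YX xY.
apply/fintype.subsetP => y; rewrite !inE => /andP[yx yX]; apply/negPn/negP => yY.
have yX1 : y \in cl (x |: Y).
  by apply: fintype.subsetP yX; apply: cl_mono; apply: finset.setUS.
have := cl_antiexchange (A := Y) (x := x) (y := y); rewrite clY eq_sym yx xY yY.
move=> /(_ isT isT isT yX1) xn.
have : cl (y |: Y) = Y.
  apply: maxY; last by apply: fintype.subset_trans (cl_ext _); apply: finset.subsetUr.
  rewrite /p cl_idem eqxx xn andbT /=; apply/andP; split.
    by apply: fintype.subset_trans (cl_ext _); apply: fintype.subset_trans BY _; apply: finset.subsetUr.
  have -> : X = cl X by rewrite cl_idem.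
  by apply: cl_mono; rewrite finset.subUset finset.sub1set yX YX.
move=> e; move/negP: yY; apply; rewrite -e; apply: fintype.subsetP (cl_ext _) _ _.
by rewrite !inE eqxx.
Qed.

Variable I : finType.

(** For a Helly independent family, [X] is the closure of its union and [K i] the closure of the
    union without the [i]-th member. Only these properties are kept, since they survive shrinking
    [X] and enlarging the [K i]. *)
Definition helly_family (X : {set T}) (K : I -> {set T}) :=
  [/\ cl X = X, forall i, cl (K i) = K i,
      forall x, x \in X -> exists i, x \notin K i
    & forall i, exists2 x, x \in X & forall j, j != i -> x \in K j].

(* In a smallest [X] carrying such a family, points [x i] of [X] lying in every [K j] but
   [K i] are extreme; replacing each [K i] by [X :\ x i] shows that [X] consists of them. *)
Lemma free_of_helly_family X K : helly_family X K ->
  exists2 S : {set T}, #|S| = #|I| & forall k, k \notin cl (S :\ k).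
Proof.
have [n] := ubnP #|X|; elim: n X K => // n IHn X K leXn fXK.
case: (pselect (exists X' K', helly_family X' K' /\ (#|X'| < #|X|)%N)).
  move=> [X' [K' [f' lt']]]; apply: (IHn X' K') f'.
  exact: leq_trans lt' leXn.
move=> /forallNP Xmin0.
have Xmin X' K' : helly_family X' K' -> (#|X| <= #|X'|)%N.
  move=> f'; rewrite leqNgt; apply/negP => lt'; apply: (Xmin0 X').
  by exists K'; split.
have [clX clK K0 K1] := fXK.
have clsX (A : {set T}) : A \subset X -> cl A \subset X.
  by move=> /cl_mono; rewrite clX.
have [x xX xK] := fin_all_exists2 K1.
have xnK i : x i \notin K i.
  by have [j jP] := K0 _ (xX i); case: (eqVneq j i) jP => [-> //|/xK ->].
have x_inj : injective x.
  move=> i j eij; apply/eqP; apply: contraT => nij.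
  by have := xnK i; rewrite eij xK.
(* The closure of the points [x i], with the closures of all of them but one, is again such a
   family, so minimality applies. *)
have XE : X = cl [set x i | i in I].
  apply/esym/eqP; rewrite eqEcard; apply/andP; split.
    apply: clsX.
    by apply/fintype.subsetP => _ /imsetP[i _ ->].
  apply: (Xmin _ (fun i => cl [set x j | j in I & j != i])); split => //.
  - move=> y yX; have {}yX : y \in X.
      apply: fintype.subsetP yX; apply: clsX.
      by apply/fintype.subsetP => _ /imsetP[i _ ->].
    have [i yi] := K0 y yX; exists i; apply: contra yi => {}yi.
    rewrite -(clK i); apply: fintype.subsetP yi; apply: cl_mono.
    by apply/fintype.subsetP => z /imsetP[j]; rewrite !inE => ji ->; apply: xK; rewrite eq_sym.
  - move=> i; exists (x i); first by apply: fintype.subsetP (cl_ext _) _ _; apply: imset_f.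
    move=> j ji; apply: fintype.subsetP (cl_ext _) _ _; apply: imset_f.
    by rewrite !inE eq_sym.
have xext i : x i \notin cl (X :\ x i).
  have e : [set x j | j in I] = x i |: [set x j | j in I & j != i].
    apply/finset.setP => y; rewrite !inE; apply/imsetP/orP => [[j _ ->]|].
      case: (eqVneq j i) => [->|ji]; first by left.
      by right; apply: imset_f; rewrite inE.
    by move=> [/eqP ->|/imsetP[j _ ->]]; [exists i|exists j].
  rewrite XE e; apply: extreme_point; apply: contra (xnK i) => xi.
  rewrite -(clK i); apply: fintype.subsetP xi; apply: cl_mono.
  by apply/fintype.subsetP => z /imsetP[j]; rewrite !inE => ji ->; apply: xK; rewrite eq_sym.
have clX1 i : cl (X :\ x i) = X :\ x i.
  apply/eqP; rewrite finset.eqEsubset cl_ext andbT finset.subsetD1 xext andbT.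
  by apply: clsX; apply: finset.subsetDl.
(* If [y] differed from [x i], it could take over its role, and [X :\ x i] would carry a smaller
   family. *)
have uniq_pt (K' : I -> {set T}) i y : helly_family X K' ->
    (forall l j, j != l -> x l \in K' j) -> y \in X ->
    (forall j, j != i -> y \in K' j) -> y = x i.
  move=> [_ clK' K0' _] xK' yX yK'; apply/eqP; apply: contraT => yxi.
  suff : helly_family (X :\ x i) K'.
    by move=> /Xmin; rewrite (finset.cardsD1 (x i) X) xX add1n ltnn.
  split=> //; first by move=> z; rewrite inE => /andP[_ /K0'].
  move=> l; case: (eqVneq l i) => [->|li]; first by exists y; rewrite ?inE ?yxi.
  exists (x l); last exact: xK'.
  by rewrite !inE xX andbT; apply: contra_neq li => /x_inj.
(* The replacement is made one index at a time. Once it is made for all, a point lying in no common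
   part must be some [x i], so [X] has no other points. *)
pose Ks (s : seq I) i := if i \in s then X :\ x i else K i.
have xKs s l j : j != l -> x l \in Ks s j.
  rewrite /Ks => jl; case: ifP => _; last by rewrite xK.
  by rewrite !inE xX andbT; apply: contra_neq jl => /x_inj.
have fam s : helly_family X (Ks s).
  elim: s => [|a s IHs]; first exact: fXK.
  split=> //.
  - by move=> i; rewrite /Ks; case: ifP.
  - move=> z zX; case: (pselect (exists i, z \notin Ks (a :: s) i)) => // /forallNP zK.
    have zKs i : z \in Ks (a :: s) i by apply/negPn/negP/zK.
    have za : z = x a.
      apply: (uniq_pt _ _ _ IHs (xKs s)) => // j ja.
      by have := zKs j; rewrite /Ks inE (negbTE ja).
    by have := zKs a; rewrite /Ks mem_head za !inE eqxx.
  - by move=> i; exists (x i) => // j ji; apply: xKs; rewrite // eq_sym.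
have Xx y : y \in X -> exists i, y = x i.
  move=> yX; have [_ _ /(_ y yX)[i yi] _] := fam (enum I); move: yi.
  rewrite /Ks mem_enum /= !inE yX andbT negbK => /eqP ->; by exists i.
exists X.
  have -> : X = [set x i | i in I].
    apply/finset.setP => y; apply/idP/imsetP => [/Xx[i ->]|[i _ ->]] //.
    by exists i.
  by rewrite card_imset.
move=> k; case: (boolP (k \in X)) => [/Xx[i ->] //|kX].
by apply: contra kX => kX; apply: fintype.subsetP kX; apply: clsX; apply: finset.subsetDl.
Qed.

End ConvexGeometry.

(** * Cones of positive roots *)

Section Conic.
Variables (R : realType) (V : vectType R) (I : finType) (r : I -> V).

Definition conic (B : {set I}) (v : V) : Prop :=
  exists2 c : I -> R, forall i, 0 <= c i & v = \sum_(i in B) c i *: r i.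

(** With [k] ranging over all indices, this says at once that [S] is closed ([k] outside [S]) and
    that its members are extreme ([k] inside); together these make every subset of [S] closed. *)
Definition free_family (S : {set I}) : Prop :=
  forall k, ~ conic (S :\ k) (r k).

Lemma conic0 B : conic B 0.
Proof.
by exists (fun=> 0) => //; rewrite big1 // => i _; rewrite scale0r.
Qed.

Lemma conicD B u v : conic B u -> conic B v -> conic B (u + v).
Proof.
move=> [c c0 ->] [d d0 ->]; exists (fun i => c i + d i).
  by move=> i; rewrite addr_ge0.
by rewrite -big_split; apply: eq_bigr => i _; rewrite /= scalerDl.
Qed.

Lemma conicZ B a v : 0 <= a -> conic B v -> conic B (a *: v).
Proof.
move=> a0 [c c0 ->]; exists (fun i => a * c i); first by move=> i; rewrite mulr_ge0.
by rewrite scaler_sumr; apply: eq_bigr => i _; rewrite scalerA.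
Qed.

Lemma conic_gen (B : {set I}) i : i \in B -> conic B (r i).
Proof.
move=> iB; exists (fun j => (j == i)%:R) => [j|]; first by rewrite ler0n.
rewrite (bigD1 i) //= eqxx scale1r big1 ?addr0 // => j /andP[_ /negbTE ->].
by rewrite scale0r.
Qed.

Lemma conic_sum (J : Type) (s : seq J) (p : pred J) (F : J -> V) B :
  (forall j, p j -> conic B (F j)) -> conic B (\sum_(j <- s | p j) F j).
Proof.
by move=> FB; apply: big_ind => //; [apply: conic0|apply: conicD].
Qed.

Lemma conic_trans (B B' : {set I}) v :
  (forall i, i \in B -> conic B' (r i)) -> conic B v -> conic B' v.
Proof.
by move=> BB' [c c0 ->]; apply: conic_sum => i iB; apply: conicZ => //; exact: BB'.
Qed.

Lemma conicS (B B' : {set I}) v : B \subset B' -> conic B v -> conic B' v.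
Proof.
by move=> /fintype.subsetP BB'; apply: conic_trans => i /BB'; exact: conic_gen.
Qed.

Lemma conicU1 B x v : conic (x |: B) v ->
  exists c u, [/\ 0 <= c, conic B u & v = u + c *: r x].
Proof.
case: (boolP (x \in B)) => xB.
  rewrite (finset.setUidPr _) ?finset.sub1set // => vB; exists 0, v; split=> //.
  by rewrite scale0r addr0.
move=> [c c0 ->]; rewrite big_setU1 //=.
by exists (c x), (\sum_(i in B) c i *: r i); split; [|exists c|rewrite addrC].
Qed.

Lemma nonneg_spanE (B : {set I}) :
  nonneg_span [set r i | i in [set` B]]%classic = conic B.
Proof.
apply/funext => v; apply/propext; split=> [[k [a [c [aB c0 ->]]]]|[c c0 ->]].
  by apply: conic_sum => i _; have [j jB <-] := aB i; apply: conicZ => //; exact: conic_gen.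
exists #|B|, (fun i => r (enum_val i)), (fun i => c (enum_val i)); split => //.
  by move=> i; exists (enum_val i) => //=; exact: enum_valP.
by rewrite big_enum_val.
Qed.

End Conic.

Section RayFamily.
Variables (R : realType) (V : vectType R) (I : finType) (r : I -> V).
Variable h : V -> R.
Hypothesis hD : forall u v, h (u + v) = h u + h v.
Hypothesis hZ : forall c v, h (c *: v) = c * h v.
Hypothesis h_gt0 : forall i, 0 < h (r i).
Hypothesis r_ray : forall i j c, r j = c *: r i -> i = j.

Lemma height_sum (B : {set I}) (c : I -> R) :
  h (\sum_(i in B) c i *: r i) = \sum_(i in B) c i * h (r i).
Proof.
have h0 : h 0 = 0 by rewrite -(scale0r 0) hZ mul0r.
by elim/big_rec2: _ => // i y v _ <-; rewrite hD hZ.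
Qed.

Lemma conic_height_ge0 B v : conic r B v -> 0 <= h v.
Proof.
move=> [c c0 ->]; rewrite height_sum; apply: sumr_ge0 => i _.
by rewrite mulr_ge0 // ltW.
Qed.

Lemma conic_height_eq0 B v : conic r B v -> h v = 0 -> v = 0.
Proof.
move=> [c c0 ->] /eqP; rewrite height_sum psumr_eq0; last first.
  by move=> i _; rewrite mulr_ge0 // ltW.
move=> /allP hc; apply: big1 => i iB.
have := hc i; rewrite mem_index_enum iB /= mulf_eq0 (gt_eqF (h_gt0 i)) orbF.
by move=> /(_ isT)/eqP ->; rewrite scale0r.
Qed.

Definition ray_closure (B : {set I}) : {set I} := [set k | `[<conic r B (r k)>]].

Lemma ray_closureP B k : reflect (conic r B (r k)) (k \in ray_closure B).
Proof. by rewrite inE; exact: asboolP. Qed.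

Lemma ray_closure_ext (A : {set I}) : A \subset ray_closure A.
Proof. by apply/fintype.subsetP => k kA; apply/ray_closureP; exact: conic_gen. Qed.

Lemma ray_closure_mono (A B : {set I}) :
  A \subset B -> ray_closure A \subset ray_closure B.
Proof.
move=> AB; apply/fintype.subsetP => k /ray_closureP kA; apply/ray_closureP.
exact: conicS kA.
Qed.

Lemma ray_closure_idem A : ray_closure (ray_closure A) = ray_closure A.
Proof.
apply/eqP; rewrite finset.eqEsubset ray_closure_ext andbT.
apply/fintype.subsetP => k /ray_closureP kA; apply/ray_closureP.
by apply: conic_trans kA => i /ray_closureP.
Qed.

(** Write [y = b + c x] and [x = b' + c' y] with [b], [b'] in the cone of [A]; then
    [(1 - c c') y = b + c b']. If [c c' < 1], then [y] is in that cone. Otherwise the right side has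
    height at most 0, so [b = 0] and [y] is proportional to [x]. *)
Lemma ray_closure_antiexchange (A : {set I}) x y : x != y ->
  x \notin ray_closure A -> y \notin ray_closure A ->
  y \in ray_closure (x |: A) -> x \notin ray_closure (y |: A).
Proof.
move=> xy /ray_closureP xA /ray_closureP yA.
move=> /ray_closureP/conicU1[c [b [c0 bA yE]]].
apply/ray_closureP => /conicU1[c' [b' [c'0 b'A xE]]].
have yE' : r y = b + c *: b' + (c * c') *: r y.
  by rewrite {1}yE xE scalerDr scalerA addrA.
have e : (1 - c * c') *: r y = b + c *: b'.
  by rewrite scalerBl scale1r {1}yE' addrK.
have eA : conic r A (b + c *: b') by apply: conicD => //; exact: conicZ.
have [lt1|ge1] := ltP (c * c') 1.
  apply: yA; rewrite -[r y]scale1r -(@mulVf _ (1 - c * c')); last by rewrite subr_eq0 gt_eqF.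
  by rewrite -scalerA e; apply: conicZ => //; rewrite invr_ge0 subr_ge0 ltW.
have hb : h b = 0.
  apply/eqP; rewrite eq_le (conic_height_ge0 bA) andbT.
  have := congr1 h e; rewrite hZ hD hZ => he.
  have hb' : 0 <= c * h b' by rewrite mulr_ge0 // (conic_height_ge0 b'A).
  have : (1 - c * c') * h (r y) <= 0 by rewrite mulr_le0_ge0 ?subr_le0 // ltW.
  lra.
move: yE; rewrite (conic_height_eq0 bA hb) add0r => /r_ray e'.
by rewrite e' eqxx in xy.
Qed.

Lemma free_familyP (S : {set I}) :
  reflect (free_family r S) [forall k, k \notin ray_closure (S :\ k)].
Proof.
apply: (iffP forallP) => fS k; first by move/ray_closureP; apply/negP.
by apply/negP => /ray_closureP; exact: fS.
Qed.

Variables (P : set V) (N : nat).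
Hypothesis PE : P = [set r k | k in [set: I]]%classic.
Hypothesis free_ex : exists2 S : {set I}, free_family r S & #|S| = N.
Hypothesis free_le : forall S : {set I}, free_family r S -> (#|S| <= N)%N.

Let r_inj : injective r.
Proof. by move=> i j e; apply: (@r_ray _ _ 1); rewrite scale1r. Qed.

Let Pr k : P (r k). Proof. by rewrite PE; exists k. Qed.

Let img (B : {set I}) : set V := [set r i | i in [set` B]]%classic.

Let cone_img (B : {set I}) : cone P (img B) = img (ray_closure B).
Proof.
apply/funext => v; apply/propext; rewrite /cone /img nonneg_spanE; split.
  by move=> [vB]; rewrite PE => -[k _ e]; exists k => //=; apply/ray_closureP; rewrite e.
by move=> [k /= /ray_closureP kB <-]; split.
Qed.

Let preim (A : set V) : {set I} := [set k | `[<A (r k)>]].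

Let img_preim (A : set V) : (A `<=` P)%classic -> img (preim A) = A.
Proof.
move=> AP; apply/funext => v; apply/propext; split.
  by move=> [k /=]; rewrite inE => /asboolP ? <-.
move=> Av; have := AP _ Av; rewrite PE => -[k _ e]; exists k => //=.
by rewrite inE; apply/asboolP; rewrite e.
Qed.

Let preim_img (B : {set I}) : preim (img B) = B.
Proof.
apply/finset.setP => k; rewrite inE; apply/asboolP/idP => [[j jB /r_inj <- //]|kB].
by exists k.
Qed.

Let abelian_free (B : {set I}) : really_abelian P (img B) <-> free_family r B.
Proof.
split=> [[_ cB] k kB|fB].
  have kB' : k \in ray_closure (B :\ k) by apply/ray_closureP.
  have := cB (img (B :\ k)); rewrite cone_img => /(_ _) e.
  have /(congr1 preim) : img (ray_closure (B :\ k)) = img (B :\ k).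
    by apply: e => v [i /= ]; rewrite !inE => /andP[_ iB] <-; exists i.
  by rewrite !preim_img => e'; move: kB'; rewrite e' !inE eqxx.
split; first by move=> v [i _ <-].
move=> C CB; have CP : (C `<=` P)%classic by move=> v /CB[i _ <-].
rewrite -(img_preim CP) cone_img; congr img; apply/eqP.
rewrite finset.eqEsubset ray_closure_ext andbT; apply/fintype.subsetP => k.
move=> /ray_closureP kC; apply: contraT => nk; case: (fB k).
apply: conicS kC; apply/fintype.subsetP => i iC; rewrite !inE; apply/andP; split.
  by apply: contraNneq nk => <-.
move: iC; rewrite inE => /asboolP /CB [j /= jB /r_inj <-] //.
Qed.

Let card_img (B : {set I}) : (img B #= `I_#|B|)%card.
Proof.
have -> : img B = [set r (enum_val i) | i in [set: 'I_#|B|]]%classic.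
  apply/funext => v; apply/propext; split=> [[k /= kB <-]|[i _ <-]].
    by exists (enum_rank_in kB k); rewrite ?enum_rankK_in.
  by exists (enum_val i) => //=; exact: enum_valP.
apply: (@card_eq_trans _ _ _ _ [set: 'I_#|B|]%classic); last exact: card_esym card_II.
by apply: inj_card_eq => i j _ _ /r_inj/enum_val_inj.
Qed.

Lemma max_really_abelian_size_family : max_really_abelian_size P N.
Proof.
split.
  have [S fS <-] := free_ex; exists (img S); first exact/abelian_free.
  exact: card_img.
move=> A aA; have AP := proj1 aA; rewrite -(img_preim AP).
have fA : free_family r (preim A) by apply/abelian_free; rewrite img_preim.
by rewrite (card_le_eql (card_img _)) card_le_II; exact: free_le.
Qed.

(** The singletons of a free set are Helly independent: a root in all the closures would be a member
    [k], the set being closed, and would lie in the cone of the others. Conversely, closures of a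
    Helly independent family form a [helly_family], which yields a free set of the same size. *)
Lemma helly_number_family : helly_number P (cone P) N.
Proof.
split.
  have [S fS <-] := free_ex.
  exists 'I_#|S|, (fun i => [set r (enum_val i)]%classic); split; last by rewrite card_ord.
  split=> [i|].
    by split; [exists (r (enum_val i))|move=> _ ->; exact: Pr].
  rewrite -subset0 => v vK.
  have vJ J : ([set: 'I_#|S|] |` [set [set~ i] | i in [set: 'I_#|S|]])%classic J ->
      cone P (img [set enum_val i | i in [pred i | `[<J i>]]]) v.
    move=> /vK; set U := (\bigcup_(j in J) _)%classic.
    suff -> : U = img [set enum_val i | i in [pred i | `[<J i>]]] by [].
    apply/funext => w; apply/propext; split.
      move=> [j Jj ->]; exists (enum_val j) => //=.
      by apply/imsetP; exists j => //; rewrite unfold_in; exact: asboolT.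
    move=> [k /= /imsetP[j]]; rewrite unfold_in => /asboolW Jj -> <-.
    by exists j.
  have := vJ _ (or_introl erefl); rewrite cone_img => -[k /= kS kv].
  have {kS} kS : k \in S.
    apply/negPn/negP => nk; have /free_familyP/forallP/(_ k)/negP := fS; apply.
    apply: fintype.subsetP kS; apply: ray_closure_mono.
    apply/fintype.subsetP => _ /imsetP[j _ ->]; rewrite !inE enum_valP andbT.
    by apply: contraNneq nk => <-; exact: enum_valP.
  pose i := enum_rank_in kS k.
  have := vJ [set~ i]%classic; rewrite cone_img => -[|l /= lS lv].
    by right; exists i.
  have {lv lS} : k \in ray_closure (S :\ k).
    have <- : l = k by apply: r_inj; rewrite lv kv.
    apply: fintype.subsetP lS; apply: ray_closure_mono.
    apply/fintype.subsetP => z /imsetP[j]; rewrite unfold_in => /asboolW /= ji ->.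
    change (enum_val j \in S :\ l); rewrite !inE enum_valP andbT; apply/eqP => e; apply: ji.
    have lk : l = k by apply: r_inj; rewrite lv kv.
    by apply: enum_val_inj; rewrite e lk enum_rankK_in.
  by apply/negP; have /free_familyP/forallP := fS; apply.
move=> J A [A0 AK].
pose K i := ray_closure (\bigcup_(j | j != i) preim (A j)).
have clK B : ray_closure (ray_closure B) = ray_closure B by exact: ray_closure_idem.
have preimU (C : set J) : (\bigcup_(j in C) A j)%classic =
    img (\bigcup_(j | j \in [pred j | `[<C j>]]) preim (A j)).
  rewrite -(img_preim (A := (\bigcup_(j in C) A j)%classic)); last first.
    by move=> v [j _ Ajv]; exact: (proj2 (A0 j)).
  congr img; apply/finset.setP => k; rewrite inE.
  apply/idP/finset.bigcupP => [/asboolW[j Cj Ajk]|[j Cj]].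
    by exists j; [exact: asboolT|rewrite inE; exact: asboolT].
  rewrite inE => /asboolW Ajk; apply: asboolT; exists j => //.
  exact: asboolW Cj.
have fam : helly_family ray_closure (ray_closure (\bigcup_j preim (A j))) K.
  split=> [||k kX|i]; rewrite ?clK //; first by move=> i; rewrite clK.
    case: (pselect (exists i, k \notin K i)) => // /forallNP kK.
    suff : (set0 : set V) (r k) by [].
    rewrite -AK => _ [->|[i _ <-]]; rewrite preimU cone_img; exists k => //=.
      apply: fintype.subsetP kX; apply: ray_closure_mono.
      by apply/bigcupsP => j _; apply: finset.bigcup_sup; exact: asboolT.
    have /negP := kK i; rewrite negbK; apply: fintype.subsetP.
    apply: ray_closure_mono; apply/bigcupsP => j ji; apply: finset.bigcup_sup.
    by apply: asboolT; apply/eqP.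
  have [[v Aiv] AP] := A0 i; have := AP v Aiv; rewrite PE => -[k _ kv].
  have ki : k \in preim (A i) by rewrite inE; apply/asboolP; rewrite kv.
  exists k.
    by apply: fintype.subsetP (ray_closure_ext _) _ _; apply/finset.bigcupP; exists i.
  move=> j ji; apply: fintype.subsetP (ray_closure_ext _) _ _.
  by apply/finset.bigcupP; exists i; rewrite // eq_sym.
have [S <- fS] := free_of_helly_family ray_closure_ext ray_closure_mono
  ray_closure_idem ray_closure_antiexchange fam.
by apply: free_le; apply/free_familyP/forallP.
Qed.
End RayFamily.

(** * Simple systems *)

Section Reflections.
Variables (R : realType) (V : vectType R) (ip : {dot V for idfun}).
Implicit Types u v w a : V.

Lemma ipDl u v w : ip (u + v) w = ip u w + ip v w.
Proof. exact: linearDl. Qed.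

Lemma ipZl c u w : ip (c *: u) w = c * ip u w.
Proof. exact: linearZl_LR. Qed.

Lemma ipC u v : ip u v = ip v u.
Proof. by have := hermC ip u v; rewrite expr0 mul1r. Qed.

Lemma ipDr u v w : ip w (u + v) = ip w u + ip w v.
Proof. by rewrite ipC ipDl !(ipC w). Qed.

Lemma ipZr c u w : ip w (c *: u) = c * ip w u.
Proof. by rewrite ipC ipZl (ipC w). Qed.

Lemma ipNl u w : ip (- u) w = - ip u w.
Proof. by rewrite -scaleN1r ipZl mulN1r. Qed.

Lemma ipNr u w : ip w (- u) = - ip w u.
Proof. by rewrite ipC ipNl (ipC w). Qed.

Lemma ip0l w : ip 0 w = 0.
Proof. by rewrite -(scale0r 0) ipZl mul0r. Qed.

Lemma ip_suml (J : Type) (s : seq J) (p : pred J) (F : J -> V) w :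
  ip (\sum_(j <- s | p j) F j) w = \sum_(j <- s | p j) ip (F j) w.
Proof. by apply: (big_morph (ip^~ w)) => [u v|]; [apply: ipDl|apply: ip0l]. Qed.

Lemma ip_gt0 v : v != 0 -> 0 < ip v v.
Proof. exact: neq0_dnorm_gt0. Qed.

Definition ipE := (ipDl, ipDr, ipZl, ipZr, ipNl, ipNr).

Lemma reflE a v : reflection ip a v = v - (2 * ip v a / ip a a) *: a.
Proof. by []. Qed.

Lemma reflD a u v : reflection ip a (u + v) = reflection ip a u + reflection ip a v.
Proof.
rewrite /reflection ipDl mulrDr mulrDl scalerDl opprD.
by rewrite -!addrA; congr (_ + _); rewrite addrCA.
Qed.

Lemma reflZ a c v : reflection ip a (c *: v) = c *: reflection ip a v.
Proof.
by rewrite /reflection ipZl scalerBr scalerA mulrCA !mulrA.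
Qed.

Lemma reflN a v : reflection ip a (- v) = - reflection ip a v.
Proof. by rewrite -!scaleN1r reflZ. Qed.

Lemma refl_sum a (J : Type) (s : seq J) (F : J -> V) :
  reflection ip a (\sum_(j <- s) F j) = \sum_(j <- s) reflection ip a (F j).
Proof.
apply: (big_morph (reflection ip a)) => [u v|]; first exact: reflD.
by have := reflZ a 0 0; rewrite !scale0r.
Qed.

Lemma reflK a v : a != 0 -> reflection ip a (reflection ip a v) = v.
Proof.
move=> a0; have aa : ip a a != 0 by rewrite gt_eqF // ip_gt0.
rewrite {2}/reflection reflD reflN reflZ.
have -> : reflection ip a a = - a.
  by rewrite /reflection mulfK // scaler_nat mulr2n opprD addrA subrr add0r.
by rewrite scalerN opprK /reflection subrK.
Qed.

Lemma ip_refl a u v : a != 0 ->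
  ip (reflection ip a u) (reflection ip a v) = ip u v.
Proof.
move=> a0; have aa : ip a a != 0 by rewrite gt_eqF // ip_gt0.
by rewrite /reflection !ipE (ipC a v); field.
Qed.

Lemma refl_scale a c v : c != 0 -> reflection ip (c *: a) v = reflection ip a v.
Proof.
move=> c0; have [->|a0] := eqVneq a 0; first by rewrite scaler0.
have aa : ip a a != 0 by rewrite gt_eqF // ip_gt0.
by rewrite /reflection !ipE scalerA; congr (_ - _ *: _); field; rewrite aa.
Qed.

Lemma refl_refl a u v : a != 0 -> u != 0 ->
  reflection ip (reflection ip a u) v
  = reflection ip a (reflection ip u (reflection ip a v)).
Proof.
move=> a0 u0; rewrite -{1}(reflK v a0); set w := reflection ip a v.
by rewrite (reflE (reflection ip a u)) (reflE u w) !ip_refl // reflD reflN reflZ.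
Qed.

End Reflections.

Lemma count_predD1_lt (T : eqType) (p : pred T) (x : T) (s : seq T) :
  x \in s -> p x -> (count (predD1 p x) s < count p s)%N.
Proof.
move=> xs px; have -> : count p s = (count (predD1 p x) s + count (pred1 x) s)%N.
  elim: s {xs} => //= y s ->; rewrite addnACA; congr (_ + _)%N.
  by case: eqVneq => [->|_]; rewrite ?px ?addn0.
by rewrite -[X in (X < _)%N]addn0 ltn_add2l -has_count has_pred1.
Qed.

(** * Simple systems inside a positive system *)

Section Adapted.
Variables (R : realType) (V : vectType R) (ip : {dot V for idfun}).
Variables (Phi P : set V).
Hypotheses (PhiR : root_system ip Phi) (PP : positive_system Phi P).

Lemma root_neq0 v : Phi v -> v != 0. Proof. exact: rs_nonzero PhiR v. Qed.

Lemma root_refl a v : Phi a -> Phi v -> Phi (reflection ip a v).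
Proof.
move=> Pa Pv; have e := rs_reflection PhiR Pa.
by rewrite -[X in X (reflection _ _ _)]e; exists v.
Qed.

Lemma rootN v : Phi v -> Phi (- v).
Proof.
move=> Pv; have e := rs_line PhiR Pv.
have : (([set c *: v | c in [set: R]] `&` Phi) (- v))%classic by rewrite e; right.
by move=> [].
Qed.

Lemma root_line v c : Phi v -> Phi (c *: v) -> c = 1 \/ c = - 1.
Proof.
move=> Pv Pcv; have e := rs_line PhiR Pv.
have : (([set c *: v | c in [set: R]] `&` Phi) (c *: v))%classic by split => //; exists c.
rewrite e => -[/eqP|/eqP]; rewrite ?addr_eq0.
  rewrite -subr_eq0 -[X in _ - X]scale1r -scalerBl scaler_eq0 (negbTE (root_neq0 Pv)).
  by rewrite orbF subr_eq0 => /eqP; left.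
rewrite -addr_eq0 -[X in _ + X]scale1r -scalerDl scaler_eq0 (negbTE (root_neq0 Pv)).
by rewrite orbF addr_eq0 => /eqP; right.
Qed.

Lemma positive_or v : Phi v -> P v \/ P (- v).
Proof.
have [le [_ _ _ tot add _] ->] := PP.
move=> Pv; have v0 := root_neq0 Pv.
have [|le0] := orP (tot 0 v); first by left.
right; split; [exact: rootN|split; last by rewrite oppr_eq0].
by have := add _ _ (- v) le0; rewrite subrr add0r.
Qed.

Lemma positive_conic n (a : 'I_n -> V) (c : 'I_n -> R) :
  (forall i, P (a i)) -> (forall i, 0 <= c i) ->
  Phi (\sum_i c i *: a i) -> P (\sum_i c i *: a i).
Proof.
have [le [lexx anti tr tot add sc] ->] := PP.
move=> aP c0 Ps; split => //; split; last exact: root_neq0.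
elim/big_ind: _ => [|u v u0 v0|i _]; first exact: lexx.
  by apply: tr u0 _; have := add _ _ u v0; rewrite add0r addrC.
by have [_ [/(sc _ _ _ (c0 i)) + _]] := aP i; rewrite scaler0.
Qed.

Lemma positive_root v : P v -> Phi v.
Proof. by have [le _ ->] := PP; case. Qed.

Lemma positiveN v : P v -> ~ P (- v).
Proof.
have [le [lexx anti tr tot add sc] ->] := PP.
move=> [_ [v0 vn0]] [_ [Nv0 _]].
have := add _ _ v Nv0; rewrite add0r addNr => v0'.
by move/eqP: vn0; apply; apply: anti; rewrite v0 v0'.
Qed.

Variables (n : nat) (m : 'I_n -> 'I_n -> nat).

Definition coxeter_orders (Delta : n.-tuple V) := forall i j,
  map_order (reflection ip (tnth Delta i) \o reflection ip (tnth Delta j)) (m i j).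

Section Coordinates.
Variable Delta : n.-tuple V.
Hypothesis D : simple_system Phi Delta.

Lemma coord_sum v : v = \sum_i coord Delta i v *: tnth Delta i.
Proof.
have [bD _ _] := D; have := coord_basis bD (memvf v) => {1}->.
by apply: eq_bigr => i _; rewrite (tnth_nth 0).
Qed.

Lemma coord_simple i j : coord Delta i (tnth Delta j) = (i == j)%:R.
Proof.
have [bD _ _] := D; have fD := basis_free bD.
by rewrite (tnth_nth 0) coord_free // eq_sym.
Qed.

Lemma simple_neq0 i : tnth Delta i != 0.
Proof. by have [_ DP _] := D; apply: root_neq0. Qed.

(* A simple reflection permutes the positive roots other than its own root. *)
Lemma simple_refl_nonneg i v : Phi v -> (forall j, 0 <= coord Delta j v) ->
  v != tnth Delta i ->
  forall j, 0 <= coord Delta j (reflection ip (tnth Delta i) v).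
Proof.
have [bD DP sgn] := D => Pv v0 vi; have Psv := root_refl (DP i) Pv.
have [//|neg] := sgn _ Psv; exfalso.
have vj j : j != i -> coord Delta j v = 0.
  move=> ji; apply/eqP; rewrite eq_le v0 andbT; have := neg j.
  by rewrite /reflection linearB linearZ /= coord_simple (negbTE ji) mulr0 subr0.
have vE : v = coord Delta i v *: tnth Delta i.
  rewrite {1}(coord_sum v) (bigD1 i) //= big1 ?addr0 // => j ji.
  by rewrite vj // scale0r.
have [c1|cN1] : coord Delta i v = 1 \/ coord Delta i v = -1.
- by apply: (root_line (DP i)); rewrite -vE.
- by move/eqP: vi; apply; rewrite vE c1 scale1r.
- by have := v0 i; rewrite cN1 => /le_gtF; rewrite ltrN10.
Qed.

Variable i : 'I_n.
Let s := reflection ip (tnth Delta i).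
Let Delta' : n.-tuple V := [tuple of map s Delta].

Let sE v : v = \sum_j coord Delta j (s v) *: tnth Delta' j.
Proof.
have e : v = s (\sum_j coord Delta j (s v) *: tnth Delta j).
  by rewrite -coord_sum /s reflK ?simple_neq0.
by rewrite {1}e {1}/s refl_sum; apply: eq_bigr => j _; rewrite reflZ tnth_map.
Qed.

Let basis' : basis_of fullv Delta'.
Proof.
have [bD _ _] := D; rewrite basisEdim; apply/andP; split; last first.
  by rewrite (size_basis bD) !size_tuple.
apply/subvP => v _; rewrite (sE v); apply: memv_suml => j _.
by apply: memvZ; apply: memv_span; exact: mem_tnth.
Qed.

Lemma coord_map_refl j v : coord Delta' j v = coord Delta j (s v).
Proof.
rewrite {1}(sE v) (eq_bigr (fun j => coord Delta j (s v) *: Delta'`_j)).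
  by rewrite coord_sum_free // (basis_free basis').
by move=> k _; rewrite (tnth_nth 0).
Qed.

Lemma simple_system_refl : simple_system Phi Delta'.
Proof.
have [_ DP sgn] := D; split=> [//|j|v Pv].
  by rewrite tnth_map; apply: root_refl.
by have [sv|sv] := sgn (s v) (root_refl (DP i) Pv); [left|right] => j;
  rewrite coord_map_refl.
Qed.

(** The reflections in the images of the simple roots are conjugates by [s], and conjugation keeps
    orders of products. *)
Lemma coxeter_orders_refl : coxeter_orders Delta -> coxeter_orders Delta'.
Proof.
move=> Dm j k; have [m0 mid mmin] := Dm j k.
have sK : cancel s s by move=> v; rewrite /s reflK // simple_neq0.
pose f := reflection ip (tnth Delta j) \o reflection ip (tnth Delta k).
have itE l v : iter l (reflection ip (tnth Delta' j) \o reflection ip (tnth Delta' k)) v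
    = s (iter l f (s v)).
  elim: l => [|l IHl] /=; first by rewrite sK.
  rewrite IHl !tnth_map /=; rewrite !refl_refl ?simple_neq0 // -/s.
  by rewrite !sK.
split=> // [v|l lm lid]; first by rewrite itE mid sK.
by apply: (mmin l lm) => v; rewrite -[v]sK -/f -(sK (iter _ _ _)) -itE lid.
Qed.

End Coordinates.

(** Induction on the number of roots that are positive for [Delta] but outside [P]. If a simple root
    is outside [P], reflecting [Delta] in it exchanges that root for its opposite, which is in [P],
    and changes no other sign. *)
Lemma adapted_simple_system (Delta : n.-tuple V) :
  simple_system Phi Delta -> coxeter_orders Delta ->
  exists2 Delta' : n.-tuple V, simple_system Phi Delta' /\ coxeter_orders Delta'
    & P = [set v | Phi v /\ forall i, 0 <= coord Delta' i v]%classic.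
Proof.
have /finite_seqP[L LE] := rs_finite PhiR.
pose bad (D : n.-tuple V) v :=
  `[<[/\ Phi v, forall i, 0 <= coord D i v & ~ P v]>].
have [k] := ubnP (count (bad Delta) L); elim: k Delta => // k IHk Delta leDk D Dm.
have [DP|/existsNP[i nPi]] := pselect (forall i, P (tnth Delta i)).
  exists Delta => //; have [_ _ sgn] := D.
  have posP v : Phi v -> (forall i, 0 <= coord Delta i v) -> P v.
    by move=> Pv v0; rewrite (coord_sum D v); apply: positive_conic => //; rewrite -coord_sum.
  apply/funext => v; apply/propext; split=> [Pv|[Pv v0]]; last exact: posP.
  have Phv := positive_root Pv; split=> //.
  have [//|neg] := sgn v Phv; exfalso; apply: (positiveN Pv); apply: posP.
    exact: rootN.
  by move=> i; rewrite linearN /= oppr_ge0.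
pose Delta' : n.-tuple V := [tuple of map (reflection ip (tnth Delta i)) Delta].
have [_ DP sgn] := D.
apply: (IHk Delta'); [|exact: simple_system_refl|exact: coxeter_orders_refl].
rewrite ltnS in leDk; apply: leq_trans leDk.
have iL : tnth Delta i \in L by have := DP i; rewrite LE.
have badi : bad Delta (tnth Delta i).
  by apply/asboolP; split=> // j; rewrite coord_simple.
apply: leq_ltn_trans (count_predD1_lt iL badi); apply: sub_count => v.
move=> /asboolP[Phv v0 nPv]; have s0 := simple_neq0 D i.
have sN : reflection ip (tnth Delta i) (tnth Delta i) = - tnth Delta i.
  by rewrite reflE mulfK ?gt_eqF ?ip_gt0 // scaler_nat mulr2n opprD addrA subrr add0r.
have {}v0 j : 0 <= coord Delta j (reflection ip (tnth Delta i) v).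
  by rewrite -coord_map_refl.
apply/andP; split.
  apply/eqP => e; have := v0 i; rewrite e sN linearN /= coord_simple // eqxx.
  by rewrite oppr_ge0 => /le_gtF; rewrite ltr01.
apply/asboolP; split=> // j; rewrite -(reflK ip v s0).
apply: simple_refl_nonneg => //; first exact: root_refl.
apply/eqP => e; apply: nPv; rewrite -(reflK ip v s0) e sN.
by case: (positive_or (DP i)).
Qed.

End Adapted.

(** * Descent to simple vectors and models of the positive roots *)

Section Frame.
Variables (R : realType) (V : vectType R) (ip : {dot V for idfun}).
Variables (n : nat) (b : 'I_n -> V) (x : 'I_n -> V -> R).

Record frame : Prop := Frame {
  frameD : forall i u v, x i (u + v) = x i u + x i v;
  frameZ : forall i c v, x i (c *: v) = c * x i v;
  frame_sum : forall v, v = \sum_i x i v *: b i;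
  frame_delta : forall i j, x i (b j) = (i == j)%:R }.

Hypothesis F : frame.

Definition word_act (w : seq 'I_n) (v : V) : V :=
  foldr (fun i => reflection ip (b i)) v w.

Lemma frameN i v : x i (- v) = - x i v.
Proof. by rewrite -scaleN1r frameZ // mulN1r. Qed.

Lemma frame_neq0 i : b i != 0.
Proof.
apply/eqP => e; have := frame_delta F i i; rewrite e -(scale0r 0) frameZ // mul0r eqxx.
by move/eqP; rewrite eq_sym oner_eq0.
Qed.

Lemma frame_ext u v : (forall i, x i u = x i v) -> u = v.
Proof.
by move=> e; rewrite (frame_sum F u) (frame_sum F v); apply: eq_bigr => i _; rewrite e.
Qed.

Lemma word_actZ w c v : word_act w (c *: v) = c *: word_act w v.
Proof. by elim: w => //= i w ->; rewrite reflZ. Qed.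

Lemma word_actK w v : word_act (rev w) (word_act w v) = v.
Proof.
elim: w => //= i w IHw; rewrite rev_cons /word_act foldr_rcons.
by rewrite reflK ?frame_neq0.
Qed.

(** What [Phi] has in common with the vectors of a model and their opposites; [descent] is applied
    to both. *)
Definition sign_coherent (Psi : set V) : Prop :=
  [/\ finite_set Psi, forall v, Psi v -> v != 0,
      forall v, Psi v -> (forall i, 0 <= x i v) \/ (forall i, x i v <= 0)
    & forall i v, Psi v -> Psi (reflection ip (b i) v)].

Lemma word_act_stable Psi w v : sign_coherent Psi -> Psi v -> Psi (word_act w v).
Proof. by move=> [_ _ _ st] Pv; elim: w => //= i w IHw; apply: st. Qed.

(* Some simple reflection lowers the height of a nonnegative vector, and keeps it
   nonnegative until it is proportional to a simple one. *)
Lemma descent Psi v : sign_coherent Psi -> Psi v -> (forall i, 0 <= x i v) ->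
  exists w i a, 0 < a /\ v = word_act w (a *: b i).
Proof.
move=> [/finite_seqP[L LE] n0 sgn st].
pose ht u := \sum_i x i u.
have [k] := ubnP (count (fun u => ht u < ht v) L).
elim: k v => // k IHk v; rewrite ltnS => lek Pv v0.
(* The norm [(v, v)] is the sum of the [x_i (v, b_i)]; being positive, it has a positive term. *)
have [i [xi vi]] : exists i, 0 < x i v /\ 0 < ip v (b i).
  apply: contrapT => /forallNP nex.
  have := ip_gt0 ip (n0 v Pv); rewrite {1}(frame_sum F v) ip_suml.
  apply/negP; rewrite -leNgt; apply: sumr_le0 => i _; rewrite ipZl ipC.
  have [xi|] := ltP 0 (x i v); last first.
    move=> xi; have -> : x i v = 0 by apply/eqP; rewrite eq_le xi v0.
    by rewrite mul0r.
  apply: mulr_ge0_le0 => //; rewrite leNgt; apply/negP => vi.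
  by apply: (nex i).
have b0 := frame_neq0 i.
have [[j [ji xj]]|nex] := pselect (exists j, j != i /\ 0 < x j v); last first.
  exists [::], i, (x i v); split=> //=; rewrite {1}(frame_sum F v) (bigD1 i) //=.
  rewrite big1 ?addr0 // => j ji; have -> : x j v = 0; last by rewrite scale0r.
  apply/eqP; rewrite eq_le v0 andbT leNgt; apply/negP => xj.
  by apply: nex; exists j.
set u := reflection ip (b i) v.
have Pu : Psi u by exact: st.
pose c := 2 * ip v (b i) / ip (b i) (b i).
have c0 : 0 < c by rewrite divr_gt0 ?mulr_gt0 ?ip_gt0.
have xu l : x l u = x l v - c * (l == i)%:R.
  by rewrite /u reflE -scaleNr frameD // frameZ // frame_delta // mulNr.
(* Only the [i]-th coordinate changes, so the positive one at [j] decides the common sign. *)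
have u0 : forall l, 0 <= x l u.
  have [//|neg] := sgn u Pu; have := neg j.
  by rewrite xu (negbTE ji) mulr0 subr0 => /le_gtF; rewrite xj.
have htu : ht u < ht v.
  rewrite /ht (eq_bigr _ (fun l _ => xu l)) sumrB.
  have -> : \sum_l c * (l == i)%:R = c; last by rewrite ltrBlDr ltrDl.
  rewrite (bigD1 i) //= eqxx mulr1 big1 ?addr0 // => l /negbTE ->.
  by rewrite mulr0.
have [|//|//|w [l [a [a0 uE]]]] := IHk u.
  apply: leq_trans lek; apply: leq_ltn_trans (count_predD1_lt (x := u) _ _).
  - by apply: sub_count => y /= yu; rewrite (lt_trans yu htu) andbT;
       apply: contraTneq yu => ->; rewrite ltxx.
  - by move: Pu; rewrite LE.
  - exact: htu.
exists (i :: w), l, a; split=> //=; rewrite -uE.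
by rewrite /u reflK.
Qed.

Variable Phi : set V.
Hypothesis PhiR : root_system ip Phi.
Hypothesis Phi_coherent : sign_coherent Phi.
Variable lam : 'I_n -> R.
Hypothesis lam_gt0 : forall i, 0 < lam i.
Hypothesis Phi_simple : forall i, Phi (lam i *: b i).

Variables (I : finType) (phi : I -> V).

(** Finite conditions, checkable on a table, in which [Phi] does not occur: simple vectors and
    simple reflections already determine the positive rays. *)
Record root_model : Prop := RootModel {
  model_nonneg : forall k i, 0 <= x i (phi k);
  model_neq0 : forall k, phi k != 0;
  model_simple : forall i, exists k, phi k = b i;
  model_refl : forall i k, exists l,
    reflection ip (b i) (phi k) = phi l \/ reflection ip (b i) (phi k) = - phi l;
  model_ray : forall k i c, phi k = c *: b i -> c = 1;
  model_inj : injective phi }.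

Hypothesis M : root_model.

Let Psi : set V := [set v | exists k, v = phi k \/ v = - phi k]%classic.

Let Psi_coherent : sign_coherent Psi.
Proof.
split.
- apply: (@sub_finite_set _ _ (range phi `|` range (fun k => - phi k))%classic).
    by move=> v [k [->|->]]; [left|right]; exists k.
  by rewrite finite_setU; split; apply: finite_image; exact: finite_finset.
- by move=> v [k [->|->]]; rewrite ?oppr_eq0 model_neq0.
- by move=> v [k [->|->]]; [left|right] => i; rewrite ?frameN ?oppr_le0 model_nonneg.
- move=> i v [k e]; have [l le] := model_refl M i k; exists l.
  by case: e le => -> []; rewrite ?reflN => ->; rewrite ?opprK; [left|right|right|left].
Qed.

Let model_pos k i (a : R) : 0 < a -> phi k = - (a *: b i) -> False.
Proof.
move=> a0 e; have := model_nonneg M k i.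
by rewrite e frameN frameZ // frame_delta // eqxx mulr1 oppr_ge0 leNgt a0.
Qed.

Let model_descent k : exists w i, phi k = word_act w (b i).
Proof.
have Pk : Psi (phi k) by exists k; left.
have [w [i [a [a0 e]]]] := descent Psi_coherent Pk (model_nonneg M k).
exists w, i; rewrite e; suff -> : a = 1 by rewrite scale1r.
have [l [el|el]] : Psi (a *: b i).
- by rewrite -(word_actK w (a *: b i)) -e; apply: word_act_stable.
- by apply: (model_ray M (k := l) (i := i)); rewrite el.
- by case: (@model_pos l i a a0); rewrite el opprK.
Qed.

Let Psi_phi v : Psi v -> (forall i, 0 <= x i v) -> exists k, v = phi k.
Proof.
move=> [k [->|e]] v0; first by exists k.
exfalso; have /eqP := model_neq0 M k; apply; apply: frame_ext => i.
have x0 : x i 0 = 0 by rewrite -(scale0r 0) frameZ // mul0r.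
apply/eqP; rewrite x0 eq_le model_nonneg // andbT.
by have := v0 i; rewrite e frameN oppr_ge0.
Qed.

(** A word of simple reflections carries the relation to a multiple of a simple vector, where
    [model_ray] leaves [c = 1] or [c = -1]; nonnegative coordinates exclude the latter. *)
Lemma model_ray_inj i j c : phi j = c *: phi i -> i = j.
Proof.
move=> e; have [w [l il]] := model_descent i.
have [k ek] : Psi (c *: b l).
  rewrite -(word_actK w (c *: b l)) word_actZ -il -e.
  by apply: word_act_stable => //; exists j; left.
have [c1|cN1] : c = 1 \/ c = -1.
- case: ek => ek; [left|right]; first exact: (model_ray M (k := k) (i := l)).
  by rewrite -[c]opprK; congr (- _); apply: (model_ray M (k := k) (i := l)); rewrite scaleNr ek opprK.
- by apply: (model_inj M); rewrite e c1 scale1r.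
- have [||k' ek'] := @Psi_phi (- phi i).
  + by exists i; right.
  + by move=> q; rewrite -scaleN1r -cN1 -e model_nonneg.
  + exfalso; have /eqP := model_neq0 M i; apply; apply: frame_ext => q.
    have x0 : x q 0 = 0 by rewrite -(scale0r 0) frameZ // mul0r.
    apply/eqP; rewrite x0 eq_le model_nonneg // andbT -oppr_ge0 -frameN ek'.
    exact: model_nonneg.
Qed.

(** By [descent] each [phi k] is [w b_i], so its multiple by [lam i] is a root; likewise a positive
    root is [w (a b_i)], and [w b_i] is some [phi k]. Two positively proportional roots coincide,
    which fixes the factor. The factors [c k] reflect that lengths of roots are arbitrary. *)
Lemma positive_roots_model : exists2 c : I -> R, forall k, 0 < c k &
  [set v | Phi v /\ forall i, 0 <= x i v]%classic
  = [set c k *: phi k | k in [set: I]]%classic.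
Proof.
have ex k : exists c, 0 < c /\ Phi (c *: phi k).
  have [w [i ->]] := model_descent k; exists (lam i); split=> //.
  by rewrite -word_actZ; apply: word_act_stable.
have [c c0] := choice ex; exists c => [k|]; first exact: (proj1 (c0 k)).
apply/funext => v; apply/propext; split=> [[Pv v0]|[k _ <-]]; last first.
  have [ck Pk] := c0 k; split=> // i; rewrite frameZ //.
  by rewrite mulr_ge0 ?model_nonneg // ltW.
have [w [i [a [a0 e]]]] := descent Phi_coherent Pv v0.
have [k ek] : exists k, word_act w (b i) = phi k.
  apply: Psi_phi.
    apply: word_act_stable => //; have [k <-] := model_simple M i.
    by exists k; left.
  by move=> j; have := v0 j; rewrite e word_actZ frameZ // pmulr_rge0.
exists k => //; have [ck Pk] := c0 k.
have vE : v = (a / c k) *: (c k *: phi k).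
  by rewrite scalerA divfK ?gt_eqF // -ek -word_actZ.
have [e1|eN1] : a / c k = 1 \/ a / c k = - 1.
- by apply: (root_line PhiR Pk); rewrite -vE.
- by rewrite vE e1 scale1r.
- have : 0 < a / c k by rewrite divr_gt0.
  by rewrite eN1 oppr_gt0 ltr10.
Qed.

End Frame.

Lemma free_family_scale (R : realType) (V : vectType R) (I : finType)
    (phi : I -> V) (c : I -> R) (S : {set I}) : (forall k, 0 < c k) ->
  free_family (fun k => c k *: phi k) S <-> free_family phi S.
Proof.
move=> c0; have conicE B v : conic (fun k => c k *: phi k) B v <-> conic phi B v.
  split=> -[d d0 ->]; apply: conic_sum => i iB; apply: conicZ => //.
    by apply: conicZ; [exact: ltW|exact: conic_gen].
  have -> : phi i = (c i)^-1 *: (c i *: phi i) by rewrite scalerK ?gt_eqF.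
  by apply: conicZ; [rewrite invr_ge0 ltW|exact: (conic_gen (fun k => c k *: phi k))].
split=> fS k kS; apply: (fS k).
  by apply: conicZ; [exact: ltW|apply/conicE].
have -> : phi k = (c k)^-1 *: (c k *: phi k) by rewrite scalerK ?gt_eqF.
by apply: conicZ; [rewrite invr_ge0 ltW|apply/conicE].
Qed.

(** * Inner products of simple roots from orders of products of reflections *)

Definition golden (R : realType) : R := (1 + Num.sqrt 5) / 2.

Lemma golden_gt0 (R : realType) : 0 < golden R.
Proof. by rewrite /golden divr_gt0 // ltr_wpDr ?sqrtr_ge0. Qed.

Lemma golden_sqr (R : realType) : golden R ^+ 2 = golden R + 1.
Proof.
have s5 : Num.sqrt 5 ^+ 2 = 5 :> R by rewrite sqr_sqrtr.
rewrite /golden; nra.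
Qed.

(* [4 cos^2 (pi / m)] for [2 <= m <= 5]. *)
Definition cartan_product (R : realType) (m : nat) : R :=
  match m with 3 => 1 | 4 => 2 | 5 => golden R ^+ 2 | _ => 0 end.

Section RankTwo.
Variables (R : realType) (V : vectType R) (ip : {dot V for idfun}).
Variables (a b : V) (A B : R).
Hypotheses (sab : reflection ip a b = b + A *: a)
  (sba : reflection ip b a = a + B *: b).
Hypotheses (a0 : a != 0) (b0 : b != 0) (A0 : 0 <= A) (B0 : 0 <= B).
Hypothesis AB : A = 0 <-> B = 0.
Variables p q : V -> R.
Hypothesis pqE : forall c d, p (c *: a + d *: b) = c /\ q (c *: a + d *: b) = d.
Hypothesis coherent : 0 < A -> 0 <= q (reflection ip b (reflection ip a b)).

Let f := reflection ip a \o reflection ip b.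
Let t := A * B.

Let refl_self u : u != 0 -> reflection ip u u = - u.
Proof.
by move=> u0; rewrite reflE mulfK ?gt_eqF ?ip_gt0 // scaler_nat mulr2n opprD addrA subrr add0r.
Qed.

Let sbE c d : reflection ip b (c *: a + d *: b) = c *: a + (B * c - d) *: b.
Proof.
rewrite reflD !reflZ sba (refl_self b0) scalerDr scalerA -addrA; congr (_ + _).
by rewrite scalerN -scaleNr -scalerDl mulrC.
Qed.

Let saE c d : reflection ip a (c *: a + d *: b) = (A * d - c) *: a + d *: b.
Proof.
rewrite reflD !reflZ sab (refl_self a0) scalerDr scalerA addrCA addrC; congr (_ + _).
by rewrite scalerN -scaleNr -scalerDl mulrC addrC.
Qed.

Let fE c d : f (c *: a + d *: b) = ((t - 1) * c - A * d) *: a + (B * c - d) *: b.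
Proof. by rewrite /f /= sbE saE; congr (_ *: _ + _); rewrite /t; ring. Qed.

Let fE2 c d : f (f (c *: a + d *: b)) =
  (((t - 1) ^+ 2 - t) * c - A * (t - 2) * d) *: a
  + (B * (t - 2) * c + (1 - t) * d) *: b.
Proof. by rewrite !fE /t; congr (_ *: _ + _ *: _); ring. Qed.

Let aE : a = 1 *: a + 0 *: b.
Proof. by rewrite scale1r scale0r addr0. Qed.

Let commute : A = 0 -> f \o f =1 id.
Proof.
move=> A0'; have B0' : B = 0 by apply/AB.
have ab : ip a b = 0.
  have := sba; rewrite B0' scale0r addr0 reflE => /eqP.
  rewrite -subr_eq0 addrAC subrr add0r oppr_eq0 scaler_eq0 (negbTE b0) orbF.
  rewrite !mulf_eq0 invr_eq0 (gt_eqF (ip_gt0 ip b0)) orbF pnatr_eq0 /=.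
  by move/eqP.
have com v : f v = reflection ip b (reflection ip a v).
  rewrite /f /= !reflE !ipE ab (ipC ip b a) ab !mulr0 oppr0 !addr0.
  by rewrite addrAC.
by move=> v; rewrite /= {1}/f /= com !reflK.
Qed.

(** Applied to [a], the identity [f ^ m = 1] becomes two polynomial equations, one for each
    coordinate. Unwanted roots of the second drop out in three ways: the first coordinate would be
    -1; for [m = 4], [t = 0] would give order 2; for [m = 5], [t = 2 - phi], the square of
    [2 cos (2 pi / 5)], is below 1, while [coherent] gives [t >= 1]. *)
Lemma cartan_product_order m : map_order f m -> (2 <= m <= 5)%N ->
  A * B = cartan_product R m.
Proof.
move=> [_ mid mmin].
have iterP c d : iter m f a = c *: a + d *: b -> c = 1 /\ d = 0.
  rewrite mid => e; have := pqE c d; rewrite -e => -[pc qd].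
  by have := pqE 1 0; rewrite -aE pc qd.
have A0B0 : A * B = 0 -> A = 0.
  by move/eqP; rewrite mulf_eq0 => /orP[/eqP //|/eqP/AB].
have q0 : 0 < A -> 1 <= t.
  move=> /coherent; rewrite sab.
  have -> : b + A *: a = A *: a + 1 *: b by rewrite scale1r addrC.
  rewrite sbE; have [_ ->] := pqE A (B * A - 1).
  by rewrite subr_ge0 mulrC.
have B_eq0 : B = 0 -> t = 0 by rewrite /t => ->; rewrite mulr0.
have t_eq0 : t = 0 -> A = 0 by [].
move: m mid mmin iterP => [|[|[|[|[|[|//]]]]]] // mid mmin iterP _ /=; rewrite -/t.
- have := iterP _ _ _; rewrite /= {1}aE fE2 => /(_ _ _ erefl)[e1 e2].
  have /eqP : B * (t - 2) = 0 by lra.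
  rewrite mulf_eq0 => /orP[/eqP /B_eq0 //|/eqP t3].
  have t2 : t = 2 by lra.
  by exfalso; move: e1; rewrite t2; lra.
- have := iterP _ _ _; rewrite /= {1}aE fE2 fE => /(_ _ _ erefl)[e1 e2].
  have /eqP : B * (t - 1) * (t - 3) = 0 by rewrite -[RHS]e2 /t; ring.
  rewrite !mulf_eq0 -orbA => /or3P[/eqP /B_eq0 t0|/eqP t1|/eqP t3].
  + by exfalso; move: e1; rewrite (t_eq0 t0) t0; lra.
  + lra.
  + have t3' : t = 3 by lra.
    exfalso; have : (t - 1) * ((t - 1) ^+ 2 - t) - t * (t - 2) = 1.
      by rewrite -[RHS]e1 /t; ring.
    by rewrite t3'; lra.
- have := iterP _ _ _; rewrite /= {1}aE !fE2 => /(_ _ _ erefl)[e1 e2].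
  have /eqP : B * (t - 2) * (t ^+ 2 - 4 * t + 2) = 0 by rewrite -[RHS]e2; ring.
  rewrite !mulf_eq0 -orbA => /or3P[/eqP /B_eq0/t_eq0 A0'|/eqP t1|/eqP t3].
  + by case: (mmin 2 isT) => v /=; exact: commute.
  + lra.
  + exfalso; have : (t ^+ 2 - 4 * t + 2) * (t ^+ 2 - 3 * t + 1) - 1 = 1.
      by rewrite -[RHS]e1 /t; ring.
    by rewrite t3; lra.
- have := iterP _ _ _; rewrite /= {1}aE !fE2 fE => /(_ _ _ erefl)[e1 e2].
  have /eqP : B * (t ^+ 2 - 3 * t + 1) * (t ^+ 2 - 5 * t + 5) = 0.
    by rewrite -[RHS]e2 /t; ring.
  rewrite !mulf_eq0 -orbA => /or3P[/eqP /B_eq0 t0|/eqP t1|/eqP t3].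
  + by exfalso; move: e1; rewrite (t_eq0 t0) t0; lra.
  + have tge : 1 <= t.
      apply: q0; rewrite lt_neqAle A0 andbT eq_sym; apply/eqP => A0'.
      by move: t1; rewrite /t A0' mul0r; lra.
    have g0 := golden_gt0 R; have g2 := golden_sqr R.
    have g1 : 1 < golden R by nra.
    have /eqP : (t - golden R ^+ 2) * (t - (2 - golden R)) = 0.
      transitivity (t ^+ 2 - 3 * t + 1); last by [].
      by rewrite g2; transitivity (t ^+ 2 - 3 * t + 2 + golden R - golden R ^+ 2);
         [ring|rewrite g2; ring].
    by rewrite mulf_eq0 => /orP[|] /eqP; lra.
  + exfalso; have : (t ^+ 2 - 5 * t + 5)
        * ((t - 1) * (t ^+ 2 - 3 * t - 1) + t - 1) - 1 = 1.
      by rewrite -[RHS]e1 /t; ring.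
    by rewrite t3; lra.
Qed.

End RankTwo.

Section NormalFrame.
Variables (R : realType) (V : vectType R) (ip : {dot V for idfun}).
Variables (Phi : set V) (n : nat) (Delta : n.-tuple V) (m : 'I_n -> 'I_n -> nat).
Hypotheses (PhiR : root_system ip Phi) (D : simple_system Phi Delta).
Hypothesis Dm : coxeter_orders ip m Delta.

Let d i := tnth Delta i.
Let d_gt0 i : 0 < ip (d i) (d i).
Proof. by apply: ip_gt0; exact: (simple_neq0 PhiR D). Qed.

Let simple_sign i j : i != j -> 0 <= - (2 * ip (d j) (d i) / ip (d i) (d i)).
Proof.
move=> ij; have [_ DP sgn] := D.
have [/(_ i)|/(_ j)] := sgn _ (root_refl PhiR (DP i) (DP j)).
  rewrite reflE linearB linearZ /= !(coord_simple D) eqxx (negbTE ij).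
  by rewrite mulr1 sub0r.
rewrite reflE linearB linearZ /= !(coord_simple D) eqxx eq_sym (negbTE ij).
by rewrite mulr0 subr0 => /le_gtF; rewrite ltr01.
Qed.

Lemma simple_ip i j : i != j -> (2 <= m i j <= 5)%N ->
  ip (d i) (d j) <= 0 /\
  4 * ip (d i) (d j) ^+ 2 =
    cartan_product R (m i j) * (ip (d i) (d i) * ip (d j) (d j)).
Proof.
move=> ij mij; have di := d_gt0 i; have dj := d_gt0 j; have [_ DP sgn] := D.
set A := - (2 * ip (d j) (d i) / ip (d i) (d i)).
set B := - (2 * ip (d i) (d j) / ip (d j) (d j)).
have A0 : 0 <= A by exact: simple_sign.
have B0 : 0 <= B by apply: simple_sign; rewrite eq_sym.
have AE : A * ip (d i) (d i) = - (2 * ip (d i) (d j)).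
  by rewrite /A mulNr divfK ?gt_eqF // ipC.
have BE : B * ip (d j) (d j) = - (2 * ip (d i) (d j)).
  by rewrite /B mulNr divfK ?gt_eqF.
split; first by nra.
have sab : reflection ip (d i) (d j) = d j + A *: d i by rewrite reflE scaleNr.
have sba : reflection ip (d j) (d i) = d i + B *: d j by rewrite reflE scaleNr.
have pq c e : coord Delta i (c *: d i + e *: d j) = c /\
    coord Delta j (c *: d i + e *: d j) = e.
  rewrite !linearD !linearZ /= !(coord_simple D) !eqxx (negbTE ij) eq_sym (negbTE ij).
  by rewrite !mulr1 !mulr0 addr0 add0r.
have AB0 : A = 0 <-> B = 0.
  have ABE : A * ip (d i) (d i) = B * ip (d j) (d j) by rewrite AE BE.
  split=> e; move: ABE; rewrite e mul0r => /eqP; [rewrite eq_sym|];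
    by rewrite mulf_eq0 ?(gt_eqF dj) ?(gt_eqF di) orbF => /eqP.
(* This root has [i]-th coordinate [A], so for positive [A] all its coordinates are nonnegative. *)
have coh : 0 < A -> 0 <= coord Delta j (reflection ip (d j) (reflection ip (d i) (d j))).
  move=> Agt; have := sgn _ (root_refl PhiR (DP j) (root_refl PhiR (DP i) (DP j))).
  move=> [/(_ j) //|/(_ i)]; rewrite -/(d i) -/(d j) sab reflE linearB linearD !linearZ /=.
  rewrite !(coord_simple D) eqxx (negbTE ij) mulr0 subr0 mulr1 add0r.
  by move=> /le_gtF; rewrite Agt.
have := cartan_product_order sab sba (simple_neq0 PhiR D i) (simple_neq0 PhiR D j)
  A0 AB0 pq coh (Dm i j) mij.
move=> <-; have : (A * ip (d i) (d i)) * (B * ip (d j) (d j)) = 4 * ip (d i) (d j) ^+ 2.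
  by rewrite AE BE; ring.
by move=> <-; ring.
Qed.

Lemma simple_coherent (b : 'I_n -> V) (x : 'I_n -> V -> R) (lam : 'I_n -> R) :
  (forall i, 0 < lam i) -> (forall i, b i = lam i *: d i) ->
  (forall i v, x i v = (lam i)^-1 * coord Delta i v) ->
  frame b x /\ sign_coherent ip b x Phi.
Proof.
move=> lam0 bE xE; have [_ DP sgn] := D; split.
  split=> [i u v|i c v|v|i j].
  - by rewrite !xE linearD mulrDr.
  - by rewrite !xE linearZ /= mulrCA.
  - rewrite {1}(coord_sum D v); apply: eq_bigr => i _.
    by rewrite xE bE scalerA mulrAC mulVf ?mul1r ?gt_eqF.
  - rewrite xE bE linearZ /= (coord_simple D); case: eqVneq => [->|_].
      by rewrite mulr1 mulVf ?gt_eqF.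
    by rewrite !mulr0.
split=> [|v|v Pv|i v Pv]; first exact: rs_finite PhiR.
- exact: root_neq0 PhiR v.
- have l0 i : 0 <= (lam i)^-1 by rewrite invr_ge0 ltW.
  by have [sv|sv] := sgn v Pv; [left|right] => i; rewrite xE;
    [exact: mulr_ge0|exact: mulr_ge0_le0].
- by rewrite bE refl_scale ?gt_eqF //; apply: root_refl.
Qed.

Variables (q : 'I_n -> R) (g : 'I_n -> 'I_n -> R).
Hypothesis q_gt0 : forall i, 0 < q i.
Hypothesis g_diag : forall i, g i i = q i.
Hypothesis g_off : forall i j, i != j -> [/\ (2 <= m i j <= 5)%N, g i j <= 0
  & 4 * g i j ^+ 2 = cartan_product R (m i j) * (q i * q j)].

(** Once the simple roots are scaled to the norms [q i], the orders give the squares of the other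
    inner products, and these are known to be nonpositive. *)
Lemma normal_frame : exists (b : 'I_n -> V) (x : 'I_n -> V -> R) (lam : 'I_n -> R),
  [/\ frame b x, sign_coherent ip b x Phi,
      forall i, 0 < lam i /\ Phi (lam i *: b i),
      forall i j, ip (b i) (b j) = g i j
    & forall v, (forall i, 0 <= x i v) <-> (forall i, 0 <= coord Delta i v)].
Proof.
pose l i := Num.sqrt (q i / ip (d i) (d i)).
have l0 i : 0 < l i by rewrite sqrtr_gt0 divr_gt0.
have l2 i : l i ^+ 2 * ip (d i) (d i) = q i.
  by rewrite sqr_sqrtr ?divfK ?gt_eqF // ltW // divr_gt0.
pose b i := l i *: d i; pose x i v := (l i)^-1 * coord Delta i v.
have [F coh] := simple_coherent (b := b) (x := x) l0 (fun _ => erefl) (fun _ _ => erefl).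
exists b, x, (fun i => (l i)^-1); split=> //.
- move=> i; rewrite invr_gt0; split=> //; rewrite scalerK ?gt_eqF //.
  by have [_ DP _] := D; exact: DP.
- move=> i j; rewrite !ipE; have [<-|ij] := eqVneq i j.
    by rewrite g_diag -l2 expr2 mulrA.
  have [mij g0 gE] := g_off ij; have [ip0 ipE'] := simple_ip ij mij.
  have le0 : l i * (l j * ip (d i) (d j)) <= 0.
    by rewrite mulr_ge0_le0 ?mulr_ge0_le0 // ltW.
  have : (l i * (l j * ip (d i) (d j))) ^+ 2 = g i j ^+ 2.
    apply: (mulfI (_ : 4 != 0 :> R)); first by rewrite pnatr_eq0.
    rewrite gE -!l2; transitivity (l i ^+ 2 * l j ^+ 2 * (4 * ip (d i) (d j) ^+ 2)); first by ring.
    by rewrite ipE'; ring.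
  move/eqP; rewrite eqf_sqr => /orP[/eqP //|/eqP e].
  have : g i j = 0 by lra.
  by move=> g00; rewrite e g00 oppr0.
- move=> v; split=> v0 i; last by rewrite /x mulr_ge0 // invr_ge0 ltW.
  by have := v0 i; rewrite /x pmulr_rge0 // invr_gt0.
Qed.

End NormalFrame.

Section Conclusion.
Variables (R : realType) (V : vectType R) (ip : {dot V for idfun}).
Variables (Phi P : set V) (n : nat) (m : 'I_n -> 'I_n -> nat).
Hypotheses (PhiR : root_system ip Phi) (PP : positive_system Phi P).
Variable Delta : n.-tuple V.
Hypotheses (D : simple_system Phi Delta) (Dm : coxeter_orders ip m Delta).
Variables (q : 'I_n -> R) (g : 'I_n -> 'I_n -> R) (N : nat).
Hypothesis q_gt0 : forall i, 0 < q i.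
Hypothesis g_diag : forall i, g i i = q i.
Hypothesis g_off : forall i j, i != j -> [/\ (2 <= m i j <= 5)%N, g i j <= 0
  & 4 * g i j ^+ 2 = cartan_product R (m i j) * (q i * q j)].

(** After this reduction a type only has to provide a Gram matrix with the right labels, a model
    over it, and the largest size of a free family in that model. The height needed for
    anti-exchange is the sum of the coordinates. *)
Lemma table_entry (I : finType) (phi : ('I_n -> V) -> I -> V) :
  (forall (b : 'I_n -> V) x, frame b x -> (forall i j, ip (b i) (b j) = g i j) ->
    [/\ root_model ip b x (phi b),
        exists2 S : {set I}, free_family (phi b) S & #|S| = N
      & forall S : {set I}, free_family (phi b) S -> (#|S| <= N)%N]) ->
  max_really_abelian_size P N /\ helly_number P (cone P) N.
Proof.
move=> phiP; have [Delta' [D' Dm'] PE] := adapted_simple_system PhiR PP D Dm.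
have [b [x [lam [F coh lamP bg xP]]]] := normal_frame PhiR D' Dm' q_gt0 g_diag g_off.
have [M [S fS cS] leN] := phiP b x F bg.
have PE' : P = [set v | Phi v /\ forall i, 0 <= x i v]%classic.
  by rewrite PE; apply/funext => v; apply/propext; split=> -[Pv /xP v0].
have [c c0 PE''] := positive_roots_model F PhiR coh (fun i => proj1 (lamP i))
  (fun i => proj2 (lamP i)) M.
rewrite -PE' in PE''.
pose r k := c k *: phi b k; pose h v := \sum_i x i v.
have hD u v : h (u + v) = h u + h v.
  by rewrite /h -big_split; apply: eq_bigr => i _; rewrite /= (frameD F).
have hZ a v : h (a *: v) = a * h v.
  by rewrite /h mulr_sumr; apply: eq_bigr => i _; rewrite (frameZ F).
have h0 k : 0 < h (r k).
  rewrite hZ mulr_gt0 // lt_neqAle sumr_ge0 ?andbT => [|i _]; last exact: (model_nonneg M).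
  rewrite eq_sym; apply/eqP => /eqP; rewrite psumr_eq0 => [/allP x0|i _]; last exact: (model_nonneg M).
  have /eqP := model_neq0 M k; apply; apply: (frame_ext F) => i.
  have := x0 i; rewrite mem_index_enum => /(_ isT)/eqP ->.
  by rewrite -(scale0r 0) (frameZ F) mul0r.
have ray i j a : r j = a *: r i -> i = j.
  rewrite /r scalerA => e; apply: (model_ray_inj F M (c := (c j)^-1 * (a * c i))).
  by rewrite -scalerA -e scalerK ?gt_eqF.
have fr T : free_family r T <-> free_family (phi b) T by exact: free_family_scale.
split.
  apply: (max_really_abelian_size_family ray PE'') => [|T /fr]; last exact: leN.
  by exists S => //; apply/fr.
apply: (helly_number_family hD hZ h0 ray PE'') => [|T /fr]; last exact: leN.
by exists S => //; apply/fr.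
Qed.

End Conclusion.

(** * Rank two *)

Lemma conic1 (R : realType) (V : vectType R) (I : finType) (r : I -> V) i v :
  conic r [set i] v -> exists2 c, 0 <= c & v = c *: r i.
Proof. by move=> [c c0 ->]; exists (c i); rewrite ?big_set1. Qed.

Section PlaneFamily.
Variables (R : realType) (V : vectType R) (I : finType) (r : I -> V) (h : V -> R).
Hypothesis hD : forall u v, h (u + v) = h u + h v.
Hypothesis hZ : forall c v, h (c *: v) = c * h v.
Hypothesis h_gt0 : forall i, 0 < h (r i).
Hypothesis r_ray : forall i j c, r j = c *: r i -> i = j.

(** A pair with smallest closure is free: a third [k] in the closure of [i] and [j] would, by
    anti-exchange, make the closure of [i] and [k] miss [j], hence smaller. *)
Lemma free_pair (i0 j0 : I) : i0 != j0 -> exists2 S : {set I}, free_family r S & #|S| = 2.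
Proof.
move=> ij0; pose m (p : I * I) := #|ray_closure r [set p.1; p.2]|.
have [[i j] /= ij minij] := arg_minnP (i0 := (i0, j0)) (P := fun p : I * I => p.1 != p.2) m ij0.
exists [set i; j]; last by rewrite cards2 ij.
have ray1 k l : k != l -> k \notin ray_closure r [set l].
  move=> kl; apply/ray_closureP => /conic1[c _ /r_ray e].
  by rewrite e eqxx in kl.
move=> k /(ray_closureP r _ k) kS; have [ki|ki] := eqVneq k i.
  move/negP: (ray1 _ _ ij); apply; move: kS; rewrite ki.
  by apply: fintype.subsetP; apply: ray_closure_mono; apply/fintype.subsetP => l;
    rewrite !inE => /andP[/negbTE ->].
have [kj|kj] := eqVneq k j.
  move: (ij); rewrite eq_sym => /ray1/negP; apply; move: kS; rewrite kj.
  by apply: fintype.subsetP; apply: ray_closure_mono; apply/fintype.subsetP => l;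
    rewrite !inE => /andP[/negbTE ->]; rewrite orbF.
have {}kS : k \in ray_closure r (j |: [set i]).
  move: kS; apply: fintype.subsetP; apply: ray_closure_mono.
  by apply/fintype.subsetP => l; rewrite !inE orbC => /andP[_].
have jk : j \notin ray_closure r (k |: [set i]).
  by apply: (ray_closure_antiexchange hD hZ h_gt0 r_ray _ _ _ kS);
    rewrite ?ray1 // eq_sym.
have := minij (i, k); rewrite /= eq_sym => /(_ ki).
apply/negP; rewrite -ltnNge; apply: proper_card; apply/properP; split.
  rewrite -(ray_closure_idem r [set i; j]); apply: ray_closure_mono.
  apply/fintype.subsetP => l; rewrite in_set2 => /orP[/eqP ->|/eqP ->].
    by apply: (fintype.subsetP (ray_closure_ext r _)); rewrite !inE eqxx.
  by rewrite /= finset.setUC.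
exists j; last by rewrite finset.setUC.
by apply: (fintype.subsetP (ray_closure_ext r _)); rewrite !inE eqxx orbT.
Qed.

Variables x y : V -> R.
Hypothesis xD : forall u v, x (u + v) = x u + x v.
Hypothesis xZ : forall c v, x (c *: v) = c * x v.
Hypothesis yD : forall u v, y (u + v) = y u + y v.
Hypothesis yZ : forall c v, y (c *: v) = c * y v.
Hypothesis xy_inj : forall u v, x u = x v -> y u = y v -> u = v.
Hypothesis xy_ge0 : forall k, 0 <= x (r k) /\ 0 <= y (r k).

Let det u v := x u * y v - y u * x v.

Let det_neq0 i j : i != j -> det (r i) (r j) != 0.
Proof.
move=> ij; apply/eqP => /subr0_eq e; move/eqP: ij; apply.
have [xi yi] := xy_ge0 i; have [xi0|xi0] := eqVneq (x (r i)) 0.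
  have yi0 : y (r i) != 0.
    apply/eqP => yi0; have := h_gt0 i; suff -> : r i = 0 *: r i by rewrite hZ mul0r ltxx.
    by apply: xy_inj; rewrite ?xZ ?yZ mul0r.
  apply: (r_ray (c := y (r j) / y (r i))); apply: xy_inj; rewrite ?xZ ?yZ.
    apply: (mulfI yi0); rewrite -e xi0; ring.
  by rewrite divfK.
apply: (r_ray (c := x (r j) / x (r i))); apply: xy_inj; rewrite ?xZ ?yZ ?divfK //.
by apply: (mulfI xi0); rewrite e; field.
Qed.

Let between i j k : 0 < det (r i) (r j) -> 0 < det (r j) (r k) -> i != k ->
  conic r [set i; k] (r j).
Proof.
move=> ij jk ik; have [xi yi] := xy_ge0 i; have [xj yj] := xy_ge0 j.
have [xk yk] := xy_ge0 k.
(* By Cramer's rule [det_ik r_j = det_jk r_i + det_ij r_k]. Were [det_ik] not positive, both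
   coordinates of [r_i] would vanish. *)
have dik : 0 < det (r i) (r k).
  rewrite ltNge; apply/negP => dik.
  have e (z : V -> R) : z = x \/ z = y -> det (r i) (r k) * z (r j)
      = det (r j) (r k) * z (r i) + det (r i) (r j) * z (r k).
    by rewrite /det => -[] ->; ring.
  have z0 (z : V -> R) : z = x \/ z = y -> (forall l, 0 <= z (r l)) -> z (r i) = 0.
    move=> /e ez zp; apply/eqP; rewrite eq_le zp andbT -(pmulr_rle0 _ jk).
    have := mulr_ge0 (ltW ij) (zp k); have := mulr_le0_ge0 dik (zp j).
    by rewrite ez => ? ?; lra.
  move: ij; rewrite /det (z0 x) ?(z0 y) ?mul0r ?subrr ?ltxx //; try by [left|right].
    by move=> l; case: (xy_ge0 l).
  by move=> l; case: (xy_ge0 l).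
have -> : r j = (det (r j) (r k) / det (r i) (r k)) *: r i
              + (det (r i) (r j) / det (r i) (r k)) *: r k.
  have d0 : det (r i) (r k) != 0 by rewrite gt_eqF.
  apply: xy_inj; rewrite ?(xD, yD) ?(xZ, yZ); apply: (mulfI d0);
    by rewrite /det in d0 *; field.
by apply: conicD; apply: conicZ; rewrite ?divr_ge0 ?ltW //; apply: conic_gen;
  rewrite !inE eqxx ?orbT.
Qed.

(** The sign of [det] orders the rays of the quadrant linearly, so of any three one lies between the
    other two. *)
Lemma free_plane_le2 (S : {set I}) : free_family r S -> (#|S| <= 2)%N.
Proof.
move=> fS; rewrite leqNgt; apply/negP => /card_gt2P[i [j [k [[iS jS kS] [ij jk ki]]]]].
have not_between a b c : a \in S -> b \in S -> c \in S -> a != b -> b != c -> c != a ->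
    0 < det (r a) (r b) -> 0 < det (r b) (r c) -> False.
  move=> aS bS cS ab bc ca dab dbc; apply: (fS b).
  have ac : a != c by rewrite eq_sym.
  apply: conicS (between dab dbc ac).
  by apply/fintype.subsetP => l; rewrite !inE => /orP[]/eqP ->; rewrite ?aS ?cS ?ab ?andbT // eq_sym.
have detC u v : det u v = - det v u by rewrite /det; ring.
have neg a b : a != b -> ~~ (0 < det (r a) (r b)) -> 0 < det (r b) (r a).
  by move=> ab; rewrite -leNgt detC oppr_le0 lt_neqAle eq_sym det_neq0 // eq_sym.
have [dij|/(neg _ _ ij) dij] := boolP (0 < det (r i) (r j)).
  have [djk|/(neg _ _ jk) djk] := boolP (0 < det (r j) (r k)).
    exact: (not_between i j k).
  have [dki|/(neg _ _ ki) dki] := boolP (0 < det (r k) (r i)).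
    exact: (not_between k i j).
  by apply: (not_between i k j); rewrite // eq_sym.
have [djk|/(neg _ _ jk) djk] := boolP (0 < det (r j) (r k)).
  have [dki|/(neg _ _ ki) dki] := boolP (0 < det (r k) (r i)).
    exact: (not_between j k i).
  by apply: (not_between j i k); rewrite // eq_sym.
by apply: (not_between k j i); rewrite // eq_sym.
Qed.

End PlaneFamily.

(** The argument is uniform in the order of the product of the simple reflections: the positive
    roots themselves, listed as a finite type, serve as the family, with the two simple coordinates
    placing them in a quadrant. *)
Lemma rank_two_entry (R : realType) (V : vectType R) (ip : {dot V for idfun})
    (Phi P : set V) (m : 'I_2 -> 'I_2 -> nat) (Delta : 2.-tuple V) :
  root_system ip Phi -> positive_system Phi P ->
  simple_system Phi Delta -> coxeter_orders ip m Delta ->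
  max_really_abelian_size P 2 /\ helly_number P (cone P) 2.
Proof.
move=> PhiR PP D0 Dm; have [Delta' [D _] PE] := adapted_simple_system PhiR PP D0 Dm.
have /finite_seqP[L LE] := rs_finite PhiR.
pose I := seq_sub [seq v <- L | `[<P v>]].
pose r (k : I) : V := val k.
have Pr k : P (r k) by have := valP k; rewrite mem_filter => /andP[/asboolP].
have PE' : P = [set r k | k in [set: I]]%classic.
  apply/funext => v; apply/propext; split=> [Pv|[k _ <-] //].
  have vL : v \in [seq v <- L | `[<P v>]].
    rewrite mem_filter; apply/andP; split; first exact/asboolP.
    by have := positive_root PP Pv; rewrite LE.
  by exists (SeqSub vL).
pose x v := coord Delta' ord0 v; pose y v := coord Delta' (lift ord0 ord0) v.
pose h v := x v + y v.
have xy_ge0 k : 0 <= x (r k) /\ 0 <= y (r k).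
  by have := Pr k; rewrite PE => -[_ k0]; split; exact: k0.
have vE v : v = x v *: tnth Delta' ord0 + y v *: tnth Delta' (lift ord0 ord0).
  by rewrite {1}(coord_sum D v) big_ord_recl big_ord1.
have xy_inj u v : x u = x v -> y u = y v -> u = v.
  by move=> ex ey; rewrite (vE u) (vE v) ex ey.
have xD u v : x (u + v) = x u + x v by rewrite /x linearD.
have yD u v : y (u + v) = y u + y v by rewrite /y linearD.
have xZ c v : x (c *: v) = c * x v by rewrite /x linearZ.
have yZ c v : y (c *: v) = c * y v by rewrite /y linearZ.
have hD u v : h (u + v) = h u + h v by rewrite /h xD yD; ring.
have hZ c v : h (c *: v) = c * h v by rewrite /h xZ yZ; ring.
have h0 k : 0 < h (r k).
  have [x0 y0] := xy_ge0 k; rewrite lt_neqAle addr_ge0 // andbT eq_sym.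
  apply/eqP => e; have /eqP := root_neq0 PhiR (positive_root PP (Pr k)); apply.
  have xk : x (r k) = 0 by rewrite /h in e; lra.
  have yk : y (r k) = 0 by rewrite /h in e; lra.
  by rewrite (vE (r k)) xk yk !scale0r addr0.
have ray i j c : r j = c *: r i -> i = j.
  move=> e; have Pj := positive_root PP (Pr j); rewrite e in Pj.
  have [c1|cN1] := root_line PhiR (positive_root PP (Pr i)) Pj.
    by apply: val_inj; move: e; rewrite c1 scale1r.
  have := h0 j; rewrite e hZ cN1 mulN1r oppr_gt0 => hi.
  by have := lt_trans (h0 i) hi; rewrite ltxx.
have [i0 i0E] : exists k, r k = tnth Delta' ord0.
  have : P (tnth Delta' ord0).
    rewrite PE; split; first by have [_ DP _] := D; exact: DP.
    by move=> i; rewrite (coord_simple D).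
  by rewrite {1}PE' => -[k _ e]; exists k.
have [j0 j0E] : exists k, r k = tnth Delta' (lift ord0 ord0).
  have : P (tnth Delta' (lift ord0 ord0)).
    rewrite PE; split; first by have [_ DP _] := D; exact: DP.
    by move=> i; rewrite (coord_simple D).
  by rewrite {1}PE' => -[k _ e]; exists k.
have ij0 : i0 != j0.
  apply/eqP => e; have : x (r i0) = x (r j0) by rewrite e.
  by rewrite i0E j0E /x !(coord_simple D) /= => /eqP; rewrite oner_eq0.
have ex := free_pair hD hZ h0 ray ij0.
have le2 := free_plane_le2 hZ h0 ray xD xZ yD yZ xy_inj xy_ge0.
split; first exact: (max_really_abelian_size_family ray PE').
exact: (helly_number_family hD hZ h0 ray PE').
Qed.

(** * Type A *)

(** The form may vanish at [phi k]: as it is positive on the other members, a combination of them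
    with nonpositive value has all coefficients zero. *)
Lemma free_of_functionals (R : realType) (V : vectType R) (I : finType)
    (phi : I -> V) (S : {set I}) :
  (forall k, phi k != 0) ->
  (forall k, exists f : V -> R, [/\ forall u v, f (u + v) = f u + f v,
     forall c v, f (c *: v) = c * f v, f (phi k) <= 0
     & forall l, l \in S -> l != k -> 0 < f (phi l)]) ->
  free_family phi S.
Proof.
move=> phi0 fP k [c c0 kE]; have [f [fD fZ fk fS]] := fP k.
have f0 : f 0 = 0 by rewrite -(scale0r 0) fZ mul0r.
have fE : f (phi k) = \sum_(i in S :\ k) c i * f (phi i).
  by rewrite {1}kE (big_morph f fD f0); apply: eq_bigr => i _.
have pos i : i \in S :\ k -> 0 <= c i * f (phi i).
  by rewrite !inE => /andP[ik iS]; rewrite mulr_ge0 // ltW // fS.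
have /eqP : \sum_(i in S :\ k) c i * f (phi i) = 0.
  by apply/eqP; rewrite eq_le -{1}fE fk sumr_ge0.
rewrite psumr_eq0 // => /allP z.
have /eqP := phi0 k; apply; rewrite kE big1 // => i iS.
have := z i; rewrite mem_index_enum iS /= mulf_eq0 => /(_ isT).
move: (iS); rewrite !inE => /andP[ik iS'].
by rewrite (gt_eqF (fS _ iS' ik)) orbF => /eqP ->; rewrite scale0r.
Qed.

(** The only consequence of freeness behind the upper bounds in types A, B, D and E. *)
Lemma free_pair_sum (R : realType) (V : vectType R) (I : finType)
    (phi : I -> V) (S : {set I}) i j k c :
  free_family phi S -> i \in S -> j \in S -> i != k -> j != k -> 0 <= c ->
  phi k = c *: (phi i + phi j) -> False.
Proof.
move=> fS iS jS ik jk c0 e; apply: (fS k); rewrite e.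
by apply: conicZ => //; apply: conicD; apply: conic_gen; rewrite !inE ?ik ?jk.
Qed.

Section FrameCone.
Variables (R : realType) (V : vectType R) (n : nat).
Variables (b : 'I_n -> V) (x : 'I_n -> V -> R).
Hypothesis F : frame b x.

Lemma frame_nonnegD j u v : 0 <= x j u -> 0 <= x j v -> 0 <= x j (u + v).
Proof. by rewrite (frameD F); exact: addr_ge0. Qed.

(* Over an index set of positive vectors of equal norm only the scalar 1 is left:
   the scalar is nonnegative, nonzero, and has square 1. *)
Lemma frame_ray (ip : {dot V for idfun}) i c v :
  0 <= x i v -> ip v v = ip (b i) (b i) -> v = c *: b i -> c = 1.
Proof.
move=> v0 vb e; have b0 := ip_gt0 ip (frame_neq0 F i).
have c0 : 0 <= c by move: v0; rewrite e (frameZ F) (frame_delta F) eqxx mulr1.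
have : (c * c - 1) * ip (b i) (b i) = 0.
  by rewrite mulrBl mul1r -{2}vb e !ipE; ring.
move/eqP; rewrite mulf_eq0 (gt_eqF b0) orbF => /eqP cc; nra.
Qed.
End FrameCone.

(* The positive vectors of norm 2 on which a functional bounded by 1 attains its
   bound: being unit vectors up to scale, none is a convex combination of others. *)
Lemma free_minuscule (R : realType) (V : vectType R) (ip : {dot V for idfun})
    (I : finType) (phi : I -> V) (y : V -> R) :
  (forall k, ip (phi k) (phi k) = 2) -> injective phi ->
  (forall u v, y (u + v) = y u + y v) -> (forall c v, y (c *: v) = c * y v) ->
  (forall k, y (phi k) <= 1) ->
  free_family phi [set k | y (phi k) == 1].
Proof.
move=> n2 phi_inj yD yZ y1; apply: free_of_functionals => k.
  by apply/eqP => e; have /eqP := n2 k; rewrite e ip0l eq_sym pnatr_eq0.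
exists (fun v => 2 * y v - ip (phi k) v); split=> [u v|c v||l].
- by rewrite yD ipDr; ring.
- by rewrite yZ ipZr; ring.
- by rewrite n2; have := y1 k; lra.
rewrite inE => /eqP -> lk; have : phi l - phi k != 0.
  by rewrite subr_eq0; apply: contra_neq lk => /phi_inj.
by move=> /(ip_gt0 ip); rewrite !ipE !n2 (ipC ip (phi l)); lra.
Qed.

Lemma card_ord_lt n k : (k <= n)%N -> #|[set i : 'I_n | (i < k)%N]| = k.
Proof.
move=> kn; have w_inj : injective (widen_ord kn).
  by move=> i j /(congr1 val) /= /val_inj.
rewrite -[RHS]card_ord -(card_imset _ w_inj).
apply: eq_card => i; rewrite inE; apply/idP/imsetP => [ik|[j _ ->]]; last exact: (ltn_ord j).
by exists (Ordinal ik) => //; apply: val_inj.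
Qed.

Definition chain_gram (R : realType) (i j : nat) : R :=
  if i == j then 2 else if (i == j.+1) || (j == i.+1) then -1 else 0.

Lemma chain_label3 n i j : (i < n)%N -> (j < n)%N -> i != j ->
  chain_label (nseq n.-1 3%N) (minn i j) (maxn i j) =
  if (i == j.+1) || (j == i.+1) then 3%N else 2%N.
Proof.
move=> i_n j_n ij; rewrite /chain_label /minn /maxn nth_nseq.
case: ltngtP ij => // lt _.
  have -> : (i == j.+1) = false by lia.
  by case: eqP => //= e; rewrite ifT //; lia.
have -> : (j == i.+1) = false by lia.
by rewrite orbF; case: eqP => //= e; rewrite ifT //; lia.
Qed.

Section TypeA.
Variables (R : realType) (V : vectType R) (ip : {dot V for idfun}).
Variables (n : nat) (b : 'I_n -> V) (x : 'I_n -> V -> R).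
Hypothesis F : frame b x.
Hypothesis bg : forall i j : 'I_n, ip (b i) (b j) = chain_gram R i j.

(** With [b_k = e_k - e_(k+1)] this is [e_i - e_n], so differences of ladders are the roots of type
    A and [ladder n = 0]. In type B it is [e_i] itself. *)
Definition ladder (i : nat) : V := \sum_(k < n | (i <= k)%N) b k.

Lemma ladderS (i : 'I_n) : ladder i = b i + ladder i.+1.
Proof.
rewrite /ladder (bigD1 i) //=; congr (_ + _); apply: eq_bigl => k.
by rewrite ltn_neqAle eq_sym andbC.
Qed.

Definition intervals := {p : 'I_n.+1 * 'I_n.+1 | (p.1 < p.2)%N}.

Definition phiA (p : intervals) : V := ladder (val p).1 - ladder (val p).2.

(** The inner product of [e_i] with [e_k - e_(k+1)]. *)
Let step k i : R := (i == k)%N%:R - (i == k.+1)%N%:R.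

(** Stated for differences, since [(ladder l, b_k) - step k l] is constant in [l] but is 1 rather
    than 0 when [k = n - 1]. *)
Lemma ladder_ip (k : 'I_n) (i j : nat) : (i <= n)%N -> (j <= n)%N ->
  ip (ladder i - ladder j) (b k) = step k i - step k j.
Proof.
have up (l : nat) : (l < n)%N -> ip (ladder l) (b k) - step k l
    = ip (ladder l.+1) (b k) - step k l.+1.
  move=> ln; rewrite (ladderS (Ordinal ln)) ipDl bg /= /chain_gram /step.
  by do !case: eqP => ? /=; first [lra | exfalso; lia].
have all l : (l <= n)%N -> ip (ladder l) (b k) - step k l
    = ip (ladder n) (b k) - step k n.
  move=> ln; rewrite -(subKn ln); elim: (n - l)%N (leq_subr l n) => [|d IHd] dn.
    by rewrite subn0.
  by rewrite up ?subnSK ?IHd //; lia.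
move=> /all ei /all ej; rewrite ipDl ipNl; lra.
Qed.

Let tau (k i : nat) : nat := if i == k then k.+1 else if i == k.+1 then k else i.

Lemma ladder_refl (k : 'I_n) (i j : nat) : (i <= n)%N -> (j <= n)%N ->
  reflection ip (b k) (ladder i - ladder j) = ladder (tau k i) - ladder (tau k j).
Proof.
move=> ni nj; rewrite reflE ladder_ip // bg /chain_gram eqxx.
have -> : 2 * (step k i - step k j) / 2 = step k i - step k j.
  by rewrite mulrAC divff ?mul1r // pnatr_eq0.
have st l : ladder l - step k l *: b k = ladder (tau k l).
  rewrite /step /tau; have [->|lk] := eqVneq l k.
    have -> : (k == k.+1 :> nat) = false by lia.
    by rewrite subr0 scale1r ladderS addrAC subrr add0r.
  have [->|lk1] := eqVneq l k.+1; last by rewrite subr0 scale0r subr0.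
  by rewrite sub0r scaleN1r opprK ladderS addrC.
by rewrite -!st scalerBl opprD addrACA -opprD.
Qed.

Lemma ladder_coord (m : 'I_n) i : x m (ladder i) = (i <= m)%N%:R.
Proof.
have x0 : x m 0 = 0 by rewrite -(scale0r 0) (frameZ F) mul0r.
rewrite /ladder (big_morph (x m) (frameD F m) x0) big_mkcond /= (bigD1 m) //=.
rewrite (frame_delta F) eqxx big1 => [|k km]; first by rewrite addr0; case: ifP.
by rewrite (frame_delta F) eq_sym (negbTE km) if_same.
Qed.

Lemma ladderB_coord (m : 'I_n) i j : x m (ladder i - ladder j) = (i <= m)%N%:R - (j <= m)%N%:R.
Proof. by rewrite (frameD F) (frameN F) !ladder_coord. Qed.

Lemma ladder_nonneg i j m : (i <= j)%N -> 0 <= x m (ladder i - ladder j).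
Proof.
move=> ij; rewrite ladderB_coord subr_ge0 ler_nat.
by have [jm|//] := leqP j m; rewrite (leq_trans ij jm).
Qed.

Lemma ladder_norm i j : (i < j)%N -> (j <= n)%N ->
  ip (ladder i - ladder j) (ladder i - ladder j) = 2.
Proof.
move=> ij jn; set v := ladder i - ladder j.
have stp l : (l < j)%N -> ip v (ladder l) = ip v (ladder l.+1) + step l i - step l j.
  move=> lj; have ln := leq_trans lj jn.
  rewrite (ladderS (Ordinal ln)) ipDr ladder_ip ?(ltnW (leq_trans ij jn)) //=.
  by rewrite addrC addrA.
have cl d : (d <= j - i)%N -> ip v (ladder (j - d)) - ip v (ladder j)
    = (0 < d)%N%:R + (d == j - i)%N%:R.
  elim: d => [|d IHd] dj; first by rewrite subn0 subrr; case: eqP => ?; [lia|rewrite addr0].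
  have e : (j - d.+1).+1 = (j - d)%N by lia.
  have IH := IHd (ltnW dj); rewrite stp ?e; last by lia.
  move: IH; rewrite /step !lt0n; move: (ip _ _) (ip _ _) => c c'.
  by do !case: eqP => ? /=; first [exfalso; lia | lra].
rewrite {2}/v ipDr ipNr; have := cl _ (leqnn _); rewrite eqxx subKn ?(ltnW ij) // => ->.
by rewrite subn_gt0 ij.
Qed.

Lemma phiA_model : root_model ip b x phiA.
Proof.
have bnd (i : 'I_n.+1) : (i <= n)%N by rewrite -ltnS.
split.
- by move=> [[i j] /= ij] m; apply: ladder_nonneg; rewrite ?(ltnW ij).
- move=> [[i j] /= ij]; apply/eqP => e.
  by have := ladder_norm ij (bnd j); rewrite [_ - _]e ip0l => /eqP; rewrite eq_sym pnatr_eq0.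
- move=> i; have ii : (widen_ord (leqnSn n) i < lift ord0 i)%N by [].
  by exists (exist _ (_, _) ii); rewrite /phiA /= ladderS addrK.
- move=> k [[i j] /= ij].
  have tn l : (l <= n)%N -> (tau k l < n.+1)%N.
    by have := ltn_ord k; rewrite /tau; case: eqP => ?; [|case: eqP => ?]; lia.
  have : tau k i != tau k j.
    by apply/eqP; rewrite /tau; do !case: eqP => ?; lia.
  pose o l := inord (tau k l) : 'I_n.+1.
  have oE l : (l <= n)%N -> o l = tau k l :> nat by move=> ln; rewrite inordK ?tn.
  rewrite neq_ltn => /orP[] lt.
    have lt' : (o i < o j)%N by rewrite !oE.
    by exists (exist _ (_, _) lt'); left; rewrite /phiA /= !oE // ladder_refl.
  have lt' : (o j < o i)%N by rewrite !oE.
  by exists (exist _ (_, _) lt'); right; rewrite /phiA /= !oE // ladder_refl // opprB.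
- move=> [[i j] /= ij] m c; apply: (frame_ray F (ip := ip)).
    by apply: ladder_nonneg; exact: ltnW.
  by rewrite ladder_norm // bg /chain_gram eqxx.
- move=> [[i j] /= ij] [[i' j'] /= ij'] e; apply/val_inj => /=.
  have {}e (m : nat) : (m < n)%N -> (i <= m < j)%N = (i' <= m < j')%N.
    move=> mn; have := congr1 (x (Ordinal mn)) e; rewrite /phiA /= !ladderB_coord /=.
    by do 4?case: leqP => ? //=; try lra; lia.
  have jn := bnd j; have jn' := bnd j'.
  have := (e i, e i', e j.-1, e j'.-1).
  move=> [[[e1 e2] e3] e4].
  congr pair; apply: val_inj => /=; lia.
Qed.

Lemma free_intervals_le (S : {set intervals}) :
  free_family phiA S -> (#|S| <= n.+1 ^ 2 %/ 4)%N.
Proof.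
move=> fS; pose L := [set (val p).1 | p in S]; pose U := [set (val p).2 | p in S].
have LU : [disjoint L & U].
  apply/pred0P => j /=; apply/negP => /andP[/imsetP[p pS pj] /imsetP[p' p'S p'j]].
  have e : (val p').2 = (val p).1 by rewrite -p'j.
  have lt := valP p; have lt' := valP p'; rewrite /= in lt lt'.
  have ik : ((val p').1 < (val p).2)%N by rewrite (ltn_trans lt') // e.
  apply: (free_pair_sum (k := exist _ ((val p').1, (val p).2) ik) (c := 1) fS p'S pS) => //.
  - by apply/eqP => /(congr1 val) e'; move: lt; rewrite -e e' /= ltnn.
  - by apply/eqP => /(congr1 val) e'; move: lt'; rewrite e e' /= ltnn.
  - by rewrite scale1r /phiA /= e addrA subrK.
have le1 : (#|S| <= #|L| * #|U|)%N.
  rewrite -(card_imset _ val_inj) -cardsX; apply: subset_leq_card.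
  apply/fintype.subsetP => _ /imsetP[p pS ->]; rewrite !inE.
  by apply/andP; split; apply: imset_f.
have le2 : (#|L| + #|U| <= n.+1)%N.
  have [_] := leq_card_setU L U; rewrite LU => /eqP <-.
  by rewrite -[X in (_ <= X)%N]card_ord max_card.
rewrite leq_divRL //; apply: leq_trans (_ : (#|L| + #|U|) ^ 2 <= _)%N; last by rewrite leq_exp2r.
apply: leq_trans (_ : #|L| * #|U| * 4 <= _)%N; first by rewrite leq_mul2r le1 orbT.
by rewrite mulnC; exact: (nat_AGM2 _ _).1.
Qed.

(** The roots whose support contains the middle simple root: with [t = n./2] there are [t + 1] left
    ends and [n - t] right ends, and all their pairs occur. *)
Lemma free_intervals_ex : (0 < n)%N ->
  exists2 S : {set intervals}, free_family phiA S & #|S| = (n.+1 ^ 2 %/ 4)%N.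
Proof.
move=> n0; have tn : (n./2 < n)%N by lia.
pose t := Ordinal tn; exists [set p | x t (phiA p) == 1].
  apply: (free_minuscule (ip := ip) (phi := phiA) (y := x t)).
  - by move=> [[i j] /= ij]; apply: ladder_norm => //; rewrite -ltnS.
  - exact: model_inj phiA_model.
  - exact: frameD F t.
  - exact: frameZ F t.
  - by move=> [[i j] /= ij]; rewrite /phiA ladderB_coord /=;
      do 2!case: (_ <= _)%N; rewrite ?mulr1n ?mulr0n; lra.
have -> : [set p | x t (phiA p) == 1]
    = [set p : intervals | ((val p).1 < t.+1)%N && ~~ ((val p).2 < t.+1)%N].
  apply/finset.setP => -[[i j] /= ij]; rewrite !inE /phiA ladderB_coord /= !ltnS.
  by case: (leqP i t) => _; case: (leqP j t) => _; rewrite ?mulr1n ?mulr0n /=;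
    first [apply/eqP; lra | apply/negbTE/eqP; lra].
rewrite -(card_imset _ val_inj).
have -> : [set val p | p in [set p : intervals | ((val p).1 < t.+1)%N && ~~ ((val p).2 < t.+1)%N]]
    = finset.setX [set i : 'I_n.+1 | (i < t.+1)%N] (~: [set i : 'I_n.+1 | (i < t.+1)%N]).
  apply/finset.setP => -[i j]; rewrite !inE /=; apply/imsetP/idP => [[[p pP]] |].
    by rewrite inE /= => /andP[p1 p2] e; move: p1 p2; rewrite -e /= => -> ->.
  move=> /andP[it tj]; have ij : (i < j)%N by lia.
  by exists (exist _ (i, j) ij); rewrite // inE /= it tj.
have t1 : (t.+1 <= n.+1)%N by rewrite ltnS ltnW.
set A := [set i : 'I_n.+1 | _]; have cA : #|A| = t.+1 by exact: card_ord_lt.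
have := cardsC A; rewrite card_ord cardsX cA; move: #|~: A| => c /= e.
have {e} -> : c = (n - n./2)%N by lia.
have := odd_double_half n; case: (odd n) => /= e.
  have -> : (n.+1 ^ 2 = ((n./2).+1 * (n - n./2)) * 4)%N by nia.
  by rewrite mulnK.
have -> : (n.+1 ^ 2 = ((n./2).+1 * (n - n./2)) * 4 + 1)%N by nia.
by rewrite divnMDl // divn_small // addn0.
Qed.

End TypeA.

Lemma type_A_entry (R : realType) (V : vectType R) (ip : {dot V for idfun})
    (Phi P : set V) (n : nat) (Delta : n.-tuple V) : (0 < n)%N ->
  root_system ip Phi -> positive_system Phi P -> simple_system Phi Delta ->
  coxeter_orders ip (fun i j : 'I_n => coxeter_matrix (type_A n) i j) Delta ->
  max_really_abelian_size P (n.+1 ^ 2 %/ 4) /\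
  helly_number P (cone P) (n.+1 ^ 2 %/ 4).
Proof.
move=> n0 PhiR PP D Dm.
apply: (table_entry PhiR PP D Dm (q := fun=> 2)
  (g := fun i j => chain_gram R i j) _ _ _ (phi := @phiA R V n)) => //.
- by move=> i; rewrite /chain_gram eqxx.
- move=> i j ij; have {}ij : (i == j :> nat) = false by apply: negbTE.
  rewrite /coxeter_matrix ij /edge_label chain_label3 ?ltn_ord ?ij // /chain_gram ij.
  by case: ifP => _; split=> //=; lra.
move=> b x F bg; split; first exact: phiA_model.
  exact: free_intervals_ex F bg n0.
exact: free_intervals_le.
Qed.

(** * Types B and D *)

Section Orthonormal.
Variables (R : realType) (V : vectType R) (ip : {dot V for idfun}).
Variables (n : nat) (e : 'I_n -> V).
Hypothesis he : forall i j, ip (e i) (e j) = (i == j)%:R.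

(* The pair [(i, j)] stands for [e_i - e_j] if [i < j], for [e_i + e_j] if
   [i > j], and for [e_i] if [i = j]. *)
Definition psi (p : 'I_n * 'I_n) : V :=
  if (p.1 < p.2)%N then e p.1 - e p.2
  else if (p.2 < p.1)%N then e p.1 + e p.2 else e p.1.

Lemma psi_coef p l : ip (psi p) (e l) = (p.1 == l)%:R +
  (if (p.1 < p.2)%N then - (p.2 == l)%:R
   else if (p.2 < p.1)%N then (p.2 == l)%:R else 0).
Proof.
by rewrite /psi; case: ltngtP => _; rewrite ?(ipDl, ipNl) !he ?addr0.
Qed.

Lemma psi_inj : injective psi.
Proof.
move=> p p' E.
have H l : ip (psi p) (e l) = ip (psi p') (e l) by rewrite E.
move: (H p.1) (H p.2) (H p'.1) (H p'.2); rewrite !psi_coef {E H}.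
case: p p' => [i j] [i' j'] /=; rewrite -!val_eqE /=.
move=> H1 H2 H3 H4; suff [ei ej] : i = i' :> nat /\ j = j' :> nat.
  by congr pair; apply: val_inj.
move: (i : nat) (j : nat) (i' : nat) (j' : nat) H1 H2 H3 H4 => {}i {}j {}i' {}j'.
rewrite !eqxx (eq_sym i' i) (eq_sym i' j) (eq_sym j' i) (eq_sym j' j).
case: (ltngtP i j) => ij; case: (ltngtP i' j') => ij';
case: (eqVneq i i') => ii; case: (eqVneq i j') => ij2;
case: (eqVneq j i') => ji; case: (eqVneq j j') => jj /= H1 H2 H3 H4;
first [by split | exfalso; clear -H1 H2 H3 H4; lra
      | exfalso; clear -ij ij' ii ij2 ji jj; lia | split; clear -ij ij' ii ij2 ji jj; lia].
Qed.

Lemma psi_neq0 p : psi p != 0.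
Proof.
apply/eqP => E; have := psi_coef p p.1; rewrite E ip0l eqxx.
rewrite -val_eqE /=; case: ltngtP => _; rewrite ?mulr0n ?oppr0 addr0 => /eqP;
by rewrite eq_sym oner_eq0.
Qed.

Lemma psi_coef_sqr p l : ip (psi p) (e l) \in [:: -1; 0; 1].
Proof.
rewrite psi_coef; case: p => i j /=; rewrite -!val_eqE /=.
case: (eqVneq (i : nat) l) => li; case: (eqVneq (j : nat) l) => lj;
case: ltngtP => ij; rewrite ?mulr0n ?mulr1n ?(oppr0, addr0, add0r) !inE ?eqxx ?orbT //;
  by exfalso; move: ij; rewrite li lj ltnn.
Qed.

Lemma signed_pair i j (s t : bool) : i != j -> exists p, p.1 != p.2 /\
  ((-1) ^+ s *: e i + (-1) ^+ t *: e j = psi p \/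
   (-1) ^+ s *: e i + (-1) ^+ t *: e j = - psi p).
Proof.
move=> ij; wlog lt : i j s t ij / (i < j)%N.
  move=> W; have := ij; rewrite neq_ltn => /orP[|] lt; first exact: W.
  by rewrite addrC; apply: W; rewrite // eq_sym.
case: (boolP (s == t)) => st.
  exists (j, i); rewrite eq_sym ij /psi /= ltnNge ltnW //= lt.
  by split=> //; rewrite (eqP st); case: t {st}; rewrite ?(scaleN1r, scale1r); [right|left];
    rewrite ?opprD addrC.
exists (i, j); rewrite ij /psi /= lt; split=> //.
by case: s t st => [] [] //= _; rewrite !(scaleN1r, scale1r); [right; rewrite opprB addrC|left].
Qed.

(** Simple reflections of types B and D are signed permutations of the [e i]. The clause on distinct
    indices keeps the roots of type D, those off the diagonal, stable. *)
Lemma psi_signed (f : V -> V) (pi : 'I_n -> 'I_n) (s : 'I_n -> bool) p :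
  (forall u v, f (u + v) = f u + f v) -> (forall u, f (- u) = - f u) ->
  injective pi -> (forall i, f (e i) = (-1) ^+ s i *: e (pi i)) ->
  exists p', (p.1 != p.2 -> p'.1 != p'.2) /\ (f (psi p) = psi p' \/ f (psi p) = - psi p').
Proof.
move=> fD fN pi_inj fe; move: (erefl (psi p)); rewrite {1}/psi.
case: ltngtP => lt <-.
- have ij : pi p.1 != pi p.2 by apply: contraTneq lt => /pi_inj ->; rewrite ltnn.
  have [p' [p'n E]] := signed_pair (s p.1) (~~ s p.2) ij; exists p'; split=> //.
  by move: E; rewrite fD fN !fe signrN scaleNr.
- have ij : pi p.1 != pi p.2 by apply: contraTneq lt => /pi_inj ->; rewrite ltnn.
  have [p' [p'n E]] := signed_pair (s p.1) (s p.2) ij; exists p'; split=> //.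
  by move: E; rewrite fD !fe.
exists (pi p.1, pi p.1); split.
  by move/negP; case; apply/eqP/val_inj.
by rewrite fe /psi /= ltnn; case: (s _); rewrite ?(scaleN1r, scale1r); [right|left].
Qed.

Let half2 (z : R) : 2 * z / 2 = z.
Proof. by rewrite mulrAC divff ?mul1r ?pnatr_eq0. Qed.

Lemma ip_diff k l : k != l -> ip (e k - e l) (e k - e l) = 2.
Proof.
by move=> kl; rewrite !ipE !he !eqxx (eq_sym l k) (negbTE kl) !mulr0n !mulr1n; ring.
Qed.

Lemma ip_plus k l : k != l -> ip (e k + e l) (e k + e l) = 2.
Proof.
by move=> kl; rewrite !ipE !he !eqxx (eq_sym l k) (negbTE kl) !mulr0n !mulr1n; ring.
Qed.

Lemma refl_diff k l i : k != l -> reflection ip (e k - e l) (e i) = e (tperm k l i).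
Proof.
move=> kl; rewrite reflE ip_diff // half2 ipDr ipNr !he.
case: tpermP => [->|->|/eqP ik /eqP il].
- by rewrite eqxx (negbTE kl) mulr0n mulr1n subr0 scale1r opprB addrC subrK.
- rewrite eqxx eq_sym (negbTE kl) mulr0n mulr1n sub0r scaleN1r.
  by rewrite opprK addrC subrK.
- by rewrite (negbTE ik) (negbTE il) subrr scale0r subr0.
Qed.

Lemma refl_plus k l i : k != l -> reflection ip (e k + e l) (e i)
  = (-1) ^+ (i \in [set k; l]) *: e (tperm k l i).
Proof.
move=> kl; rewrite reflE ip_plus // half2 ipDr !he !inE.
case: tpermP => [->|->|/eqP ik /eqP il].
- rewrite eqxx (negbTE kl) mulr0n mulr1n addr0 scale1r scaleN1r opprD addrA.
  by rewrite subrr add0r.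
- rewrite eqxx orbT eq_sym (negbTE kl) mulr0n mulr1n add0r scale1r scaleN1r opprD.
  by rewrite addrCA subrr addr0.
- by rewrite (negbTE ik) (negbTE il) mulr0n addr0 scale0r subr0 scale1r.
Qed.

Lemma refl_unit k i : reflection ip (e k) (e i) = (-1) ^+ (i == k) *: e i.
Proof.
rewrite reflE !he eqxx divr1; case: eqVneq => [->|_].
  by rewrite mulr1 scaler_nat mulr2n opprD addrA subrr add0r scaleN1r.
by rewrite mulr0 scale0r subr0 scale1r.
Qed.

End Orthonormal.

Lemma double_bin2 k : ('C(k, 2) * 2 = k * k.-1)%N.
Proof. by elim: k => // k IHk; rewrite binS mulnDl IHk bin1; nia. Qed.

Lemma card_oriented_graph (T : finType) (K : {set T}) (S : {set T * T}) :
  (forall p, p \in S -> [/\ p.1 != p.2, p.1 \in K, p.2 \in K & (p.2, p.1) \notin S]) ->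
  (#|S| <= 'C(#|K|, 2))%N.
Proof.
move=> SP; pose f (p : T * T) := [set p.1; p.2].
have f_inj : {in S &, injective f}.
  move=> [i j] [i' j'] pS p'S; rewrite /f /= => E.
  have [/= ij _ _ ji] := SP _ pS; have [/= ij' _ _ _] := SP _ p'S.
  have : i \in [set i'; j'] by rewrite -E !inE eqxx.
  have : j \in [set i'; j'] by rewrite -E !inE eqxx orbT.
  rewrite !inE => /orP[]/eqP ej /orP[]/eqP ei; subst i j => //.
  - by rewrite eqxx in ij.
  - by rewrite p'S in ji.
  - by rewrite eqxx in ij.
rewrite -(card_in_imset f_inj) -cards_draws; apply: subset_leq_card.
apply/fintype.subsetP => _ /imsetP[p /SP[p12 p1 p2 _] ->].
rewrite !inE cards2 p12 eqxx andbT; apply/fintype.subsetP => k.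
by rewrite !inE => /orP[]/eqP ->.
Qed.

Lemma card_below_diagonal n : #|[set p : 'I_n * 'I_n | (p.2 < p.1)%N]| = 'C(n, 2).
Proof.
rewrite -sum1_card (eq_bigl (fun p : 'I_n * 'I_n => true && (p.2 < p.1)%N)); last first.
  by move=> p; rewrite inE.
rewrite -(pair_big_dep xpredT (fun i j : 'I_n => (j < i)%N) (fun _ _ => 1%N)) /=.
rewrite (eq_bigr (fun i : 'I_n => i : nat)) => [|i _].
  by rewrite -bin2_sum big_mkord.
rewrite sum1_card -[RHS](card_ord_lt (ltnW (ltn_ord i))).
by apply: eq_card => j; rewrite !inE.
Qed.

Section SignedPairs.
Variables (R : realType) (V : vectType R) (ip : {dot V for idfun}).
Variables (n : nat) (e : 'I_n -> V).
Hypothesis he : forall i j, ip (e i) (e j) = (i == j)%:R.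

Definition plus_pair (i k : 'I_n) : 'I_n * 'I_n := if (k < i)%N then (i, k) else (k, i).

Lemma psi_plus_pair i k : i != k -> psi e (plus_pair i k) = e i + e k.
Proof.
rewrite /plus_pair /psi -val_eqE /=; case: (ltngtP k i) => //= ki _.
  by rewrite ltnNge ltnW //= ki.
by rewrite ltnNge ltnW //= ki addrC.
Qed.

Lemma psi_lt (i j : 'I_n) : (i < j)%N -> psi e (i, j) = e i - e j.
Proof. by rewrite /psi /= => ->. Qed.

Lemma psi_gt (i j : 'I_n) : (j < i)%N -> psi e (i, j) = e i + e j.
Proof. by move=> ji; rewrite /psi /= ltnNge ltnW //= ji. Qed.

Lemma psi_diag i : psi e (i, i) = e i.
Proof. by rewrite /psi /= ltnn. Qed.

Definition weight (X : 'I_n -> R) (v : V) : R := \sum_l X l * ip v (e l).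

Lemma weightD X u v : weight X (u + v) = weight X u + weight X v.
Proof.
by rewrite /weight -big_split; apply: eq_bigr => l _; rewrite /= ipDl mulrDr.
Qed.

Lemma weightZ X c v : weight X (c *: v) = c * weight X v.
Proof. by rewrite /weight mulr_sumr; apply: eq_bigr => l _; rewrite ipZl mulrCA. Qed.

Lemma weight_e X i : weight X (e i) = X i.
Proof.
rewrite /weight (bigD1 i) //= he eqxx mulr1 big1 ?addr0 // => l li.
by rewrite he eq_sym (negbTE li) mulr0.
Qed.

Lemma weight_psi X p : weight X (psi e p) =
  if (p.1 < p.2)%N then X p.1 - X p.2
  else if (p.2 < p.1)%N then X p.1 + X p.2 else X p.1.
Proof.
by rewrite /psi; case: ltngtP => _; rewrite ?weightD ?weight_e // -scaleN1r weightZ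
  weight_e mulN1r.
Qed.

(** Both [e_i - e_j] and [e_i + e_j] cannot occur, as they add up to [2 e_i]; this gives one edge at
    most for each pair of indices. Nor can [e_i] and [e_j], whose sum is a root; this leaves one
    unit vector at most. *)
Lemma free_B_le (S : {set 'I_n * 'I_n}) :
  free_family (psi e) S -> (#|S| <= 'C(n, 2) + 1)%N.
Proof.
move=> fS; pose D := [set p : 'I_n * 'I_n | p.1 == p.2].
rewrite -(cardsID D S) addnC; apply: leq_add.
  rewrite -[X in 'C(X, 2)]card_ord -cardsT; apply: card_oriented_graph => -[i j].
  rewrite !inE /= => /andP[ij pS]; split=> //; rewrite eq_sym ij /=.
  wlog lt : i j ij pS / (i < j)%N.
    move=> W; have := ij; rewrite neq_ltn => /orP[|] lt; first exact: W.
    apply/negP => pS'; have := W j i; rewrite eq_sym ij => /(_ isT pS' lt).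
    by rewrite pS.
  apply/negP => pS'; apply: (free_pair_sum (k := (i, i)) (c := 2^-1) fS pS pS').
  - by apply: contra ij => /eqP[->].
  - by apply: contra ij => /eqP[->].
  - by rewrite invr_ge0 ler0n.
  - rewrite psi_diag psi_lt // psi_gt // addrA subrK -mulr2n.
    by rewrite -scaler_nat scalerK ?pnatr_eq0.
apply/card_le1_eqP => -[i i'] [j j']; rewrite !inE /=.
move=> /andP[iS /eqP ei] /andP[jS /eqP ej]; subst i' j'.
apply/eqP; apply: contraT => ij; have {}ij : i != j by apply: contra ij => /eqP ->.
have np l : (l, l) != plus_pair i j.
  by rewrite /plus_pair; case: ifP => _; apply: contra ij => /eqP[<- <-].
exfalso; apply: (free_pair_sum (k := plus_pair i j) (c := 1) fS iS jS) => //.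
by rewrite psi_plus_pair // !psi_diag scale1r.
Qed.

Lemma free_B_ex : (0 < n)%N ->
  exists2 S : {set 'I_n * 'I_n}, free_family (psi e) S & #|S| = ('C(n, 2) + 1)%N.
Proof.
move=> n0; pose o := Ordinal n0.
exists ((o, o) |: [set p : 'I_n * 'I_n | (p.2 < p.1)%N]); last first.
  by rewrite cardsU1 card_below_diagonal inE /= addnC.
apply: free_of_functionals => [p|p]; first exact: (psi_neq0 he).
(* Each form vanishes at [psi p] and is positive on the rest of the set. The unit vector added is
   the one of index 0 because in the second case the form is negative at [e_i] for the larger index
   [i], which is never 0. *)
pose X (l : 'I_n) : R := if (p.1 < p.2)%N then 1 else if (p.2 < p.1)%N then
  (if l == p.1 then -1 else if l == p.2 then 1 else 2) else (l != p.1)%:R.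
exists (weight X); split; [exact: weightD|exact: weightZ| |].
  rewrite weight_psi /X; case: ltngtP => lt; rewrite ?eqxx ?subrr //.
  by rewrite -val_eqE (ltn_eqF lt) addNr.
move=> [k l]; rewrite in_setU1 weight_psi /= => /orP[/eqP[-> ->]|].
  rewrite ltnn /X; case: p {X} => i j /=; case: (ltngtP i j) => lt np.
  - by rewrite ltr01.
  - have -> : (o == i) = false by apply/eqP => oi; rewrite -oi in lt.
    by case: ifP; rewrite ?ltr01 ?ltr0n.
  - suff -> : o != i by rewrite ltr01.
    by apply: contra np => /eqP ->; rewrite xpair_eqE eqxx -val_eqE /= lt eqxx.
rewrite inE /= => lk np; rewrite ltnNge ltnW //= lk /X.
case: p np {X} => i j /=; case: (ltngtP i j) => lt; rewrite xpair_eqE => np.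
- lra.
- have [ki|ki] := eqVneq k i.
    have -> : (l == i) = false by rewrite -ki -val_eqE /= ltn_eqF.
    have -> : (l == j) = false by rewrite ki eqxx in np; exact: negbTE.
    by rewrite addrC; lra.
  have [li|li] := eqVneq l i; last by do 2?case: ifP => _; lra.
  have -> : (k == j) = false; last by lra.
  by apply/eqP => kj; move: lk; rewrite li kj ltnNge ltnW.
- have [ki|_] := eqVneq k i; have [li|_] := eqVneq l i; rewrite ?mulr0n ?mulr1n; try lra.
  by move: lk; rewrite ki li ltnn.
Qed.

Definition offdiag := {p : 'I_n * 'I_n | p.1 != p.2}.

Definition psiD (p : offdiag) : V := psi e (val p).

(** Half the sum of the coordinates, a spin weight, is 1 on every [e_i + e_j] and 0 on every
    [e_i - e_j]. *)
Lemma free_D_ex :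
  exists2 S : {set offdiag}, free_family psiD S & #|S| = 'C(n, 2).
Proof.
pose y := weight (fun=> 2^-1).
have yE p : y (psi e p) = if (p.1 < p.2)%N then 0 else if (p.2 < p.1)%N then 1 else 2^-1.
  by rewrite /y weight_psi subrr; do 2!case: ifP => // _; field.
exists [set k | y (psiD k) == 1].
  apply: (free_minuscule (ip := ip) (phi := psiD) (y := y)).
  - move=> [[i j] /= ij]; rewrite /psiD /psi /=; case: (ltngtP i j) => lt.
    + exact: ip_diff.
    + exact: ip_plus.
    + by move: ij; rewrite -val_eqE /= lt eqxx.
  - by move=> p q /(psi_inj he)/val_inj.
  - exact: weightD.
  - exact: weightZ.
  - by move=> p; rewrite /psiD yE; do 2!case: ifP => // _; lra.
rewrite -card_below_diagonal -(card_imset _ val_inj); apply: eq_card => p.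
rewrite inE; apply/imsetP/idP => [[q + ->]|lt].
  rewrite inE /psiD yE; case: ltngtP => // _; first by rewrite eq_sym oner_eq0.
  by move/eqP; lra.
have np : p.1 != p.2 by rewrite -val_eqE /= gtn_eqF.
by exists (exist _ p np) => //; rewrite inE /psiD yE /= ltnNge ltnW //= lt.
Qed.

Lemma free_D_le (S : {set offdiag}) : (4 <= n)%N ->
  free_family psiD S -> (#|S| <= 'C(n, 2))%N.
Proof.
move=> n4 fS; pose T := [set val p | p in S].
rewrite -(card_imset _ val_inj) -/T.
have Tn p : p \in T -> p.1 != p.2 by move=> /imsetP[q _ ->]; exact: valP q.
have conflict p q r : p \in T -> q \in T -> r.1 != r.2 -> p != r -> q != r ->
    psi e r = psi e p + psi e q -> False.
  move=> /imsetP[p' p'S ->] /imsetP[q' q'S ->] rn pr qr rE.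
  apply: (free_pair_sum (k := exist _ r rn : offdiag) (c := 1) fS p'S q'S) => //.
  by rewrite scale1r.
(* If [e_i - e_j] and [e_i + e_j] both occur, no other member involves [e_j]; [m] such
   pairs leave at most [2 m + 'C(n - m, 2) <= 'C(n, 2)] members. *)
pose twin (i j : 'I_n) := [&& (i < j)%N, (i, j) \in T & (j, i) \in T].
(* According to the sign of [e_j] in [q], one of [e_i - e_j] and [e_i + e_j] cancels it, and the sum
   is a root not involving [e_j]. *)
have touch i j q : twin i j -> q \in T -> (q.1 == j) || (q.2 == j) ->
    q \in [set (i, j); (j, i)].
  move=> /and3P[ij ijT jiT] qT qj; apply: contraT => qn; exfalso.
  have nij : i != j by rewrite -val_eqE /= ltn_eqF.
  have jpp k p : p.1 = j \/ p.2 = j -> k != j -> p != plus_pair i k.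
    by move=> pj kj; rewrite /plus_pair; case: ifP => _; apply: contraNneq kj => E;
      move: pj nij; rewrite E /= => -[] ->; rewrite ?eqxx.
  have offpp k : i != k -> (plus_pair i k).1 != (plus_pair i k).2.
    by rewrite /plus_pair; case: ifP => //= _; rewrite eq_sym.
  move: q qT qj qn => [a c] qT /= /orP[]/eqP E; subst; rewrite !inE !xpair_eqE eqxx /=.
    rewrite negb_or negb_and => /andP[_ ci]; have cj : c != j by rewrite eq_sym (Tn _ qT).
    have ic : i != c by rewrite eq_sym.
    have [jc|lt] := ltnP j c.
      apply: (conflict (i, j) (j, c) (i, c)) => //=.
      - by rewrite xpair_eqE negb_and (eq_sym j) cj orbT.
      - by rewrite xpair_eqE negb_and (eq_sym j) nij.
      - by rewrite !psi_lt ?addrA ?subrK // (ltn_trans ij).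
    have {}lt : (c < j)%N by rewrite ltn_neqAle lt andbT.
    apply: (conflict (i, j) (j, c) (plus_pair i c)) => //.
    - exact: offpp.
    - by apply: jpp; [right|].
    - by apply: jpp; [left|].
    - by rewrite psi_plus_pair // psi_lt // psi_gt // addrA subrK.
  rewrite andbT negb_or => /andP[ai _]; have aj : a != j by exact: (Tn _ qT).
  have ia : i != a by rewrite eq_sym.
  have [ja|lt] := ltnP j a.
    apply: (conflict (i, j) (a, j) (plus_pair i a)) => //.
    - exact: offpp.
    - by apply: jpp; [right|].
    - by apply: jpp; [right|].
    - by rewrite psi_plus_pair // psi_lt // psi_gt // [e a + _]addrC addrA subrK.
  have {}lt : (a < j)%N by rewrite ltn_neqAle lt andbT.
  apply: (conflict (j, i) (a, j) (plus_pair i a)) => //.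
  - exact: offpp.
  - by apply: jpp; [left|].
  - by apply: jpp; [right|].
  - by rewrite psi_plus_pair // (psi_gt ij) (psi_lt lt) [e j + _]addrC addrACA subrr addr0.
pose J := [set j | [exists i, twin i j]].
pose f j := if [pick i | twin i j] is Some i then i else j.
have fP j : j \in J -> twin (f j) j.
  by rewrite inE /f => /existsP[i ti]; case: pickP => // /(_ i); rewrite ti.
pose T1 := [set p in T | (p.1 \notin J) && (p.2 \notin J)].
have le1 : (#|T1| <= 'C(#|~: J|, 2))%N.
  apply: card_oriented_graph => p; rewrite finset.in_set => /andP[pT /andP[p1 p2]].
  have := Tn p pT; rewrite neq_ltn => lt.
  split; rewrite ?finset.in_setC //.
  rewrite finset.in_set; apply/negP => /andP[pT' _]; case/orP: lt => lt.
    move/negP: p2; apply; rewrite finset.in_set; apply/existsP; exists p.1.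
    by rewrite /twin lt pT' -surjective_pairing pT.
  move/negP: p1; apply; rewrite finset.in_set; apply/existsP; exists p.2.
  by rewrite /twin lt pT' -surjective_pairing pT.
have le2 : (#|T :\: T1| <= #|J| + #|J|)%N.
  apply: (@leq_trans #|[set (f j, j) | j in J] :|: [set (j, f j) | j in J]|).
    apply: subset_leq_card; apply/fintype.subsetP => p; rewrite finset.in_setD => /andP[+ pT].
    rewrite finset.in_set pT /= negb_and !negbK finset.in_setU => /orP[] pJ.
    - by have := touch _ _ p (fP _ pJ) pT; rewrite eqxx => /(_ isT);
        rewrite in_set2 => /orP[]/eqP E; apply/orP; [left|right];
        apply/imsetP; exists p.1.
    - by have := touch _ _ p (fP _ pJ) pT; rewrite eqxx orbT => /(_ isT);
        rewrite in_set2 => /orP[]/eqP E; apply/orP; [left|right];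
        apply/imsetP; exists p.2.
  by apply: leq_trans (leq_card_setU _ _).1 _; apply: leq_add; exact: leq_imset_card.
(* Index 0 is never the larger one of a pair, so [m <= n - 1]. With [4 <= n] this gives
   [m <= 2 n - 5], which is what the bound [2 m + 'C(n - m, 2) <= 'C(n, 2)] amounts to for positive
   [m]. *)
have Jn : (#|J| < n)%N.
  have n0 : (0 < n)%N by exact: leq_trans n4.
  rewrite -[X in (_ < X)%N]card_ord -cardsT; apply: proper_card.
  rewrite properT; apply/eqP => E; have : Ordinal n0 \in J by rewrite E inE.
  by rewrite inE => /existsP[i /and3P[]].
have cJ : (#|J| + #|~: J| = n)%N by rewrite cardsC card_ord.
rewrite -(cardsID T1 T); have -> : T :&: T1 = T1.
  by apply/finset.setIidPr; apply/fintype.subsetP => p; rewrite inE => /andP[].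
have := double_bin2 n; have := double_bin2 #|~: J|; nia.
Qed.

End SignedPairs.

(** Each [e i] is the last vector plus consecutive differences, so all products are recovered by
    downward induction from data at [n - 1]. Types B and D differ only in those data. *)
Lemma chain_orthonormal (R : realType) (V : vectType R) (ip : {dot V for idfun})
    (n : nat) (e : nat -> V) :
  (forall k l, (k.+1 < n)%N -> (l.+1 < n)%N ->
    ip (e k - e k.+1) (e l - e l.+1) = chain_gram R k l) ->
  (forall k, (k.+1 < n)%N -> ip (e n.-1) (e k - e k.+1) = - (k.+1 == n.-1)%:R) ->
  ip (e n.-1) (e n.-1) = 1 ->
  forall i j, (i < n)%N -> (j < n)%N -> ip (e i) (e j) = (i == j)%:R.
Proof.
move=> eg etop enorm.
have down (p : nat -> Prop) : p n.-1 -> (forall i, (i.+1 < n)%N -> p i.+1 -> p i) ->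
    forall i, (i < n)%N -> p i.
  move=> p0 pS i i_n; have -> : i = (n.-1 - (n.-1 - i))%N by lia.
  elim: (n.-1 - i)%N (leq_subr i n.-1) => [|d IHd] dn; first by rewrite subn0.
  have e1 : (n.-1 - d.+1).+1 = (n.-1 - d)%N by lia.
  by apply: pS; rewrite e1; [lia|apply: IHd; lia].
have eS i : e i = (e i - e i.+1) + e i.+1 by rewrite subrK.
have diff i k : (i < n)%N -> (k.+1 < n)%N ->
    ip (e i) (e k - e k.+1) = (i == k)%:R - (i == k.+1)%:R.
  move=> i_n kn; move: i i_n; apply: down.
    rewrite etop //.
    by do !case: eqP => ? /=; rewrite ?mulr1n ?mulr0n; first [lra | exfalso; lia].
  move=> i i_n IHi; rewrite eS ipDl IHi eg // /chain_gram.
  by do !case: eqP => ? /=; rewrite ?mulr1n ?mulr0n; first [lra | exfalso; lia].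
have top i : (i < n)%N -> ip (e i) (e n.-1) = (i == n.-1)%:R.
  move: i; apply: down; first by rewrite eqxx.
  move=> i i_n IHi; rewrite eS ipDl IHi (ipC ip _ (e n.-1)) etop // addNr.
  by have -> : (i == n.-1) = false by lia.
move=> i j i_n; move: j; apply: down => [|j jn IHj]; first exact: top.
rewrite (eS j) ipDr IHj diff //.
by do !case: eqP => ? /=; rewrite ?mulr1n ?mulr0n; first [lra | exfalso; lia].
Qed.

Section SimpleShapes.
Variables (R : realType) (V : vectType R) (ip : {dot V for idfun}).
Variables (n : nat) (e : 'I_n -> V).
Hypothesis he : forall i j, ip (e i) (e j) = (i == j)%:R.

Definition simple_shape (v : V) : Prop := exists k, v = e k \/
  exists2 l, k != l & v = e k - e l \/ v = e k + e l.

Lemma simple_shape_refl v p : simple_shape v ->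
  exists p', (p.1 != p.2 -> p'.1 != p'.2) /\
    (reflection ip v (psi e p) = psi e p' \/ reflection ip v (psi e p) = - psi e p').
Proof.
move=> [k [->|[l kl [->|->]]]].
- apply: (psi_signed _ (reflD ip _) (reflN ip _) (pi := id)) => //.
  exact: refl_unit.
- apply: (psi_signed (s := fun=> false) _ (reflD ip _) (reflN ip _) (@perm_inj _ (tperm k l))).
  by move=> i; rewrite refl_diff // scale1r.
- apply: (psi_signed _ (reflD ip _) (reflN ip _) (@perm_inj _ (tperm k l))).
  by move=> i; exact: refl_plus.
Qed.

Lemma simple_shape_ray v p c : simple_shape v -> 0 <= c -> psi e p = c *: v -> c = 1.
Proof.
move=> [k vE] c0 E; have vk : ip v (e k) = 1.
  case: vE => [->|[l kl [->|->]]]; rewrite ?ipE !he eqxx // eq_sym (negbTE kl) mulr0n mulr1n.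
    by rewrite subr0.
  by rewrite addr0.
have := psi_coef_sqr he p k; rewrite E ipZl vk mulr1 !inE => /or3P[]/eqP // cE.
  by move: c0; rewrite cE lerNr oppr0 ler10.
by have := psi_neq0 he p; rewrite E cE scale0r eqxx.
Qed.
End SimpleShapes.

Definition chain_gramB (R : realType) (n i j : nat) : R :=
  if i == j then (if i == n.-1 then 1 else 2) else chain_gram R i j.

Definition fork_gram (R : realType) (n i j : nat) : R :=
  if (i < n.-1)%N && (j < n.-1)%N then chain_gram R i j
  else if i == j then 2
  else if (i == (n - 3)%N) || (j == (n - 3)%N) then -1 else 0.

Section TypeB.
Variables (R : realType) (V : vectType R) (ip : {dot V for idfun}).
Variables (n : nat) (b : 'I_n -> V) (x : 'I_n -> V -> R).
Hypothesis F : frame b x.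
Hypothesis n0 : (0 < n)%N.
Hypothesis bg : forall i j : 'I_n, ip (b i) (b j) = chain_gramB R n i j.

Definition unitB (i : 'I_n) : V := ladder b i.

Let b_diff (i : 'I_n) : b i = ladder b i - ladder b i.+1.
Proof. by rewrite ladderS addrK. Qed.

Let top_ord : (n.-1 < n)%N. Proof. by rewrite ltn_predL. Qed.

Let ladder_top : ladder b n.-1 = b (Ordinal top_ord).
Proof.
rewrite (ladderS b (Ordinal top_ord)) /= prednK // /ladder big1 ?addr0 // => k.
by rewrite leqNgt ltn_ord.
Qed.

Lemma unitB_orthonormal i j : ip (unitB i) (unitB j) = (i == j)%:R.
Proof.
rewrite -val_eqE; apply: (chain_orthonormal (n := n)) => //.
- move=> k l kn ln; rewrite -(b_diff (Ordinal (ltnW kn))) -(b_diff (Ordinal (ltnW ln))).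
  rewrite bg /chain_gramB /= /chain_gram; have -> : (k == n.-1) = false by lia.
  by case: eqP.
- move=> k kn; rewrite -(b_diff (Ordinal (ltnW kn))) ladder_top bg /chain_gramB /chain_gram /=.
  by do !case: eqP => ? /=; rewrite ?mulr1n ?mulr0n; first [lra | exfalso; lia].
- by rewrite ladder_top bg /chain_gramB /= !eqxx.
Qed.

Let b_shape i : simple_shape unitB (b i).
Proof.
exists i; have [lt|ge] := ltnP i.+1 n.
  by right; exists (Ordinal lt); rewrite ?b_diff; [rewrite -val_eqE /= ltn_eqF|left].
left; rewrite /unitB ladderS /ladder big1 ?addr0 // => k ik.
by have := leq_trans ge ik; rewrite leqNgt ltn_ord.
Qed.

Let unitB_nonneg m i : 0 <= x m (unitB i).
Proof. by rewrite (ladder_coord F) ler0n. Qed.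

Lemma psiB_nonneg p m : 0 <= x m (psi unitB p).
Proof.
rewrite /psi; case: ltngtP => lt //; last by apply: (frame_nonnegD F).
by apply: (ladder_nonneg F); exact: ltnW.
Qed.

Lemma psiB_model : root_model ip b x (psi unitB).
Proof.
have he := unitB_orthonormal; split.
- exact: psiB_nonneg.
- exact: psi_neq0 he.
- move=> i; have [lt|ge] := ltnP i.+1 n.
    by exists (i, Ordinal lt); rewrite b_diff psi_lt /unitB /=.
  exists (i, i); rewrite psi_diag /unitB ladderS /ladder big1 ?addr0 // => k ik.
  by have := leq_trans ge ik; rewrite leqNgt ltn_ord.
- move=> i p; have [p' [_ E]] := simple_shape_refl he p (b_shape i).
  by exists p'.
- move=> p i c E; apply: (simple_shape_ray he (b_shape i) _ E).
  by have := psiB_nonneg p i; rewrite E (frameZ F) (frame_delta F) eqxx mulr1.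
- exact: psi_inj he.
Qed.
End TypeB.

Lemma chain_label34 n i j : (2 <= n)%N -> (i < n)%N -> (j < n)%N -> i != j ->
  chain_label (rcons (nseq n.-2 3%N) 4%N) (minn i j) (maxn i j) =
  if (i == j.+1) || (j == i.+1) then (if maxn i j == n.-1 then 4 else 3)%N else 2%N.
Proof.
move=> n2 i_n j_n ij; rewrite /chain_label /minn /maxn nth_rcons size_nseq nth_nseq.
case: ltngtP ij => // lt _.
  have -> : (i == j.+1) = false by lia.
  case: eqP => //= e; have [en|ne] := eqVneq j n.-1.
    have -> : (i < n.-2)%N = false by lia.
    by have -> : (i == n.-2) = true by lia.
  by have -> : (i < n.-2)%N = true by lia.
have -> : (j == i.+1) = false by lia.
rewrite orbF; case: eqP => //= e; have [en|ne] := eqVneq i n.-1.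
  have -> : (j < n.-2)%N = false by lia.
    by have -> : (j == n.-2) = true by lia.
by have -> : (j < n.-2)%N = true by lia.
Qed.

Lemma type_BC_entry (R : realType) (V : vectType R) (ip : {dot V for idfun})
    (Phi P : set V) (n : nat) (Delta : n.-tuple V) : (2 <= n)%N ->
  root_system ip Phi -> positive_system Phi P -> simple_system Phi Delta ->
  coxeter_orders ip (fun i j : 'I_n => coxeter_matrix (type_BC n) i j) Delta ->
  max_really_abelian_size P ('C(n, 2) + 1) /\
  helly_number P (cone P) ('C(n, 2) + 1).
Proof.
move=> n2 PhiR PP D Dm; have n0 : (0 < n)%N by exact: leq_trans n2.
apply: (table_entry PhiR PP D Dm (q := fun i : 'I_n => if (i : nat) == n.-1 then 1 else 2)
  (g := fun i j => chain_gramB R n i j) _ _ _ (phi := fun b => psi (unitB b))) => //.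
- by move=> i; case: ifP.
- by move=> i; rewrite /chain_gramB eqxx.
- move=> i j ij; have {}ij : (i == j :> nat) = false by apply: negbTE.
  rewrite /coxeter_matrix ij /edge_label chain_label34 ?ltn_ord ?ij //.
  rewrite /chain_gramB /chain_gram ij; case: ifP => adj; last by split=> //=; lra.
  have := ltn_ord i; have := ltn_ord j; rewrite /maxn.
  by case: (ltngtP i j) => // lt ? ?; do !case: eqP => ? //=; try (exfalso; lia);
    split=> //=; lra.
move=> b x F bg; have he := unitB_orthonormal n0 bg; split; first exact: psiB_model.
  exact: free_B_ex he n0.
exact: free_B_le.
Qed.

Section TypeD.
Variables (R : realType) (V : vectType R) (ip : {dot V for idfun}).
Variables (n : nat) (b : 'I_n -> V) (x : 'I_n -> V -> R).
Hypothesis F : frame b x.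
Hypothesis n3 : (3 <= n)%N.
Hypothesis bg : forall i j : 'I_n, ip (b i) (b j) = fork_gram R n i j.

Let b_diff (i : 'I_n) : b i = ladder b i - ladder b i.+1.
Proof. by rewrite ladderS addrK. Qed.

Let top_lt : (n.-1 < n)%N. Proof. lia. Qed.
Let top1_lt : (n.-2 < n)%N. Proof. lia. Qed.
Let top := Ordinal top_lt.
Let top1 := Ordinal top1_lt.

(** With [b_(n-2) = e_(n-2) - e_(n-1)] and [b_(n-1) = e_(n-2) + e_(n-1)], every [ladder b i] with
    [i < n] is [e_i + e_(n-2)]; in particular [ladder b n.-2 = 2 e_(n-2)]. Solving for [e_i] gives
    the formula. *)
Definition unitD (i : nat) : V :=
  ladder b i - 2^-1 *: (ladder b n.-2).

Let ladder_n i : (n <= i)%N -> ladder b i = 0.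
Proof.
move=> ni; rewrite /ladder big1 // => k ik.
by have := leq_trans ni ik; rewrite leqNgt ltn_ord.
Qed.

Let ladder_top : ladder b n.-1 = b top.
Proof. by rewrite (ladderS b top) /= ladder_n ?addr0 //; lia. Qed.

Let ladder_top1 : ladder b n.-2 = b top1 + b top.
Proof.
by rewrite (ladderS b top1) /= -ladder_top; congr (_ + ladder b _); lia.
Qed.

Let unitD_top : unitD n.-1 = 2^-1 *: (b top - b top1).
Proof.
rewrite /unitD ladder_top ladder_top1 scalerBr scalerDr opprD addrCA addrC; congr (_ + _).
rewrite -[X in X - _]scale1r -scalerBl; congr (_ *: _); lra.
Qed.

Let unitD_diff k : unitD k - unitD k.+1 = ladder b k - ladder b k.+1.
Proof. by rewrite /unitD opprB addrA subrK. Qed.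

Lemma unitD_orthonormal (i j : 'I_n) : ip (unitD i) (unitD j) = (i == j)%:R.
Proof.
rewrite -val_eqE; apply: (chain_orthonormal (n := n)) => //.
- move=> k l kn ln; rewrite !unitD_diff.
  rewrite -(b_diff (Ordinal (ltnW kn))) -(b_diff (Ordinal (ltnW ln))).
  by rewrite bg /fork_gram /= ifT //; lia.
- move=> k kn; rewrite unitD_diff -(b_diff (Ordinal (ltnW kn))) unitD_top.
  rewrite !ipE !bg /fork_gram /chain_gram /= ltnn /=.
  have -> : (n.-2 < n.-1)%N = true by lia.
  have -> : (k < n.-1)%N = true by lia.
  by do !case: eqP => ? /=; rewrite ?mulr1n ?mulr0n; first [lra | exfalso; lia].
- rewrite unitD_top !ipE !bg /fork_gram /chain_gram /= ltnn /= andbF !eqxx.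
  have -> : (n.-2 < n.-1)%N = true by lia.
  by do !case: eqP => ? /=; first [lra | exfalso; lia].
Qed.

Let b_top : b top = unitD n.-2 + unitD n.-1.
Proof.
rewrite unitD_top /unitD ladder_top1.
have -> : b top1 + b top - 2^-1 *: (b top1 + b top) = 2^-1 *: (b top1 + b top).
  rewrite -[X in X - _]scale1r -scalerBl; congr (_ *: _); lra.
rewrite -scalerDr [b top1 + _]addrC addrACA subrr addr0 -mulr2n -scaler_nat.
by rewrite scalerK // pnatr_eq0.
Qed.

Let e (i : 'I_n) := unitD i.

Let top1_neq : top1 != top.
Proof. by rewrite -val_eqE /=; lia. Qed.

Let b_shape i : simple_shape e (b i).
Proof.
have [lt|ge] := ltnP i.+1 n.
  exists i; right; exists (Ordinal lt); first by rewrite -val_eqE /= ltn_eqF.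
  by left; rewrite /e unitD_diff b_diff.
have -> : i = top by apply: val_inj => /=; have := ltn_ord i; lia.
by exists top1; right; exists top => //; right; rewrite b_top.
Qed.

Lemma psiD_nonneg p m : 0 <= x m (psiD e p).
Proof.
case: p => -[i j] /= ij; rewrite /psiD /psi /=; case: (ltngtP i j) => lt.
- by rewrite /e /unitD opprB addrA subrK (ladder_nonneg F) // ltnW.
- have -> : e i + e j = ladder b i + ladder b j - (b top1 + b top).
    rewrite /e /unitD addrACA -opprD -scalerDl ladder_top1; congr (_ - _).
    by rewrite -[RHS]scale1r; congr (_ *: _); lra.
  rewrite !(frameD F) (frameN F) (frameD F) !(ladder_coord F) !(frame_delta F) -!val_eqE /=.
  rewrite -!natrD subr_ge0 ler_nat.
  have := ltn_ord m; have := ltn_ord i; move: (m : nat) => {}m; lia.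
- by move: ij; rewrite -val_eqE /= lt eqxx.
Qed.

Lemma psiD_model : root_model ip b x (psiD e).
Proof.
have he := unitD_orthonormal; split.
- exact: psiD_nonneg.
- by move=> p; exact: psi_neq0 he _.
- move=> i; have [lt|ge] := ltnP i.+1 n.
    have np : (i, Ordinal lt).1 != (i, Ordinal lt).2 by rewrite -val_eqE /= ltn_eqF.
    by exists (exist _ (i, Ordinal lt) np); rewrite /psiD /= psi_lt //= /e unitD_diff b_diff.
  have -> : i = top by apply: val_inj => /=; have := ltn_ord i; lia.
  have np : (top, top1).1 != (top, top1).2 by rewrite eq_sym.
  exists (exist _ (top, top1) np); rewrite /psiD /= psi_gt /=; last by lia.
  by rewrite b_top addrC.
- move=> i p; have [p' [np E]] := simple_shape_refl he (val p) (b_shape i).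
  by exists (exist _ p' (np (valP p))).
- move=> p i c E; apply: (simple_shape_ray he (b_shape i) _ E).
  by have := psiD_nonneg p i; rewrite E (frameZ F) (frame_delta F) eqxx mulr1.
- by move=> p q /(psi_inj he)/val_inj.
Qed.
End TypeD.

Lemma fork_label_sym n i j : (3 <= n)%N -> (i < n)%N -> (j < n)%N -> i != j ->
  fork_label n (n - 3) (minn i j) (maxn i j) =
  if (i < n.-1)%N && (j < n.-1)%N
  then (if (i == j.+1) || (j == i.+1) then 3 else 2)%N
  else (if (i == (n - 3)%N) || (j == (n - 3)%N) then 3 else 2)%N.
Proof.
move=> n3 i_n j_n ij; rewrite /fork_label /minn /maxn.
by case: ltngtP ij => // lt _; case: (ltnP i n.-1) => ?; case: (ltnP j n.-1) => ? /=;
  do !case: eqP => ? //=; exfalso; lia.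
Qed.

Lemma type_D_entry (R : realType) (V : vectType R) (ip : {dot V for idfun})
    (Phi P : set V) (n : nat) (Delta : n.-tuple V) : (4 <= n)%N ->
  root_system ip Phi -> positive_system Phi P -> simple_system Phi Delta ->
  coxeter_orders ip (fun i j : 'I_n => coxeter_matrix (type_D n) i j) Delta ->
  max_really_abelian_size P 'C(n, 2) /\ helly_number P (cone P) 'C(n, 2).
Proof.
move=> n4 PhiR PP D Dm; have n3 : (3 <= n)%N by exact: ltnW.
apply: (table_entry PhiR PP D Dm (q := fun=> 2)
  (g := fun i j => fork_gram R n i j) _ _ _
  (phi := fun b => psiD (fun i : 'I_n => unitD b i))) => //.
- by move=> i; rewrite /fork_gram /chain_gram eqxx; case: ifP.
- move=> i j ij; have {}ij : (i == j :> nat) = false by apply: negbTE.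
  rewrite /coxeter_matrix ij /edge_label fork_label_sym ?ltn_ord ?ij //.
  rewrite /fork_gram /chain_gram ij.
  case: ((i < n.-1)%N && _); case: (_ || _); split=> //=; lra.
move=> b x F bg; have he := unitD_orthonormal n3 bg; split; first exact: psiD_model.
  exact: free_D_ex he.
by move=> S; apply: free_D_le.
Qed.

(** * Root tables over Z[phi] *)

Delimit Scope Z_scope with coqZ.

(* [(a, b)] stands for [a + b phi] in Z[phi], with [phi ^ 2 = phi + 1]. *)
Definition gold : Type := Z * Z.

Definition gadd (u v : gold) : gold := (Z.add u.1 v.1, Z.add u.2 v.2).
Definition gopp (u : gold) : gold := (Z.opp u.1, Z.opp u.2).
Definition gmul (u v : gold) : gold :=
  let bd := Z.mul u.2 v.2 in
  (Z.add (Z.mul u.1 v.1) bd, Z.add (Z.add (Z.mul u.1 v.2) (Z.mul u.2 v.1)) bd).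
Definition g0 : gold := (Z0, Z0).
Definition gint (a : Z) : gold := (a, Z0).
(** Sufficient but not necessary for the real number to be nonnegative: [2 - phi] fails it. *)
Definition gnonneg (u : gold) : bool := Z.leb Z0 u.1 && Z.leb Z0 u.2.
Definition gpos (u : gold) : bool := gnonneg u && (u != g0).

Definition scale_vec (c : gold) (v : seq gold) : seq gold := map (gmul c) v.
Definition add_vec (u v : seq gold) : seq gold := [seq gadd p.1 p.2 | p <- zip u v].

Definition vdot (u v : seq gold) : gold :=
  foldr (fun p s => gadd (gmul p.1 p.2) s) g0 (zip u v).

Definition unit_vec (n j : nat) : seq gold :=
  mkseq (fun i => if i == j then gint 1%coqZ else g0) n.

(* [Ct] lists the columns of the Cartan matrix. *)
Definition refl_vec (Ct : seq (seq gold)) (j : nat) (v : seq gold) : seq gold :=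
  set_nth g0 v j (gadd (nth g0 v j) (gopp (vdot v (nth [::] Ct j)))).

(** The last conjunct yields [model_ray]: a vector other than the [j]-th unit vector has a nonzero
    coordinate outside [j], so it is no multiple of that vector. *)
Definition model_check (n : nat) (Ct L : seq (seq gold)) : bool :=
  [&& size Ct == n, all (fun c => size c == n) Ct, uniq L,
      all (fun v => [&& size v == n, all gnonneg v & has (fun u => u != g0) v]) L,
      all (fun j => unit_vec n j \in L) (iota 0 n),
      all (fun v => all (fun j => let w := refl_vec Ct j v in
         (w \in L) || (map gopp w \in L)) (iota 0 n)) L
    & all (fun v => all (fun j => (v == unit_vec n j)
         || has (fun i => (i != j) && (nth g0 v i != g0)) (iota 0 n)) (iota 0 n)) L].

Definition cartan_product_gold (m : nat) : gold :=
  match m with 3 => gint 1%coqZ | 4 => gint 2%coqZ | 5 => (1, 1)%coqZ | _ => g0 end.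

Definition gram_check (T : root_type) (Ct G : seq (seq gold)) : bool :=
  let n := rank_of T in
  let g i j := nth g0 (nth [::] G i) j in
  all (fun i => gpos (g i i) && all (fun j =>
    (gmul (g j j) (nth g0 (nth [::] Ct j) i) == gmul (gint 2%coqZ) (g i j))
    && ((i == j) || let m := coxeter_matrix T i j in
      [&& (2 <= m <= 5)%N, gnonneg (gopp (g i j))
        & gmul (gint 4%coqZ) (gmul (g i j) (g i j))
          == gmul (cartan_product_gold m) (gmul (g i i) (g j j))])) (iota 0 n)) (iota 0 n).

Section GoldEval.
Variable R : realType.

Definition zev (a : Z) : R := (int_of_Z a)%:~R.
Definition gev (u : gold) : R := zev u.1 + zev u.2 * golden R.

Lemma zevD a b : zev (Z.add a b) = zev a + zev b.
Proof. by rewrite /zev -rmorphD /=; congr (_%:~R); lia. Qed.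

Lemma zevM a b : zev (Z.mul a b) = zev a * zev b.
Proof. by rewrite /zev -rmorphM /=; congr (_%:~R); lia. Qed.

Lemma zevN a : zev (Z.opp a) = - zev a.
Proof. by rewrite /zev -rmorphN /=; congr (_%:~R); lia. Qed.

Lemma zev_ge0 a : Z.leb Z0 a -> 0 <= zev a.
Proof. by move=> a0; rewrite /zev ler0z; lia. Qed.

Lemma zev_eq0 a : zev a = 0 -> a = Z0.
Proof. by move/eqP; rewrite /zev intr_eq0 => /eqP; lia. Qed.

Lemma gevD u v : gev (gadd u v) = gev u + gev v.
Proof. by rewrite /gev /gadd /= !zevD; ring. Qed.

Lemma gevN u : gev (gopp u) = - gev u.
Proof. by rewrite /gev /gopp /= !zevN; ring. Qed.

Lemma gevM u v : gev (gmul u v) = gev u * gev v.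
Proof.
rewrite /gev /gmul /= !zevD !zevM.
have := golden_sqr R; rewrite expr2; set p := golden R => pp.
transitivity (zev u.1 * zev v.1 + (zev u.1 * zev v.2 + zev u.2 * zev v.1) * p
  + zev u.2 * zev v.2 * (p + 1)); first by ring.
by rewrite -pp; ring.
Qed.

Lemma gev0 : gev g0 = 0.
Proof. by rewrite /gev /zev /= mul0r addr0. Qed.

Lemma gev_int a : gev (gint a) = zev a.
Proof. by rewrite /gev /zev /= mul0r addr0. Qed.

Lemma gev_ge0 u : gnonneg u -> 0 <= gev u.
Proof.
move=> /andP[u1 u2]; apply: addr_ge0; first exact: zev_ge0.
by apply: mulr_ge0; [exact: zev_ge0|exact: ltW (golden_gt0 R)].
Qed.

Lemma gev_gt0 u : gpos u -> 0 < gev u.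
Proof.
move=> /andP[u0 un]; rewrite lt_neqAle gev_ge0 // andbT eq_sym.
move/andP: u0 => [u1 u2]; rewrite /gev paddr_eq0 ?zev_ge0 //; last first.
  by apply: mulr_ge0; [exact: zev_ge0|exact: ltW (golden_gt0 R)].
apply: contra un; rewrite mulf_eq0 (gt_eqF (golden_gt0 R)) orbF.
move=> /andP[/eqP/zev_eq0 e1 /eqP/zev_eq0 e2].
by case: u e1 e2 {u1 u2} => /= a b -> ->.
Qed.

(** Infinite descent: modulo 2 the equation forces [a] and [b] to be even, and halving both
    preserves it. *)
Lemma golden_irrational (k : nat) (a b : Z) : (Z.to_nat (Z.abs b) < k)%N ->
  Z.add (Z.mul a a) (Z.mul a b) = Z.mul b b -> b = Z0.
Proof.
elim: k a b => // k IHk a b lt e.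
have [a' ea] : exists a', a = Z.mul 2 a'.
  have := Z.div_mod a 2; have := Z.mod_pos_bound a 2; have := Z.div_mod b 2;
  have := Z.mod_pos_bound b 2; set qa := Z.div a 2; set qb := Z.div b 2.
  by move=> *; exists qa; nia.
have [b' eb] : exists b', b = Z.mul 2 b'.
  have := Z.div_mod b 2; have := Z.mod_pos_bound b 2; set qb := Z.div b 2.
  by move=> *; exists qb; nia.
have [->//|b0] := Z.eq_dec b Z0.
have : b' = Z0 by apply: (IHk a'); nia.
lia.
Qed.

(** If [a + b phi = 0], then [a a + a b = b b (phi ^ 2 - phi) = b b], so [b = 0] by descent. Hence
    distinct table entries are distinct vectors. *)
Lemma gev_inj : injective gev.
Proof.
move=> u v e; have {e} : gev (gadd u (gopp v)) = 0 by rewrite gevD gevN e subrr.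
have -> : (u = v) = (gadd u (gopp v) = g0).
  apply/propext; split=> [->|]; first by rewrite /gadd /gopp /g0 /= !Z.add_opp_diag_r.
  by case: u v => [a b] [c d] [] /= *; congr pair; lia.
move: (gadd u (gopp v)) => [a b]; rewrite /gev /= => e.
have g2 := golden_sqr R.
have : zev (Z.add (Z.mul a a) (Z.mul a b)) = zev (Z.mul b b).
  rewrite zevD !zevM; have -> : zev a = - (zev b * golden R) by lra.
  transitivity (zev b * zev b * (golden R ^+ 2 - golden R)); first by ring.
  by rewrite g2; ring.
move/eqP; rewrite /zev eqr_int => /eqP eab.
have b0 : b = Z0.
  by apply: (@golden_irrational (Z.to_nat (Z.abs b)).+1 a) => //; lia.
move: e; rewrite b0 /zev /= mul0r addr0 => /eqP; rewrite intr_eq0 => /eqP a0.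
by congr pair; lia.
Qed.

End GoldEval.

Lemma gev_vdot (R : realType) n u v : size u = n -> size v = n ->
  gev R (vdot u v) = \sum_(i < n) gev R (nth g0 u i) * gev R (nth g0 v i).
Proof.
elim: n u v => [|n IHn] [|a u] [|c v] //=; first by rewrite big_ord0 gev0.
move=> [su] [sv]; rewrite big_ord_recl /= /vdot /= gevD gevM; congr (_ + _).
by rewrite -/(vdot u v) (IHn u v).
Qed.

Lemma nth_unit_vec n j i : (i < n)%N ->
  nth g0 (unit_vec n j) i = if i == j then gint 1%coqZ else g0.
Proof. by move=> i_n; rewrite nth_mkseq. Qed.

Section TableModel.
Variables (R : realType) (V : vectType R) (ip : {dot V for idfun}).
Variables (T : root_type) (Ct G L : seq (seq gold)).
Let n := rank_of T.
Hypothesis gramP : gram_check T Ct G.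
Hypothesis modelP : model_check n Ct L.

Definition gram_entry (i j : 'I_n) : R := gev R (nth g0 (nth [::] G i) j).

Let mem_iota_ord (i : 'I_n) : (i : nat) \in iota 0 n.
Proof. by rewrite mem_iota ltn_ord. Qed.

Lemma gram_entry_pos (i : 'I_n) : 0 < gram_entry i i.
Proof. by have /allP/(_ _ (mem_iota_ord i))/andP[/gev_gt0] := gramP. Qed.

Let gramE (i j : 'I_n) := allP (proj2 (andP (allP gramP _ (mem_iota_ord i)))) _ (mem_iota_ord j).

Lemma gram_entry_off (i j : 'I_n) : i != j ->
  [/\ (2 <= coxeter_matrix T i j <= 5)%N, gram_entry i j <= 0
  & 4 * gram_entry i j ^+ 2 =
    cartan_product R (coxeter_matrix T i j) * (gram_entry i i * gram_entry j j)].
Proof.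
move=> ij; have /andP[_ /orP[ij'|/and3P[m25 g0' /eqP ge]]] := gramE i j.
  by move: ij; rewrite -val_eqE ij'.
split=> //; first by rewrite -oppr_ge0 -gevN gev_ge0.
have := congr1 (gev R) ge; rewrite !gevM gev_int -expr2 => ->; congr (_ * _).
case: (coxeter_matrix T i j) m25 => [|[|[|[|[|[|?]]]]]] //= _;
  rewrite ?gev0 ?gev_int //.
by rewrite golden_sqr addrC -[golden R in RHS]mul1r.
Qed.

Variables (b : 'I_n -> V) (x : 'I_n -> V -> R).
Hypothesis F : frame b x.
Hypothesis bg : forall i j, ip (b i) (b j) = gram_entry i j.

Definition vev (v : seq gold) : V := \sum_(i < n) gev R (nth g0 v i) *: b i.

Lemma vev_add u v : size u = n -> size v = n -> vev (add_vec u v) = vev u + vev v.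
Proof.
move=> su sv; rewrite /vev -big_split; apply: eq_bigr => i _ /=.
rewrite (nth_map (g0, g0)) ?size_zip ?su ?sv ?minnn // nth_zip ?su ?sv //=.
by rewrite gevD scalerDl.
Qed.

Lemma vev_scale c v : size v = n -> vev (scale_vec c v) = gev R c *: vev v.
Proof.
move=> sv; rewrite /vev scaler_sumr; apply: eq_bigr => i _.
by rewrite (nth_map g0) ?sv // gevM scalerA.
Qed.

Lemma vev0 : vev (nseq n g0) = 0.
Proof.
by rewrite /vev big1 // => i _; rewrite nth_nseq if_same gev0 scale0r.
Qed.

Lemma vev_coord i v : x i (vev v) = gev R (nth g0 v i).
Proof.
have x0 : x i 0 = 0 by rewrite -(scale0r 0) (frameZ F) mul0r.
rewrite /vev (big_morph (x i) (frameD F i) x0) (bigD1 i) //= (frameZ F) (frame_delta F).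
rewrite eqxx mulr1 big1 ?addr0 // => j ji.
by rewrite (frameZ F) (frame_delta F) eq_sym (negbTE ji) mulr0.
Qed.

Lemma vev_opp v : vev (map gopp v) = - vev v.
Proof.
rewrite /vev -sumrN; apply: eq_bigr => i _; rewrite -scaleNr -gevN; congr (gev R _ *: _).
have [iv|vi] := ltnP i (size v); first exact: nth_map.
by rewrite !nth_default ?size_map.
Qed.

Lemma vev_unit (i : 'I_n) : vev (unit_vec n i) = b i.
Proof.
apply: (frame_ext F) => j; rewrite vev_coord nth_unit_vec // (frame_delta F).
by rewrite -val_eqE /=; case: eqP => _; rewrite ?gev0 // gev_int.
Qed.

Lemma vev_inj u v : size u = n -> size v = n -> vev u = vev v -> u = v.
Proof.
move=> su sv e; apply: (@eq_from_nth _ g0); rewrite su ?sv // => i i_n.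
by apply: (@gev_inj R); rewrite -(vev_coord (Ordinal i_n)) e vev_coord.
Qed.

Let CtP (j : 'I_n) : size (nth [::] Ct j) = n.
Proof.
have /and5P[/eqP sC /allP aC _ _ _] := modelP; apply/eqP; apply: aC.
by rewrite mem_nth // sC.
Qed.

Lemma refl_vev (j : 'I_n) v : size v = n ->
  reflection ip (b j) (vev v) = vev (refl_vec Ct j v).
Proof.
move=> sv; have c : 2 * ip (vev v) (b j) / ip (b j) (b j)
    = gev R (vdot v (nth [::] Ct j)).
  rewrite (gev_vdot R sv (CtP j)) /vev ip_suml mulr_sumr mulr_suml.
  apply: eq_bigr => i _; rewrite ipZl !bg.
  have /andP[/eqP/(congr1 (gev R)) ge _] := gramE i j.
  rewrite !gevM gev_int in ge; have g2 : zev R 2%coqZ = 2 by [].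
  rewrite mulrCA -mulrA; congr (_ * _).
  apply: (canLR (mulfK _)); first by rewrite gt_eqF // gram_entry_pos.
  by rewrite -g2 /gram_entry -ge mulrC.
apply: (frame_ext F) => i; rewrite reflE (frameD F) (frameN F) (frameZ F) (frame_delta F).
rewrite !vev_coord c /refl_vec nth_set_nth /= -val_eqE.
by case: eqP => [->|_]; rewrite ?gevD ?gevN ?mulr1 // mulr0 subr0.
Qed.

Definition phiL (k : 'I_(size L)) : V := vev (nth [::] L k).

Let L_P v : v \in L ->
  [/\ size v = n, forall i, gnonneg (nth g0 v i) & exists2 i, (i < n)%N & gpos (nth g0 v i)].
Proof.
have /and5P[_ _ _ /allP aL _] := modelP => /aL/and3P[/eqP sv /allP v0 /hasP[u uv un]].
have nn i : gnonneg (nth g0 v i).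
  by have [iv|vi] := ltnP i (size v); [apply/v0/mem_nth|rewrite nth_default].
split=> //; exists (index u v); first by rewrite -sv index_mem.
by rewrite nth_index // /gpos un andbT; exact: v0.
Qed.

Let memL (k : 'I_(size L)) : nth [::] L k \in L.
Proof. exact: mem_nth. Qed.

Let phiL_of v : v \in L -> exists k, phiL k = vev v.
Proof.
move=> vL; have iv : (index v L < size L)%N by rewrite index_mem.
by exists (Ordinal iv); rewrite /phiL nth_index.
Qed.

Lemma phiL_model : root_model ip b x phiL.
Proof.
have /and5P[_ _ uL _ /and3P[/allP uvL /allP rL /allP cL]] := modelP.
split.
- by move=> k i; rewrite vev_coord; apply: gev_ge0; have [_ + _] := L_P (memL k); apply.
- move=> k; have [_ _ [i i_n gi]] := L_P (memL k).
  apply/eqP => /(congr1 (x (Ordinal i_n))); rewrite vev_coord /= => e.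
  by have := gev_gt0 R gi; rewrite e -(scale0r 0) (frameZ F) mul0r ltxx.
- by move=> i; rewrite -vev_unit; apply: phiL_of; apply: uvL.
- move=> i k; have [sv _ _] := L_P (memL k); rewrite {1 3}/phiL refl_vev //.
  have /allP/(_ _ (mem_iota_ord i)) := rL _ (memL k).
  move=> /orP[/phiL_of[l le]|/phiL_of[l le]]; exists l; first by left; rewrite le.
  by right; rewrite le vev_opp opprK.
- move=> k i c e; have /allP/(_ _ (mem_iota_ord i)) := cL _ (memL k).
  move=> /orP[/eqP uk|/hasP[j]].
    move: e; rewrite /phiL uk vev_unit => /(congr1 (x i)).
    by rewrite (frameZ F) (frame_delta F) eqxx mulr1.
  rewrite mem_iota /= => jn /andP[ji /eqP]; case.
  apply: (@gev_inj R); rewrite gev0 -(vev_coord (Ordinal jn)) -/(phiL k) e (frameZ F).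
  by rewrite (frame_delta F) -val_eqE /= (negbTE ji) mulr0.
- move=> k l e; have [sk _ _] := L_P (memL k); have [sl _ _] := L_P (memL l).
  apply: val_inj; apply/eqP; rewrite -(nth_uniq [::] _ _ uL) ?ltn_ord //.
  by apply/eqP; apply: vev_inj.
Qed.

End TableModel.

Lemma table_model_entry (R : realType) (V : vectType R) (ip : {dot V for idfun})
    (Phi P : set V) (T : root_type) (Delta : (rank_of T).-tuple V) (N : nat)
    (Ct G L : seq (seq gold)) :
  root_system ip Phi -> positive_system Phi P -> simple_system Phi Delta ->
  coxeter_orders ip (fun i j : 'I_(rank_of T) => coxeter_matrix T i j) Delta ->
  gram_check T Ct G -> model_check (rank_of T) Ct L ->
  (forall (b : 'I_(rank_of T) -> V) x, frame b x ->
     (forall i j, ip (b i) (b j) = gram_entry R G i j) ->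
     (exists2 S : {set 'I_(size L)}, free_family (phiL (L := L) b) S & #|S| = N) /\
     (forall S : {set 'I_(size L)}, free_family (phiL (L := L) b) S -> (#|S| <= N)%N)) ->
  max_really_abelian_size P N /\ helly_number P (cone P) N.
Proof.
move=> PhiR PP D Dm gramP modelP H.
apply: (table_entry PhiR PP D Dm (q := fun i => gram_entry R G i i)
  (g := fun i j => gram_entry R G i j) _ _ _ (phi := fun b => phiL (L := L) b)) => //.
- by move=> i; exact: gram_entry_pos gramP i.
- by move=> i j; exact: gram_entry_off gramP i j.
- move=> b x F bg; have [ex le] := H b x F bg; split=> //.
  exact: (phiL_model gramP modelP F bg).
Qed.

(** * Type E *)

Lemma card_nth_set (A : eqType) (x0 : A) (L : seq A) (p : pred A) :
  #|[set k : 'I_(size L) | p (nth x0 L k)]| = count p L.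
Proof.
have -> : count p L = count p [seq tnth (in_tuple L) i | i <- enum 'I_(size L)].
  by rewrite map_tnth_enum.
rewrite cardsE cardE size_filter -enumT count_map.
by apply: eq_count => k; rewrite !inE /= (tnth_nth x0).
Qed.

Section SimplyLaced.
Variables (R : realType) (V : vectType R) (ip : {dot V for idfun}).
Variables (I : finType) (phi : I -> V).
Hypothesis phi_norm : forall k, ip (phi k) (phi k) = 2.
Hypothesis phi_neg : forall k l, ip (phi k) (phi l) < 0 ->
  ip (phi k) (phi l) = -1 /\ exists m, phi m = phi k + phi l.
Hypothesis phi_inj : injective phi.

(** For roots of norm 2, no two members add up to a root: the corresponding root vectors span an
    abelian subalgebra. *)
Definition abelian (S : {set I}) : bool :=
  [forall k in S, forall l in S, 0 <= ip (phi k) (phi l)].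

Lemma abelianP (S : {set I}) :
  reflect {in S &, forall k l, 0 <= ip (phi k) (phi l)} (abelian S).
Proof.
apply: (iffP forall_inP) => [H k l kS lS|H k kS].
  by have /forall_inP := H k kS; apply.
by apply/forall_inP => l; exact: H.
Qed.

Lemma free_abelian (S : {set I}) : free_family phi S -> abelian S.
Proof.
move=> fS; apply/abelianP => k l kS lS; rewrite leNgt; apply/negP => lt.
have phi0 m : phi m != 0.
  by apply/eqP => e; have /eqP := phi_norm m; rewrite e ip0l eq_sym pnatr_eq0.
have [_ [m mE]] := phi_neg lt.
apply: (free_pair_sum (k := m) (c := 1) fS kS lS) => //; last by rewrite scale1r.
  apply/eqP => km; move: mE; rewrite -km => /eqP.
  by rewrite -subr_eq0 opprD addrA subrr add0r oppr_eq0 (negbTE (phi0 l)).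
apply/eqP => lm; move: mE; rewrite -lm => /eqP.
by rewrite -subr_eq0 opprD addrCA subrr addr0 oppr_eq0 (negbTE (phi0 k)).
Qed.

Definition up_closed (a : I) (S : {set I}) : Prop :=
  forall k l, k \in S -> phi l = phi k + phi a -> l \in S.

Section Shift.
Variables (a : I) (S : {set I}).
Hypothesis abS : abelian S.

Definition moves (k l : I) : bool := (phi l == phi k + phi a) && (l \notin S).
Definition shift (k : I) : I := if [pick l | moves k l] is Some l then l else k.

Variant shift_spec k : I -> Prop :=
  | ShiftMoved l : phi l = phi k + phi a -> l \notin S -> shift_spec k l
  | ShiftFixed : (forall l, phi l = phi k + phi a -> l \in S) -> shift_spec k k.

Lemma shiftP k : shift_spec k (shift k).
Proof.
rewrite /shift; case: pickP => [l /andP[/eqP e n]|none]; first exact: ShiftMoved.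
by apply: ShiftFixed => l e; have := none l; rewrite /moves e eqxx => /negbFE.
Qed.

Lemma shift_inj : {in S &, injective shift}.
Proof.
move=> k k' kS k'S; case: (shiftP k) => [l e n|_]; case: (shiftP k') => [l' e' n'|_] E.
- by apply: phi_inj; apply: (addIr (phi a)); rewrite -e -e' E.
- by move: n; rewrite E k'S.
- by move: n'; rewrite -E kS.
- exact: E.
Qed.

(* Combinatorial shadow of the degeneration of [exp (t e_a) A] as [t] tends to
   infinity, for the abelian subalgebra [A] spanned by the root vectors of [S]. *)
Lemma shift_abelian : abelian [set shift k | k in S].
Proof.
have abP := abelianP S abS.
have moved k l : phi l = phi k + phi a -> ip (phi k) (phi a) = -1.
  by move=> e; have := phi_norm l; rewrite e !ipE !phi_norm (ipC ip (phi a)); lra.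
(* If [(a, k') = -1], then [k' + a] is a root, and lies in [S] because [k'] is not moved. Its
   product with [k] is nonnegative while [(k, a) = -1], so [(k, k') >= 1] makes up for the loss. *)
have mixed k k' l : k \in S -> k' \in S -> phi l = phi k + phi a ->
    (forall l', phi l' = phi k' + phi a -> l' \in S) -> 0 <= ip (phi l) (phi k').
  move=> kS k'S e fix'; rewrite e ipDl; have kk' := abP _ _ kS k'S.
  have [|neg] := leP 0 (ip (phi a) (phi k')); first by move=> ?; rewrite addr_ge0.
  have [e1 [l' l'E]] := phi_neg neg.
  have l'S : l' \in S by apply: fix'; rewrite l'E addrC.
  have := abP _ _ kS l'S; rewrite l'E ipDr (moved _ _ e) e1; lra.
apply/abelianP => _ _ /imsetP[k kS ->] /imsetP[k' k'S ->].
case: (shiftP k) => [l e n|fix1]; case: (shiftP k') => [l' e' n'|fix2].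
- rewrite e e' !ipE phi_norm (ipC ip (phi a) (phi k')) (moved _ _ e) (moved _ _ e').
  by have := abP _ _ kS k'S; lra.
- exact: mixed kS k'S e fix2.
- by rewrite ipC; exact: mixed k'S kS e' fix1.
- exact: abP.
Qed.
End Shift.

Variable h : V -> R.
Hypothesis hD : forall u v, h (u + v) = h u + h v.
Hypothesis h_gt0 : forall k, 0 < h (phi k).

(** Take an abelian set of the same size with largest total height. A shift never lowers a height,
    and along an [a] violating closure it would raise one. *)
Lemma abelian_up_closed (S : {set I}) : abelian S ->
  exists S' : {set I}, [/\ abelian S', #|S'| = #|S| & forall a, up_closed a S'].
Proof.
move=> abS; pose P (U : {set I}) := abelian U && (#|U| == #|S|).
pose w (U : {set I}) := \sum_(k in U) h (phi k).
have PS : P S by rewrite /P abS eqxx.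
case: (arg_maxP w PS) => U /andP[abU /eqP cU] maxU.
exists U; split=> // a k l kU e; apply: contraT => lU.
have cU' : #|[set shift a U j | j in U]| = #|S|.
  by rewrite card_in_imset // => ? ? *; exact: (shift_inj (a := a) (S := U)).
have := maxU [set shift a U j | j in U]; rewrite /P shift_abelian // cU' eqxx => /(_ isT).
rewrite /w big_imset /=; last by move=> ? ? *; exact: (shift_inj (a := a) (S := U)).
rewrite leNgt => /negP; case; rewrite (bigD1 k) //= [X in _ < X](bigD1 k) //=.
apply: ltr_leD.
  case: (shiftP a U k) => [m mE _|fixk]; first by rewrite mE hD ltrDl.
  by move: lU; rewrite (fixk l e).
apply: ler_sum => j _; case: (shiftP a U j) => [m mE _|_] //.
by rewrite mE hD lerDl ltW.
Qed.

End SimplyLaced.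

(** When [Ct] is also the Gram matrix, [vdot w (dual_vec Ct v)] is the inner product of [w] and [v];
    the list is computed once for all [w]. *)
Definition dual_vec (Ct : seq (seq gold)) (v : seq gold) : seq gold := map (vdot v) Ct.

Definition neg_one : gold := gint (-1)%coqZ.

Definition ade_check (Ct L : seq (seq gold)) : bool :=
  all (fun v => let d := dual_vec Ct v in all (fun w =>
    let g := vdot w d in
    if w == v then g == gint 2%coqZ
    else [|| g == g0, g == gint 1%coqZ
          | (g == neg_one) && (add_vec w v \in L)]) L) L.

Definition incr_vec (v : seq gold) (i : nat) : seq gold :=
  set_nth g0 v i (gadd (nth g0 v i) (gint 1%coqZ)).

Definition below (n : nat) (v w : seq gold) : bool :=
  has (fun i => incr_vec v i == w) (iota 0 n).

(* If no member of [rm] lies in an up-closed set, neither does a vector discarded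
   by [strip]. *)
Fixpoint strip (n : nat) (rm todo : seq (seq gold)) : seq (seq gold) :=
  if todo is v :: t then
    if has (below n v) rm then strip n (v :: rm) t else v :: strip n rm t
  else [::].

(** Taking the first vector [v] discards those with product -1 with it; leaving it out discards
    those from which it is reached by adding simple roots. A branch ends when fewer than [need]
    candidates remain. *)
Fixpoint ideal_search (Ct : seq (seq gold)) (fuel : nat) (todo : seq (seq gold))
    (need : nat) : bool :=
  (size todo < need)%N ||
  match fuel, todo with
  | f.+1, v :: t =>
      let d := dual_vec Ct v in
      ideal_search Ct f [seq w <- t | vdot w d != neg_one] need.-1
      && ideal_search Ct f (strip (size Ct) [:: v] t) need
  | _, _ => false
  end.

Lemma strip_subset n rm t : {subset strip n rm t <= t}.
Proof.
elim: t rm => //= v t IHt rm w; rewrite inE; case: ifP => _.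
  by move/IHt ->; rewrite orbT.
by rewrite inE => /orP[->//|/IHt ->]; rewrite orbT.
Qed.

Section IdealSearch.
Variables (Ct L : seq (seq gold)) (p : pred (seq gold)).
Hypothesis p_up : forall v w, v \in L -> w \in L -> below (size Ct) v w -> p v -> p w.
Hypothesis p_abelian : forall v w, v \in L -> w \in L -> p v -> p w ->
  vdot w (dual_vec Ct v) != neg_one.

Lemma strip_count rm t : {subset rm <= L} -> {subset t <= L} -> all (predC p) rm ->
  count p (strip (size Ct) rm t) = count p t.
Proof.
elim: t rm => //= v t IHt rm rmL vtL rmP.
have vL : v \in L by apply: vtL; rewrite mem_head.
have tL : {subset t <= L} by move=> w wt; apply: vtL; rewrite inE wt orbT.
case: ifP => [/hasP[w wrm vw]|_] /=; last by rewrite IHt.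
have pv : ~~ p v by apply: contra (allP rmP w wrm) => pv; exact: (p_up vL (rmL _ wrm) vw pv).
rewrite IHt /= ?(negbTE pv) // => u; rewrite inE => /orP[/eqP -> //|]; exact: rmL.
Qed.

Lemma ideal_search_count fuel todo need : {subset todo <= L} ->
  ideal_search Ct fuel todo need -> (count p todo < need)%N.
Proof.
elim: fuel todo need => [|f IHf] todo need todoL /= => [|/orP[]].
- by rewrite orbF; exact: leq_ltn_trans (count_size p todo).
- exact: leq_ltn_trans (count_size p todo).
case: todo todoL => // v t vtL /andP[inc exc] /=.
have vL : v \in L by apply: vtL; rewrite mem_head.
have tL : {subset t <= L} by move=> w wt; apply: vtL; rewrite inE wt orbT.
have [pv|npv] := boolP (p v).
  have {inc} : (count p [seq w <- t | vdot w (dual_vec Ct v) != neg_one] < need.-1)%N.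
    by apply: IHf inc => w; rewrite mem_filter => /andP[_ /tL].
  rewrite count_filter (_ : count _ t = count p t); first by lia.
  apply: eq_in_count => w /tL wL /=; have [pw|//] := boolP (p w).
  by rewrite p_abelian.
rewrite add0n -(@strip_count [:: v]) /= ?npv //; last first.
  by move=> w; rewrite inE => /eqP ->.
by apply: IHf exc => w /strip_subset/tL.
Qed.
End IdealSearch.

(* The free set consists of the vectors whose [j]-th coordinate exceeds half its maximum
   [M]: from such a [w] the others are separated by [v |-> 2 v_j / M - (v, w)]. *)
Definition top_check (Ct L : seq (seq gold)) (N j : nat) (M : Z) : bool :=
  [&& Z.ltb Z0 M,
      all (fun v => gnonneg (gadd (gint M) (gopp (nth g0 v j)))) L,
      all (fun v => let t := gadd (gmul (gint 2%coqZ) (nth g0 v j)) (gopp (gint M)) in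
         gpos t || gnonneg (gopp t)) L,
      count (fun v => gpos (gadd (gmul (gint 2%coqZ) (nth g0 v j)) (gopp (gint M)))) L == N
    & ideal_search Ct (size L) L N.+1].

Section ADE.
Variables (R : realType) (V : vectType R) (ip : {dot V for idfun}).
Variables (T : root_type) (Ct L : seq (seq gold)).
Let n := rank_of T.
Hypothesis gramP : gram_check T Ct Ct.
Hypothesis modelP : model_check n Ct L.
Hypothesis adeP : ade_check Ct L.
Variables (N j : nat) (M : Z).
Hypothesis topP : top_check Ct L N j M.
Variables (b : 'I_n -> V) (x : 'I_n -> V -> R).
Hypothesis F : frame b x.
Hypothesis bg : forall i j, ip (b i) (b j) = gram_entry R Ct i j.

Let phi : 'I_(size L) -> V := phiL (L := L) b.

Let size_Ct : size Ct = n.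
Proof. by have /and5P[/eqP] := modelP. Qed.

Let size_col i : (i < n)%N -> size (nth [::] Ct i) = n.
Proof.
have /and5P[/eqP sC /allP aC _ _ _] := modelP => i_n; apply/eqP; apply: aC.
by rewrite mem_nth // sC.
Qed.

Let size_L v : v \in L -> size v = n.
Proof. by have /and5P[_ _ _ /allP aL _] := modelP => /aL/and3P[/eqP]. Qed.

Let memL (k : 'I_(size L)) : nth [::] L k \in L.
Proof. exact: mem_nth. Qed.

Lemma ip_vev v w : size v = n -> size w = n ->
  ip (vev b w) (vev b v) = gev R (vdot w (dual_vec Ct v)).
Proof.
move=> sv sw; rewrite (gev_vdot R sw); last by rewrite size_map.
rewrite /vev ip_suml; apply: eq_bigr => i _; rewrite ipZl; congr (_ * _).
rewrite (nth_map [::]) ?size_Ct // (gev_vdot R sv (size_col _)) // ipC ip_suml.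
by apply: eq_bigr => l _; rewrite ipZl ipC bg.
Qed.

Let ip_phi (k l : 'I_(size L)) :
  ip (phi l) (phi k) = gev R (vdot (nth [::] L l) (dual_vec Ct (nth [::] L k))).
Proof. by apply: ip_vev; exact: size_L. Qed.

Let adeE (k l : 'I_(size L)) :=
  allP (allP adeP _ (memL k)) _ (memL l).

Let phi_inj : injective phi.
Proof. exact: model_inj (phiL_model gramP modelP F bg). Qed.

Let uL : uniq L.
Proof. by have /and5P[] := modelP. Qed.

Let phi_norm k : ip (phi k) (phi k) = 2.
Proof. by have := adeE k k; rewrite /= eqxx => /eqP e; rewrite ip_phi e gev_int. Qed.

Let phi_le1 k l : l != k -> ip (phi l) (phi k) <= 1.
Proof.
move=> lk; have := adeE k l; rewrite /= nth_uniq // -[_ == _]/(l == k) (negbTE lk) ip_phi.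
by move=> /or3P[/eqP ->|/eqP ->|/andP[/eqP -> _]]; rewrite ?gev0 ?gev_int ?ler01 // /zev lerz1.
Qed.

Let phi_neg k l : ip (phi k) (phi l) < 0 ->
  ip (phi k) (phi l) = -1 /\ exists m, phi m = phi k + phi l.
Proof.
have := adeE l k; rewrite ip_phi /=; case: ifP => [_ /eqP ->|_].
  by rewrite gev_int /zev ltrz0.
move=> /or3P[/eqP ->|/eqP ->|/andP[/eqP -> mL]].
- by rewrite gev0 ltxx.
- by rewrite gev_int /zev ltrz0.
rewrite gev_int => _; split=> //.
have mi : (index (add_vec (nth [::] L k) (nth [::] L l)) L < size L)%N.
  by rewrite index_mem.
by exists (Ordinal mi); rewrite /phi /phiL /= nth_index // vev_add // size_L.
Qed.

Let simple_index (i : 'I_n) : exists a, phi a = b i.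
Proof. exact: model_simple (phiL_model gramP modelP F bg) i. Qed.

Lemma ade_free_ex : (j < n)%N ->
  exists2 S : {set 'I_(size L)}, free_family phi S & #|S| = N.
Proof.
move=> j_n; have /and5P[M0 /allP leM /allP dich /eqP cN _] := topP.
pose o := Ordinal j_n.
exists [set k : 'I_(size L) | gpos (gadd (gmul (gint 2%coqZ) (nth g0 (nth [::] L k) j)) (gopp (gint M)))].
  have M0' : 0 < zev R M by rewrite /zev ltr0z; lia.
  apply: free_of_functionals => k.
    by apply/eqP => e; have /eqP := phi_norm k; rewrite e ip0l eq_sym pnatr_eq0.
  exists (fun v => 2 / zev R M * x o v - ip v (phi k)); split.
  - by move=> u v; rewrite (frameD F) ipDl; ring.
  - by move=> c v; rewrite (frameZ F) ipZl; ring.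
  - rewrite phi_norm (vev_coord F) subr_le0 mulrAC ler_pdivrMr // ler_pM2l //.
    by have := gev_ge0 R (leM _ (memL k)); rewrite gevD gevN gev_int subr_ge0.
  - move=> l; rewrite inE => /(gev_gt0 R); rewrite gevD gevM gevN !gev_int subr_gt0 => lt lk.
    rewrite subr_gt0; apply: le_lt_trans (phi_le1 lk) _.
    by rewrite (vev_coord F) mulrAC ltr_pdivlMr // mul1r.
by rewrite -cN -(card_nth_set [::]).
Qed.

Lemma ade_free_le (S : {set 'I_(size L)}) : free_family phi S -> (#|S| <= N)%N.
Proof.
move=> fS; have abS := free_abelian phi_norm phi_neg fS.
pose h v := \sum_i x i v.
have hD u v : h (u + v) = h u + h v.
  by rewrite /h -big_split; apply: eq_bigr => i _; rewrite /= (frameD F).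
have h_gt0 k : 0 < h (phi k).
  have M' := phiL_model gramP modelP F bg.
  rewrite lt_neqAle sumr_ge0 ?andbT => [|i _]; last exact: (model_nonneg M').
  rewrite eq_sym; apply/eqP => /eqP.
  rewrite psumr_eq0 => [/allP x0|i _]; last exact: (model_nonneg M').
  have /eqP := model_neq0 M' k; apply; apply: (frame_ext F) => i.
  have := x0 i; rewrite mem_index_enum => /(_ isT)/eqP ->.
  by rewrite -(scale0r 0) (frameZ F) mul0r.
have [U [abU <- upU]] := abelian_up_closed phi_norm phi_neg phi_inj hD h_gt0 abS.
pose p v := [exists k in U, nth [::] L k == v].
have pE (k : 'I_(size L)) : p (nth [::] L k) = (k \in U).
  apply/exists_inP/idP => [[l lU /eqP e]|kU]; last by exists k.
  have : l == k by rewrite -val_eqE /= -(nth_uniq [::] _ _ uL) // e.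
  by move/eqP <-.
have pL v : v \in L -> exists2 k : 'I_(size L), nth [::] L k = v & p v = (k \in U).
  move=> vL; have iv : (index v L < size L)%N by rewrite index_mem.
  by exists (Ordinal iv); [exact: nth_index|rewrite -pE /= nth_index].
have -> : #|U| = count p L.
  by rewrite -(card_nth_set [::]); apply: eq_card => k; rewrite inE pE.
have /and5P[_ _ _ _ srch] := topP; rewrite -ltnS.
apply: (ideal_search_count (L := L)) srch => // v w /pL[k kv ->] /pL[l lw ->].
  move=> /hasP[i]; rewrite mem_iota size_Ct /= => i_n /eqP e kU.
  have [a aE] := simple_index (Ordinal i_n); apply: (upU a k l kU).
  rewrite aE; apply: (frame_ext F) => m.
  rewrite (frameD F) !(vev_coord F) (frame_delta F) lw -e -kv nth_set_nth /= -val_eqE /=.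
  by case: eqP => [->|_]; rewrite ?addr0 // gevD gev_int.
move=> kU lU; rewrite -lw -kv; apply/eqP => e.
have := abelianP _ _ _ abU l k lU kU; rewrite ip_phi e gev_int /zev ler0z; lia.
Qed.

End ADE.

(* Decreasing in height, as [ideal_search] expects; [h] bounds the heights. *)
Definition simply_laced_roots (Ct : seq (seq gold)) (h : nat) : seq (seq gold) :=
  let n := size Ct in
  let next layer := undup (flatten [seq [seq incr_vec v i | i <- iota 0 n
    & vdot v (nth [::] Ct i) == neg_one] | v <- layer]) in
  (iter h (fun p => (next p.1, p.1 ++ p.2)) (map (unit_vec n) (iota 0 n), [::])).2.

Definition cartan_E6 : seq (seq gold) := map (map gint) ([::
  [:: 2; -1; 0; 0; 0; 0]; [:: -1; 2; -1; 0; 0; 0]; [:: 0; -1; 2; -1; 0; -1];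
  [:: 0; 0; -1; 2; -1; 0]; [:: 0; 0; 0; -1; 2; 0]; [:: 0; 0; -1; 0; 0; 2]])%coqZ.

(** The bounds 11, 17 and 29 used for the three types are the heights of the highest roots, one less
    than the Coxeter numbers. The generated lists are certified by [model_check]. *)
Definition roots_E6 : seq (seq gold) := Eval lazy in simply_laced_roots cartan_E6 11.

Definition cartan_E7 : seq (seq gold) := map (map gint) ([::
  [:: 2; -1; 0; 0; 0; 0; 0]; [:: -1; 2; -1; 0; 0; 0; 0]; [:: 0; -1; 2; -1; 0; 0; -1];
  [:: 0; 0; -1; 2; -1; 0; 0]; [:: 0; 0; 0; -1; 2; -1; 0]; [:: 0; 0; 0; 0; -1; 2; 0];
  [:: 0; 0; -1; 0; 0; 0; 2]])%coqZ.

Definition roots_E7 : seq (seq gold) := Eval lazy in simply_laced_roots cartan_E7 17.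

Definition cartan_E8 : seq (seq gold) := map (map gint) ([::
  [:: 2; -1; 0; 0; 0; 0; 0; 0]; [:: -1; 2; -1; 0; 0; 0; 0; 0];
  [:: 0; -1; 2; -1; 0; 0; 0; -1]; [:: 0; 0; -1; 2; -1; 0; 0; 0];
  [:: 0; 0; 0; -1; 2; -1; 0; 0]; [:: 0; 0; 0; 0; -1; 2; -1; 0];
  [:: 0; 0; 0; 0; 0; -1; 2; 0]; [:: 0; 0; -1; 0; 0; 0; 0; 2]])%coqZ.

Definition roots_E8 : seq (seq gold) := Eval lazy in simply_laced_roots cartan_E8 29.

Lemma type_E_entry (R : realType) (V : vectType R) (ip : {dot V for idfun})
    (Phi P : set V) (T : root_type) (Delta : (rank_of T).-tuple V)
    (Ct L : seq (seq gold)) (j : nat) (M : Z) :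
  root_system ip Phi -> positive_system Phi P -> simple_system Phi Delta ->
  coxeter_orders ip (fun i j : 'I_(rank_of T) => coxeter_matrix T i j) Delta ->
  gram_check T Ct Ct -> model_check (rank_of T) Ct L -> ade_check Ct L ->
  top_check Ct L (table_value T) j M -> (j < rank_of T)%N ->
  max_really_abelian_size P (table_value T) /\
  helly_number P (cone P) (table_value T).
Proof.
move=> PhiR PP D Dm gramP modelP adeP topP jn.
apply: (table_model_entry PhiR PP D Dm gramP modelP) => b x F bg.
split; first exact: (ade_free_ex gramP modelP adeP topP F bg jn).
by move=> S; apply: (ade_free_le gramP modelP adeP topP F bg).
Qed.

(** Nodes 0 here and 5 for [E7] have coefficient 1 in the highest root; the roots involving them
    number [36 - 20 = 16] and [63 - 36 = 27], the rest forming [D5] and [E6]. *)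
Lemma checks_E6 : [&& gram_check type_E6 cartan_E6 cartan_E6,
  model_check (rank_of type_E6) cartan_E6 roots_E6, ade_check cartan_E6 roots_E6
  & top_check cartan_E6 roots_E6 (table_value type_E6) 0 1%coqZ].
Proof. by lazy. Qed.

Lemma checks_E7 : [&& gram_check type_E7 cartan_E7 cartan_E7,
  model_check (rank_of type_E7) cartan_E7 roots_E7, ade_check cartan_E7 roots_E7
  & top_check cartan_E7 roots_E7 (table_value type_E7) 5 1%coqZ].
Proof. by lazy. Qed.

(** No coefficient of the highest root is 1. Node 7, the short arm, has coefficient 3; its grading
    has 28 roots in degree 2 and 8 in degree 3, together 36. *)
Lemma checks_E8 : [&& gram_check type_E8 cartan_E8 cartan_E8,
  model_check (rank_of type_E8) cartan_E8 roots_E8, ade_check cartan_E8 roots_E8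
  & top_check cartan_E8 roots_E8 (table_value type_E8) 7 3%coqZ].
Proof. by lazy. Qed.

(** * Types F4 and H3 *)

Inductive search_tree := Leaf | Branch of N & search_tree & search_tree.

(* Prefix notation, with [0] for a leaf and [k + 1] for a branch at [k]. *)
Definition decode_tree (code : seq N) : search_tree :=
  head Leaf (foldr (fun c st =>
    if c == 0%num then Leaf :: st
    else if st is t1 :: t2 :: st' then Branch (N.pred c) t1 t2 :: st' else [::]) [::] code).

(* Whether the tree refutes every [need]-element subset of [C] containing no
   member of [E]; at a branch the first subtree takes the vertex, which forces out
   the vertices [D], and the second leaves it out. *)
Fixpoint refutes (t : search_tree) (need : nat) (C : seq N) (E : seq (seq N)) : bool :=
  match t with
  | Leaf => (size C < need)%N
  | Branch k t1 t2 =>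
      let C' := [seq i <- C | i != k] in
      let E1 := [seq [seq i <- e | i != k] | e <- E] in
      let D := flatten [seq e <- E1 | (size e == 1)%N] in
      (has (@nilp _) E1 || refutes t1 need.-1 [seq i <- C' | i \notin D]
         [seq e <- E1 | ~~ has (fun i => i \in D) e])
      && refutes t2 need C' [seq e <- E | k \notin e]
  end.

Lemma refutes_count t need C E (s : pred N) : uniq C ->
  (forall e, e \in E -> ~~ all s e) -> refutes t need C E -> (count s C < need)%N.
Proof.
elim: t need C E => [|k t1 IH1 t2 IH2] need C E uC sE /=.
  exact: leq_ltn_trans (count_size s C).
set C' := [seq i <- C | i != k]; set E1 := map _ E; set D := flatten _.
have uC' : uniq C' by rewrite filter_uniq.
have cC : (count s C <= s k + count s C')%N.
  have -> : count s C = (count (predI s (pred1 k)) C + count s C')%N.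
    rewrite /C'; elim: (C) => //= i C0 ->; case: eqVneq => _ /=; last by rewrite andbF addnCA.
    by rewrite andbT addnA.
  rewrite leq_add2r; case: (boolP (s k)) => sk.
    apply: leq_trans (_ : count (pred1 k) C <= _)%N; last by rewrite count_uniq_mem // leq_b1.
    by apply: sub_count => i /andP[].
  rewrite leqn0 -leqn0 leqNgt -has_count; apply/hasPn => i _ /=.
  by case: eqVneq => [->|_]; rewrite ?andbF ?andbT.
move=> /andP[inc exc].
have [sk|nsk] := boolP (s k); last first.
  have {}cC : (count s C <= count s C')%N by move: cC; rewrite (negbTE nsk).
  apply: leq_ltn_trans cC _; apply: IH2 exc => // e.
  by rewrite mem_filter => /andP[_ /sE].
have sE1 e : e \in E1 -> ~~ all s e.
  move=> /mapP[e' e'E ->]; apply: contra (sE _ e'E) => /allP ae.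
  apply/allP => i ie; have [->//|ik] := eqVneq i k.
  by apply: ae; rewrite mem_filter ik.
have sD i : i \in D -> ~~ s i.
  move=> /flattenP[e]; rewrite mem_filter => /andP[/eqP e1 /sE1 ne] ie.
  by case: e e1 ne ie => [|j [|]] //= _; rewrite andbT inE => sj /eqP ->.
case/orP: inc => [/hasP[e /sE1]|inc].
  by case: e.
have : (count s [seq i <- C' | i \notin D] < need.-1)%N.
  apply: IH1 inc; first by rewrite filter_uniq.
  by move=> e; rewrite mem_filter => /andP[_ /sE1].
rewrite count_filter (_ : count _ C' = count s C'); first by move: cC; rewrite sk; lia.
apply: eq_count => i /=; have [si|//] := boolP (s i).
by apply/negP => /sD; rewrite si.
Qed.

(* [(comb, (d, c))] certifies that [c] times the vector of index [d] is the positive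
   combination [comb]. *)
Definition cone_cert : Type := seq (nat * gold) * (nat * gold).

Definition cert_check (n : nat) (J : seq (seq gold)) (c : cone_cert) : bool :=
  let d := c.2.1 in
  [&& (d < size J)%N, gpos c.2.2,
      all (fun p => [&& (p.1 < size J)%N, p.1 != d & gnonneg p.2]) c.1
    & foldr (fun p => add_vec (scale_vec p.2 (nth [::] J p.1))) (nseq n g0) c.1
      == scale_vec c.2.2 (nth [::] J d)].

(* Patterns [(u, (c, d))] for the relations [u w = c v + d v'] that put a vector [w]
   between [v] and [v']. *)
Definition pattern : Type := gold * (gold * gold).

Definition pattern_tables (J : seq (seq gold)) (pats : seq pattern) :=
  [seq ([seq scale_vec p.1 v | v <- J], p) | p <- pats].

Definition pair_conflict (J : seq (seq gold))
    (tabs : seq (seq (seq gold) * pattern)) (i j : nat) : bool :=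
  has (fun t => let w := add_vec (scale_vec t.2.2.1 (nth [::] J i))
                                 (scale_vec t.2.2.2 (nth [::] J j)) in
         let k := index w t.1 in
         [&& (k < size t.1)%N, k != i & k != j]) tabs.

Definition patterns_ok (pats : seq pattern) : bool :=
  all (fun p => [&& gpos p.1, gnonneg p.2.1 & gnonneg p.2.2]) pats.

Section Certificates.
Variables (R : realType) (V : vectType R) (T : root_type) (b : 'I_(rank_of T) -> V).
Let n := rank_of T.
Variables (J : seq (seq gold)).
Hypothesis sizeJ : forall v, v \in J -> size v = n.

Let psi (k : 'I_(size J)) : V := vev b (nth [::] J k).

Variable S : {set 'I_(size J)}.
Hypothesis fS : free_family psi S.

Definition member (k : nat) : bool := [exists o in S, val o == k].

Lemma memberE (k : 'I_(size J)) : member k = (k \in S).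
Proof.
apply/exists_inP/idP => [[o oS /eqP/val_inj <- //]|kS].
by exists k.
Qed.

Let size_nth k : (k < size J)%N -> size (nth [::] J k) = n.
Proof. by move=> kJ; apply: sizeJ; exact: mem_nth. Qed.

Let size_scale c k : (k < size J)%N -> size (scale_vec c (nth [::] J k)) = n.
Proof. by move=> kJ; rewrite size_map size_nth. Qed.

Lemma cert_sound c : cert_check n J c -> ~~ all member [seq p.1 | p <- c.1].
Proof.
case: c => comb [d c0] /and4P[/= dJ c0P /allP combP /eqP e]; apply/negP => /allP mem.
pose o := Ordinal dJ; apply: (fS (k := o)).
have c00 := gev_gt0 R c0P.
have -> : psi o = (gev R c0)^-1 *: (gev R c0 *: psi o) by rewrite scalerK ?gt_eqF.
apply: conicZ; first by rewrite invr_ge0 ltW.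
rewrite /psi -vev_scale ?size_nth // -e {e}.
have {mem combP} H p : p \in comb -> [&& (p.1 < size J)%N, p.1 != d, gnonneg p.2 & member p.1].
  by move=> pc; have /and3P[-> -> ->] := combP _ pc; rewrite mem // map_f.
suff [] : conic psi (S :\ o) (vev b (foldr (fun p => add_vec (scale_vec p.2 (nth [::] J p.1)))
    (nseq n g0) comb)) /\ size (foldr (fun p => add_vec (scale_vec p.2 (nth [::] J p.1)))
    (nseq n g0) comb) = n by [].
elim: comb H => [|p comb IH] H /=; first by rewrite vev0 size_nseq; split=> //; exact: conic0.
have [|IH1 IH2] := IH; first by move=> q qc; apply: H; rewrite inE qc orbT.
have /and4P[pJ pd p0 pm] := H p (mem_head _ _).
split; last by rewrite size_map size_zip size_scale // IH2 minnn.
rewrite vev_add ?size_scale // vev_scale ?size_nth //; apply: conicD => //.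
apply: conicZ; first exact: gev_ge0.
apply: (@conic_gen _ _ _ psi _ (Ordinal pJ)).
by rewrite !inE -val_eqE /= pd -memberE.
Qed.

Lemma pair_conflict_sound pats i j : patterns_ok pats ->
  (i < size J)%N -> (j < size J)%N ->
  pair_conflict J (pattern_tables J pats) i j -> ~~ (member i && member j).
Proof.
move=> /allP okp iJ jJ /hasP[_ /mapP[p /okp/and3P[u0 c0 d0] ->] /=].
rewrite size_map => /and3P[kJ ki kj]; apply/negP => /andP[mi mj].
set w := add_vec _ _ in kJ ki kj; set k := index _ _ in kJ ki kj.
pose o := Ordinal kJ; apply: (fS (k := o)).
have w0 := gev_gt0 R u0.
have -> : psi o = (gev R p.1)^-1 *: (gev R p.1 *: psi o) by rewrite scalerK ?gt_eqF.
apply: conicZ; first by rewrite invr_ge0 ltW.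
rewrite /psi -vev_scale ?size_nth //=.
have -> : scale_vec p.1 (nth [::] J k) = w.
  rewrite -(nth_map [::] [::] (scale_vec p.1)) // nth_index //.
  by rewrite -index_mem size_map.
rewrite vev_add ?size_scale // !vev_scale ?size_nth //.
apply: conicD; apply: conicZ; try exact: gev_ge0.
  by apply: (@conic_gen _ _ _ psi _ (Ordinal iJ)); rewrite !inE -val_eqE /= eq_sym ki -memberE.
by apply: (@conic_gen _ _ _ psi _ (Ordinal jJ)); rewrite !inE -val_eqE /= eq_sym kj -memberE.
Qed.

Lemma card_member : #|S| = count member (iota 0 (size J)).
Proof.
rewrite -(@val_enum_ord (size J)) count_map enumT -size_filter.
by rewrite cardE /enum_mem; congr size; apply: eq_filter => k; rewrite /= memberE.
Qed.

End Certificates.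

Lemma card_ord_count m (p : pred nat) : #|[set k : 'I_m | p k]| = count p (iota 0 m).
Proof.
rewrite -(@val_enum_ord m) count_map enumT -size_filter.
by rewrite cardE /enum_mem; congr size; apply: eq_filter => k; rewrite /= inE.
Qed.

(** Strict at [k] and weak on the other members, so that a form may vanish on several members and
    serve for many [k]. *)
Definition separation_check (n N : nat) (L fs : seq (seq gold)) (s : seq nat) : bool :=
  (count (fun k => k \in s) (iota 0 (size L)) == N) &&
  all (fun k => has (fun f =>
    [&& size f == n, gpos (gopp (vdot f (nth [::] L k)))
      & all (fun l => (l == k) || gnonneg (vdot f (nth [::] L l))) s]) fs) (iota 0 (size L)).

Definition pair_edges (C : seq nat) (bad : nat -> nat -> bool) : seq (seq N) :=
  flatten [seq [seq [:: N.of_nat i; N.of_nat j] | j <- C & (i < j)%N && bad i j] | i <- C].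

Definition packing_check (J : seq (seq gold)) (pats : seq pattern) (t : search_tree)
    (N : nat) : bool :=
  let tabs := pattern_tables J pats in let C := iota 0 (size J) in
  patterns_ok pats &&
  refutes t N.+1 (map N.of_nat C) (pair_edges C (pair_conflict J tabs)).

Lemma pair_edgesP (C : seq nat) (bad : nat -> nat -> bool) (s : pred nat) e :
  (forall i j, i \in C -> j \in C -> (i < j)%N -> bad i j -> ~~ (s i && s j)) ->
  e \in pair_edges C bad -> ~~ all (fun i => s (N.to_nat i)) e.
Proof.
move=> bs /flatten_mapP[i iC /mapP[j]]; rewrite mem_filter => /andP[/andP[ij bij] jC] ->.
by rewrite /= !Nat2N.id andbT; exact: bs.
Qed.

Lemma uniq_map_N (C : seq nat) : uniq C -> uniq (map N.of_nat C).
Proof. by move=> uC; rewrite map_inj_uniq //; exact: Nat2N.inj. Qed.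

Lemma count_map_N (C : seq nat) (s : pred nat) :
  count (fun i => s (N.to_nat i)) (map N.of_nat C) = count s C.
Proof. by rewrite count_map; apply: eq_count => i /=; rewrite Nat2N.id. Qed.

Section TableBounds.
Variables (R : realType) (V : vectType R) (ip : {dot V for idfun}).
Variables (T : root_type) (Ct G L : seq (seq gold)).
Let n := rank_of T.
Hypothesis gramP : gram_check T Ct G.
Hypothesis modelP : model_check n Ct L.
Variables (b : 'I_n -> V) (x : 'I_n -> V -> R).
Hypothesis F : frame b x.
Hypothesis bg : forall i j, ip (b i) (b j) = gram_entry R G i j.

Lemma model_size v : v \in L -> size v = n.
Proof. by have /and5P[_ _ _ /allP aL _] := modelP => /aL/and3P[/eqP]. Qed.

Lemma separation_free N fs s : separation_check n N L fs s ->
  exists2 S : {set 'I_(size L)}, free_family (phiL (L := L) b) S & #|S| = N.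
Proof.
move=> /andP[/eqP cN /allP sep]; exists [set k : 'I_(size L) | (k : nat) \in s]; last first.
  by rewrite (card_ord_count _ (fun k => k \in s)).
move=> k [c c0 kE].
have kL : (k : nat) \in iota 0 (size L) by rewrite mem_iota ltn_ord.
have /hasP[w _ /and3P[/eqP sw /(gev_gt0 R) wk /allP wl]] := sep _ kL.
pose f v := \sum_(i < n) gev R (nth g0 w i) * x i v.
have fE (l : 'I_(size L)) : f (phiL b l) = gev R (vdot w (nth [::] L l)).
  rewrite (gev_vdot R sw (model_size (mem_nth _ (ltn_ord l)))).
  by apply: eq_bigr => i _; rewrite (vev_coord F).
have fD u v : f (u + v) = f u + f v.
  by rewrite /f -big_split; apply: eq_bigr => i _; rewrite /= (frameD F) mulrDr.
have fZ a v : f (a *: v) = a * f v.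
  by rewrite /f mulr_sumr; apply: eq_bigr => i _; rewrite (frameZ F) mulrCA.
have f0 : f 0 = 0 by rewrite -(scale0r 0) fZ mul0r.
move: wk; rewrite gevN -fE oppr_gt0 kE (big_morph f fD f0) ltNge sumr_ge0 // => l.
rewrite !inE => /andP[lk ls]; rewrite fZ mulr_ge0 // ?c0 // fE; apply: gev_ge0.
by have := wl _ ls; rewrite -[(_ == _ :> nat)]/(l == k) (negbTE lk).
Qed.

Lemma packing_le pats t N (S : {set 'I_(size L)}) : packing_check L pats t N ->
  free_family (phiL (L := L) b) S -> (#|S| <= N)%N.
Proof.
move=> /andP[okp ref] fS; rewrite -ltnS (card_member S) -count_map_N.
apply: (refutes_count (uniq_map_N (iota_uniq _ _)) _ ref) => e.
apply: pair_edgesP => i j; rewrite !mem_iota /= => iL jL _.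
exact: (pair_conflict_sound model_size fS okp iL jL).
Qed.

End TableBounds.

Lemma packing_entry (R : realType) (V : vectType R) (ip : {dot V for idfun})
    (Phi P : set V) (T : root_type) (Delta : (rank_of T).-tuple V)
    (Ct G L fs : seq (seq gold)) s pats t :
  root_system ip Phi -> positive_system Phi P -> simple_system Phi Delta ->
  coxeter_orders ip (fun i j : 'I_(rank_of T) => coxeter_matrix T i j) Delta ->
  gram_check T Ct G -> model_check (rank_of T) Ct L ->
  separation_check (rank_of T) (table_value T) L fs s ->
  packing_check L pats t (table_value T) ->
  max_really_abelian_size P (table_value T) /\
  helly_number P (cone P) (table_value T).
Proof.
move=> PhiR PP D Dm gramP modelP sepP packP.
apply: (table_model_entry PhiR PP D Dm gramP modelP) => b x F bg.
split; first exact: (separation_free modelP F sepP).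
by move=> S; exact: (packing_le modelP packP).
Qed.

Definition cartan_F4 : seq (seq gold) := map (map gint) ([::
  [:: 2; -1; 0; 0]; [:: -1; 2; -1; 0]; [:: 0; -2; 2; -1]; [:: 0; 0; -1; 2]])%coqZ.

(** Norms 4 and 2 keep the entries integral; with norms 2 and 1 the last product would be -1/2. *)
Definition gram_F4 : seq (seq gold) := map (map gint) ([::
  [:: 4; -2; 0; 0]; [:: -2; 4; -2; 0]; [:: 0; -2; 2; -1]; [:: 0; 0; -1; 2]])%coqZ.

Definition roots_F4 : seq (seq gold) := map (map gint) ([::
  [:: 2; 3; 4; 2]; [:: 1; 3; 4; 2]; [:: 1; 2; 4; 2]; [:: 1; 2; 3; 2]; [:: 1; 2; 2; 2];
  [:: 1; 2; 3; 1]; [:: 1; 1; 2; 2]; [:: 1; 2; 2; 1]; [:: 0; 1; 2; 2]; [:: 1; 1; 2; 1];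
  [:: 1; 2; 2; 0]; [:: 0; 1; 2; 1]; [:: 1; 1; 1; 1]; [:: 1; 1; 2; 0]; [:: 0; 1; 1; 1];
  [:: 0; 1; 2; 0]; [:: 1; 1; 1; 0]; [:: 0; 0; 1; 1]; [:: 0; 1; 1; 0]; [:: 1; 1; 0; 0];
  [:: 0; 0; 0; 1]; [:: 0; 0; 1; 0]; [:: 0; 1; 0; 0]; [:: 1; 0; 0; 0]])%coqZ.

Definition facets_F4 : seq (seq gold) := map (map gint) ([::
  [:: -2; 2; -1; 0]; [:: -1; 1; 0; -1]; [:: 0; -1; 1; 0]; [:: -1; 0; 0; 1]; [:: 2; 0; 0; -1];
  [:: 1; 1; -1; 0]; [:: 0; 2; -1; -1]; [:: -2; 0; 1; -1]; [:: -1; 2; -1; -1]; [:: 2; -2; 1; 1]])%coqZ.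

(** A wrong tree could only make [refutes] fail, never establish a false bound. *)
Definition search_F4 : search_tree := decode_tree ([::
  21; 23; 2; 13; 0; 0; 13; 0; 0; 20; 15; 0; 5; 0; 0; 24; 13; 0; 0; 13; 1; 2; 3; 0; 0; 3; 0; 0;
  2; 3; 0; 0; 3; 0; 0; 1; 2; 3; 15; 0; 0; 15; 0; 0; 3; 15; 0; 0; 15; 0; 0; 2; 3; 15; 0; 0; 15;
  0; 0; 3; 15; 0; 0; 15; 0; 0; 23; 12; 4; 5; 6; 0; 0; 6; 0; 0; 5; 6; 0; 0; 6; 0; 0; 13; 2; 4;
  5; 0; 0; 5; 0; 0; 4; 5; 0; 0; 5; 0; 0; 17; 2; 5; 0; 0; 5; 0; 0; 2; 4; 5; 6; 0; 0; 6; 0; 0;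
  5; 6; 0; 0; 6; 0; 0; 4; 5; 6; 0; 0; 6; 0; 0; 5; 6; 0; 0; 6; 0; 0; 20; 15; 4; 5; 0; 0; 5; 0;
  0; 19; 5; 0; 0; 5; 4; 6; 8; 0; 0; 8; 0; 0; 6; 8; 0; 0; 8; 0; 0; 4; 6; 8; 11; 0; 0; 11; 0; 0;
  8; 11; 0; 0; 11; 0; 0; 6; 8; 11; 0; 0; 11; 0; 0; 8; 11; 0; 0; 11; 0; 0; 24; 18; 4; 7; 0; 0;
  7; 0; 0; 22; 7; 0; 0; 4; 6; 7; 8; 0; 0; 8; 0; 0; 7; 8; 0; 0; 8; 0; 0; 6; 7; 8; 0; 0; 8; 0;
  0; 7; 8; 0; 0; 8; 0; 0; 13; 9; 2; 3; 8; 0; 0; 8; 0; 0; 3; 8; 0; 0; 8; 0; 0; 5; 2; 4; 8; 0;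
  0; 8; 0; 0; 4; 8; 0; 0; 8; 0; 0; 7; 4; 8; 0; 0; 8; 0; 0; 2; 3; 4; 8; 0; 0; 8; 0; 0; 4; 8; 0;
  0; 8; 0; 0; 3; 4; 8; 0; 0; 8; 0; 0; 4; 8; 0; 0; 8; 0; 0; 17; 5; 2; 8; 0; 0; 8; 0; 0; 7; 8;
  0; 0; 1; 2; 3; 8; 0; 0; 8; 0; 0; 3; 8; 0; 0; 8; 0; 0; 2; 3; 8; 0; 0; 8; 0; 0; 3; 8; 0; 0; 8;
  0; 0; 5; 10; 1; 2; 6; 0; 0; 6; 0; 0; 2; 6; 0; 0; 6; 0; 0; 18; 1; 2; 0; 0; 2; 0; 0; 7; 1; 6;
  8; 0; 0; 8; 0; 0; 6; 8; 0; 0; 8; 0; 0; 1; 4; 6; 8; 0; 0; 8; 0; 0; 6; 8; 0; 0; 8; 0; 0; 4; 6;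
  8; 0; 0; 8; 0; 0; 6; 8; 0; 0; 8; 0; 0; 7; 8; 1; 6; 0; 0; 6; 0; 0; 15; 1; 0; 0; 1; 4; 6; 10;
  0; 0; 10; 0; 0; 6; 10; 0; 0; 10; 0; 0; 4; 6; 10; 0; 0; 10; 0; 0; 6; 10; 0; 0; 10; 0; 0; 15;
  9; 4; 8; 0; 0; 8; 0; 0; 1; 3; 4; 8; 0; 0; 8; 0; 0; 4; 8; 0; 0; 8; 0; 0; 3; 4; 8; 0; 0; 8; 0;
  0; 4; 8; 0; 0; 8; 0; 0; 8; 9; 4; 0; 0; 1; 2; 3; 4; 0; 0; 4; 0; 0; 3; 4; 0; 0; 4; 0; 0; 2; 3;
  4; 0; 0; 4; 0; 0; 3; 4; 0; 0; 4; 0; 0; 9; 19; 0; 4; 6; 10; 0; 0; 10; 0; 0; 6; 10; 0; 0; 10;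
  0; 0; 19; 1; 2; 3; 0; 0; 3; 0; 0; 2; 3; 0; 0; 3; 0; 0; 11; 1; 2; 4; 10; 0; 0; 10; 0; 0; 4;
  10; 0; 0; 10; 0; 0; 2; 4; 10; 0; 0; 10; 0; 0; 4; 10; 0; 0; 10; 0; 0; 1; 2; 4; 6; 10; 0; 0;
  10; 0; 0; 6; 10; 0; 0; 10; 0; 0; 4; 6; 10; 0; 0; 10; 0; 0; 6; 10; 0; 0; 10; 0; 0; 2; 4; 6;
  10; 0; 0; 10; 0; 0; 6; 10; 0; 0; 10; 0; 0; 4; 6; 10; 0; 0; 10; 0; 0; 6; 10; 0; 0; 10; 0; 0])%num.

(** The entry [(0, -1)] is [- phi = - 2 cos (pi / 5)]. All norms are 2, so the matrix is its own
    Gram matrix. *)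
Definition cartan_H3 : seq (seq gold) := ([::
  [:: (2, 0); (-1, 0); (0, 0)]; [:: (-1, 0); (2, 0); (0, -1)]; [:: (0, 0); (0, -1); (2, 0)]])%coqZ.

Definition roots_H3 : seq (seq gold) := ([::
  [:: (0, 1); (0, 2); (1, 1)]; [:: (0, 1); (1, 1); (1, 1)]; [:: (1, 0); (1, 1); (1, 1)];
  [:: (0, 1); (1, 1); (0, 1)]; [:: (1, 0); (1, 1); (0, 1)]; [:: (0, 1); (0, 1); (0, 1)];
  [:: (0, 1); (0, 1); (1, 0)]; [:: (1, 0); (1, 0); (0, 1)]; [:: (0, 0); (0, 1); (0, 1)];
  [:: (0, 0); (0, 1); (1, 0)]; [:: (0, 0); (1, 0); (0, 1)]; [:: (1, 0); (1, 0); (0, 0)];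
  [:: (0, 0); (0, 0); (1, 0)]; [:: (0, 0); (1, 0); (0, 0)]; [:: (1, 0); (0, 0); (0, 0)]])%coqZ.

Definition facets_H3 : seq (seq gold) := ([::
  [:: (0, 0); (0, -1); (0, 1)]; [:: (0, -1); (0, 0); (1, 0)]; [:: (0, 0); (0, 1); (-1, 0)];
  [:: (0, 1); (0, -1); (1, 0)]; [:: (0, -1); (-1, 0); (0, 1)]; [:: (-1, -1); (0, 1); (0, 0)];
  [:: (1, 1); (-1, 0); (0, 0)]; [:: (0, 1); (-1, -1); (0, 1)]])%coqZ.

Definition search_H3 : search_tree := decode_tree ([::
  13; 15; 0; 1; 0; 0; 15; 8; 0; 0; 8; 3; 0; 9; 0; 0; 11; 2; 0; 0; 6; 5; 0; 0; 9; 4; 0; 0; 1;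
  4; 0; 5; 0; 0; 2; 3; 0; 0; 3; 0; 7; 0; 0])%num.

(** Relations inside the rank-two subsystems [A2] and [B2]. *)
Definition patterns_F4 : seq pattern := ([::
  (gint 1, (gint 1, gint 1)); (gint 2, (gint 1, gint 1));
  (gint 1, (gint 2, gint 1)); (gint 1, (gint 1, gint 2))])%coqZ.

(** The first relation is that of [A2]. The others belong to [I2(5)], for two roots at 72, 144 and,
    in both orders, 108 degrees. *)
Definition patterns_H : seq pattern := ([::
  ((1, 0), ((1, 0), (1, 0))); ((0, 1), ((1, 0), (1, 0))); ((1, 0), ((0, 1), (0, 1)));
  ((0, 1), ((0, 1), (1, 0))); ((0, 1), ((1, 0), (0, 1)))])%coqZ.

Lemma checks_F4 :
  [&& gram_check type_F4 cartan_F4 gram_F4, model_check (rank_of type_F4) cartan_F4 roots_F4,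
      separation_check (rank_of type_F4) (table_value type_F4) roots_F4 facets_F4
        [:: 1; 7; 10; 14; 15; 18]
    & packing_check roots_F4 patterns_F4 search_F4 (table_value type_F4)].
Proof. by lazy. Qed.

Lemma checks_H3 :
  [&& gram_check type_H3 cartan_H3 cartan_H3, model_check (rank_of type_H3) cartan_H3 roots_H3,
      separation_check (rank_of type_H3) (table_value type_H3) roots_H3 facets_H3
        [:: 1; 2; 7; 10; 12]
    & packing_check roots_H3 patterns_H search_H3 (table_value type_H3)].
Proof. by lazy. Qed.

(** * Type H4 *)

(* The order matters for [first_check] and [second_check]: with [L] decreasing in height,
   raising a root lowers its index. *)
Definition with_opposites (L : seq (seq gold)) : seq (seq gold) :=
  L ++ rev (map (map gopp) L).

Section RootTable.
Variables (n : nat) (Ct J : seq (seq gold)).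

Definition form (k l : nat) : gold := vdot (nth [::] J l) (dual_vec Ct (nth [::] J k)).

Definition act (i k : nat) : nat := index (refl_vec Ct i (nth [::] J k)) J.

Definition act_check : bool :=
  uniq J && all (fun k => (form k k == gint 2%coqZ)
    && all (fun i => (act i k < size J)%N) (iota 0 n)) (iota 0 (size J)).

(** Every root but the highest is raised by some simple reflection, so any root can be brought to
    index 0. *)
Definition first_check : bool :=
  all (fun k => (k == 0)%N || has (fun i => (act i k < k)%N) (iota 0 n)) (iota 0 (size J)).

(** Among the roots with product [c] with the highest one, only [t] is raised by no simple
    reflection fixing the latter; hence the stabiliser acts transitively on them. *)
Definition second_check (c : gold) (t : nat) : bool :=
  let fixing := [seq i <- iota 0 n | act i 0 == 0%N] in
  all (fun l => [|| form 0 l != c, l == t | has (fun i => (act i l < l)%N) fixing])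
    (iota 0 (size J)).

(* Certificates sharing the coefficients [cs] and the factor [c]; a chunk of [ks] lists
   the index of the combined vector and then those of the summands. *)
Definition expand_certs (p : seq gold * gold * seq nat) : seq cone_cert :=
  let: (cs, c, ks) := p in
  [seq (zip (behead t) cs, (head 0%N t, c))
    | t <- reshape (nseq (size ks %/ (size cs).+1) (size cs).+1) ks].

(* No compatible set larger than [N] contains the vectors of indices [0] and [t]. *)
Definition pair_check (A : seq gold) (t : nat) (certs : seq cone_cert) (tree : search_tree)
    (N : nat) : bool :=
  let bad i j := form i j \notin A in
  let C := [seq i <- iota 0 (size J) | [&& i != 0%N, i != t, ~~ bad 0%N i & ~~ bad t i]] in
  all (cert_check n J) certs &&
  refutes tree N.-1 (map N.of_nat C) (pair_edges C bad ++
    [seq [seq N.of_nat p.1 | p <- c.1 & (p.1 != 0%N) && (p.1 != t)] | c <- certs]).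

(** Either some pair has the head value and is moved to indices 0 and [t], or that value is dropped
    from [A]; later cases thus search under a stronger condition. *)
Fixpoint cases_check (A : seq gold) (cases : seq (nat * (seq cone_cert * search_tree)))
    (N : nat) : bool :=
  match A, cases with
  | [::], _ => true
  | c :: A', (t, (certs, tree)) :: cases' =>
      [&& second_check c t, pair_check A t certs tree N & cases_check A' cases' N]
  | _, _ => false
  end.

(* A product in [A0] but not in [A] forces a third vector between the two. *)
Definition form_check (L : seq (seq gold)) (pats : seq pattern) (A0 A : seq gold) : bool :=
  let tabs := pattern_tables J pats in
  [&& patterns_ok pats,
      all (fun k => all (fun l => (k == l) || (form k l \in A0)) (iota 0 (size L)))
        (iota 0 (size L))
    & all (fun l => [|| l == 0%N, form 0 l \in A, form 0 l \notin A0
        | pair_conflict J tabs 0 l]) (iota 0 (size J))].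

End RootTable.

Lemma count_remove2 (s : seq nat) (p q : pred nat) (a c : nat) : uniq s ->
  (forall i, p i -> [|| i == a, i == c | q i]) ->
  (count p s <= (count p [seq i <- s | q i]).+2)%N.
Proof.
move=> us pq; rewrite count_filter.
apply: leq_trans (_ : count (predU (pred1 a) (predU (pred1 c) (predI p q))) s <= _)%N.
  by apply: sub_count => i pi; have := pq i pi; rewrite /= pi.
rewrite -(leq_add2r (count (predI (pred1 a) (predU (pred1 c) (predI p q))) s)) count_predUI.
rewrite count_uniq_mem //.
have := count_predUI (pred1 c) (predI p q) s; rewrite (count_uniq_mem c) //.
rewrite [count (predI p [eta q]) s](_ : _ = count (predI p q) s) //.
by case: (a \in s); case: (c \in s) => /=; lia.
Qed.

Section WeylMoves.
Variables (R : realType) (V : vectType R) (ip : {dot V for idfun}).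
Variables (T : root_type) (Ct L : seq (seq gold)).
Let n := rank_of T.
Hypothesis gramP : gram_check T Ct Ct.
Hypothesis modelP : model_check n Ct L.
Variables (b : 'I_n -> V) (x : 'I_n -> V -> R).
Hypothesis F : frame b x.
Hypothesis bg : forall i j, ip (b i) (b j) = gram_entry R Ct i j.

Let J := with_opposites L.
Let psi : 'I_(size J) -> V := phiL (L := J) b.

Hypothesis actP : act_check n Ct J.

Let size_J v : v \in J -> size v = n.
Proof.
rewrite mem_cat mem_rev => /orP[|/mapP[w wL ->]]; first exact: model_size modelP v.
by rewrite size_map; exact: (model_size modelP wL).
Qed.

Let memJ (k : 'I_(size J)) : nth [::] J k \in J.
Proof. exact: mem_nth. Qed.

Let act_lt i k : (i < n)%N -> (k < size J)%N -> (act Ct J i k < size J)%N.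
Proof.
move=> i_n kJ; have /andP[_ /allP/(_ k)] := actP; rewrite mem_iota kJ => /(_ isT)/andP[_].
by move=> /allP/(_ i); rewrite mem_iota i_n => /(_ isT).
Qed.

Let move (i : 'I_n) (k : 'I_(size J)) : 'I_(size J) :=
  Ordinal (act_lt (ltn_ord i) (ltn_ord k)).

Let psi_move i k : psi (move i k) = reflection ip (b i) (psi k).
Proof.
rewrite /psi /phiL (refl_vev gramP modelP F bg) ?size_J //= nth_index //.
by rewrite -index_mem; exact: act_lt.
Qed.

Let b_neq0 i : b i != 0.
Proof. exact: frame_neq0 F i. Qed.

Let psi_inj : injective psi.
Proof.
have /andP[uJ _] := actP => k l e; apply: val_inj; apply/eqP.
rewrite -(nth_uniq [::] _ _ uJ) ?ltn_ord //.
by apply/eqP; apply: (vev_inj F) e; exact: size_J.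
Qed.

Let move_inj i : injective (move i).
Proof.
move=> k l /(congr1 psi); rewrite !psi_move => /(congr1 (reflection ip (b i))).
by rewrite !reflK // => /psi_inj.
Qed.

Let ip_psi (k l : 'I_(size J)) : ip (psi l) (psi k) = gev R (form Ct J k l).
Proof. by apply: (ip_vev modelP bg); exact: size_J. Qed.

Let form_move i k l : form Ct J (move i k) (move i l) = form Ct J k l.
Proof. by apply: (@gev_inj R); rewrite -!ip_psi !psi_move ip_refl. Qed.

(** Freeness is taken in all of [J], opposites included, which makes it invariant under
    reflections. *)
Definition compatible (A : seq gold) (U : {set 'I_(size J)}) : Prop :=
  free_family psi U /\ {in U &, forall k l : 'I_(size J), k != l -> form Ct J k l \in A}.

Lemma compatible_move A U i : compatible A U -> compatible A [set move i k | k in U].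
Proof.
move=> [fU AU]; split; last first.
  move=> _ _ /imsetP[k kU ->] /imsetP[l lU ->] kl; rewrite form_move AU //.
  by apply: contraNneq kl => ->.
have [inv _ moveK] := injF_bij (@move_inj i).
move=> k' [c c0 kE]; apply: (fU (inv k')); exists (fun k => c (move i k)) => //.
have rK : cancel (reflection ip (b i)) (reflection ip (b i)) by move=> v; exact: reflK.
apply: (can_inj rK).
rewrite -psi_move moveK kE (reindex_inj (@move_inj i)) big_mkcond /=.
rewrite [X in reflection ip (b i) X]big_mkcond refl_sum; apply: eq_bigr => k _.
rewrite !inE (mem_imset _ _ (@move_inj i)) -{1}[k']moveK (inj_eq (@move_inj i)).
case: ifP => _; first by rewrite reflZ psi_move.
by rewrite -[in RHS](scale0r 0) reflZ scale0r.
Qed.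

Let mem_iota_J (k : 'I_(size J)) : (k : nat) \in iota 0 (size J).
Proof. by rewrite mem_iota ltn_ord. Qed.

Lemma compatible_first A U (k l : 'I_(size J)) : first_check n Ct J ->
  compatible A U -> k \in U -> l \in U -> k != l ->
  exists U' (k' l' : 'I_(size J)), [/\ compatible A U', #|U'| = #|U|, k' \in U', l' \in U'
    & [/\ k' != l', val k' = 0%N & form Ct J k' l' = form Ct J k l]].
Proof.
move=> firstP; have [m] := ubnP (val k).
elim: m U k l => // m IHm U k l km cU kU lU kl.
have /orP[/eqP k0|/hasP[i]] := allP firstP _ (mem_iota_J k); first by exists U, k, l.
rewrite mem_iota => i_n ik; have cU' := compatible_move (Ordinal i_n) cU.
have mkl : move (Ordinal i_n) k != move (Ordinal i_n) l by rewrite (inj_eq (@move_inj _)).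
have [U' [k' [l' [c' e' k'U l'U [kl' k0 f']]]]] :=
  IHm _ (move (Ordinal i_n) k) (move (Ordinal i_n) l) (leq_trans ik km) cU'
    (imset_f _ kU) (imset_f _ lU) mkl.
exists U', k', l'; split=> //; first by rewrite e' card_imset //; exact: move_inj.
by split=> //; rewrite f' form_move.
Qed.

(** Only simple reflections fixing the root of index 0 are applied, so the position of [k] is kept
    while the index of [l] decreases to [t]. *)
Lemma compatible_second A U (k l : 'I_(size J)) t : second_check n Ct J (form Ct J k l) t ->
  compatible A U -> k \in U -> l \in U -> val k = 0%N ->
  exists U' : {set 'I_(size J)}, [/\ compatible A U', #|U'| = #|U|, member U' 0 & member U' t].
Proof.
move=> secondP; have [m] := ubnP (val l); move: secondP.
elim: m U l => // m IHm U l secondP lm cU kU lU k0.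
have := allP secondP _ (mem_iota_J l); rewrite -{1}k0 eqxx /= => /orP[/eqP lt|/hasP[i]].
  by exists U; split=> //; [rewrite -k0 memberE|rewrite -lt memberE].
rewrite mem_filter mem_iota => /andP[/eqP i0 i_n] il.
have cU' := compatible_move (Ordinal i_n) cU.
have mk : move (Ordinal i_n) k = k by apply: val_inj; rewrite /= k0 i0.
have kU' : k \in [set move (Ordinal i_n) k | k in U] by rewrite -{1}mk imset_f.
have secondP' : second_check n Ct J (form Ct J k (move (Ordinal i_n) l)) t.
  by rewrite -{1}mk form_move.
have [U' [c' e' m0 mt]] :=
  IHm _ (move (Ordinal i_n) l) secondP' (leq_trans il lm) cU' kU' (imset_f _ lU) k0.
by exists U'; split=> //; rewrite e' card_imset //; exact: move_inj.
Qed.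

Lemma pair_bound A U t certs tree N : compatible A U -> member U 0 -> member U t ->
  pair_check n Ct J A t certs tree N -> (#|U| <= N)%N.
Proof.
move=> [fU AU] m0 mt /andP[/allP certP ref].
set C := [seq i <- _ | _] in ref.
have bad_sound i j : form Ct J i j \notin A -> i != j -> ~~ (member U i && member U j).
  move=> bad ij; apply/negP => /andP[/exists_inP[k kU /eqP ki] /exists_inP[l lU /eqP lj]].
  by move: bad; rewrite -ki -lj AU // -val_eqE ki lj.
have : (count (member U) C < N.-1)%N.
  rewrite -count_map_N; apply: (refutes_count (uniq_map_N _) _ ref).
    by rewrite filter_uniq // iota_uniq.
  move=> e; rewrite mem_cat => /orP[|/mapP[c cc ->]].
    apply: pair_edgesP => i j _ _ ij bad.
    by apply: bad_sound => //; rewrite neq_ltn ij.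
  have := cert_sound size_J fU (certP _ cc); apply: contra; rewrite all_map => /allP H.
  apply/allP => _ /mapP[p pc ->]; have := H p; rewrite mem_filter pc andbT /= Nat2N.id.
  by have [->//|p0] := eqVneq p.1 0%N; have [->//|pt] := eqVneq p.1 t; apply.
(* The two further members are those of indices 0 and [t], which is why the search only has to
   refute [N.-1] candidates. *)
suff : (#|U| <= (count (member U) C).+2)%N by lia.
rewrite card_member; apply: (@count_remove2 _ _ _ 0%N t); first exact: iota_uniq.
move=> i mi; have [//|i0] := eqVneq i 0%N; have [//|it] /= := eqVneq i t.
apply/andP; split; apply/negP => bad.
  by have := bad_sound _ _ bad; rewrite m0 mi eq_sym i0 => /(_ isT).
by have := bad_sound _ _ bad; rewrite mt mi eq_sym it => /(_ isT).
Qed.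

Lemma cases_bound A U cases N : (0 < N)%N -> first_check n Ct J ->
  compatible A U -> cases_check n Ct J A cases N -> (#|U| <= N)%N.
Proof.
move=> N0 firstP; elim: A cases => [|c A IHA] cases cU.
  move=> _; apply: leq_trans N0; rewrite leqNgt; apply/negP => /card_gt1P[k [l [kU lU kl]]].
  by have := cU.2 k l kU lU kl.
case: cases => [|[t [certs tree]] cases] //= /and3P[secondP pairP casesP].
have [/exists_inP[k kU /exists_inP[l lU /andP[kl /eqP kc]]]|no] := boolP
  [exists k in U, exists l in U, (k != l) && (form Ct J k l == c)].
  have [U1 [k' [l' [c1 <- k'U l'U [kl' k0 kc']]]]] := compatible_first firstP cU kU lU kl.
  rewrite -kc -kc' in secondP.
  have [U2 [c2 <- m0 mt]] := compatible_second secondP c1 k'U l'U k0.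
  exact: pair_bound c2 m0 mt pairP.
apply: IHA casesP; split; first exact: cU.1.
move=> k l kU lU kl; have := cU.2 k l kU lU kl; rewrite inE => /orP[kc|//].
by case/exists_inP: no; exists k => //; apply/exists_inP; exists l => //; rewrite kl.
Qed.

(** Bringing one member of a pair to index 0 first means that conflicts need checking only for pairs
    [(0, l)]. *)
Lemma compatible_refine A0 A U pats : first_check n Ct J -> form_check Ct J L pats A0 A ->
  compatible A0 U -> compatible A U.
Proof.
move=> firstP /and3P[okp _ /allP confP] cU; split=> [|k l kU lU kl]; first exact: cU.1.
have [U1 [k' [l' [[fU1 cU1] _ k'U l'U [kl' k0 <-]]]]] := compatible_first firstP cU kU lU kl.
have := cU1 k' l' k'U l'U kl'; have := confP _ (mem_iota_J l').
rewrite -{1 2 3 4}k0 => /or4P[/eqP l0||/negbTE ->|] //.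
  by move: kl'; rewrite -val_eqE /= l0 eqxx.
move=> /(pair_conflict_sound size_J fU1 okp (ltn_ord k') (ltn_ord l')).
by rewrite !memberE k'U l'U.
Qed.

(** The cone of positive roots consists of vectors with nonnegative coordinates, so it contains no
    opposite of a positive root, and enlarging the ambient family keeps the set free. *)
Lemma lift_compatible A0 A pats (S : {set 'I_(size L)}) : form_check Ct J L pats A0 A ->
  free_family (phiL (L := L) b) S ->
  exists2 U : {set 'I_(size J)}, compatible A0 U & #|U| = #|S|.
Proof.
move=> /and3P[_ /allP formP _] fS.
have sLJ : (size L <= size J)%N by rewrite size_cat leq_addr.
pose up := widen_ord sLJ.
have up_inj : injective up by move=> k l /(congr1 val) /= /val_inj.
have psi_up k : psi (up k) = phiL (L := L) b k by rewrite /psi /phiL nth_cat /= ltn_ord.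
have M := phiL_model gramP modelP F bg.
have ge0 k i : 0 <= x i (psi (up k)) by rewrite psi_up (model_nonneg M).
exists [set up k | k in S]; last by rewrite card_imset.
split=> [k' [c c0 kE]|_ _ /imsetP[k kS ->] /imsetP[l lS ->] kl]; last first.
  have iotaL (o : 'I_(size L)) : (o : nat) \in iota 0 (size L) by rewrite mem_iota ltn_ord.
  have /allP/(_ _ (iotaL l))/orP[/eqP/val_inj e|//] := formP _ (iotaL k).
  by move: kl; rewrite e eqxx.
have [kL|Lk] := ltnP k' (size L).
  have k'E : k' = up (Ordinal kL) by apply: val_inj.
  set o := Ordinal kL in k'E.
  have upD : [set up k | k in S] :\ up o = [set up k | k in S :\ o].
    apply/finset.setP => j; rewrite finset.in_setD1; apply/andP/imsetP => [[jo /imsetP[i iS ji]]|].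
      by exists i => //; rewrite !inE iS -(inj_eq up_inj) -ji jo.
    by move=> [i]; rewrite !inE => /andP[io iS] ->; rewrite inj_eq // imset_f.
  apply: (fS o); exists (c \o up); first by move=> i; exact: c0.
  rewrite -psi_up -k'E kE k'E upD big_imset /=; last by move=> ? ? _ _; exact: up_inj.
  by apply: eq_bigr => i _; rewrite psi_up.
have sJ : size J = (size L + size L)%N by rewrite size_cat size_rev size_map.
(* The opposites come in reversed order, so this is the index in [L] of the root opposite to that of
   index [k']. *)
have kJ : (size L - (k' - size L).+1 < size L)%N by have := ltn_ord k'; lia.
have k'L : (k' - size L < size [seq map gopp v | v <- L])%N.
  by rewrite size_map; have := ltn_ord k'; lia.
have k'N : psi k' = - phiL (L := L) b (Ordinal kJ).
  by rewrite /psi /phiL nth_cat ltnNge Lk /= nth_rev // size_map (nth_map [::]) // vev_opp.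
have /eqP := model_neq0 M (Ordinal kJ); apply; apply: (frame_ext F) => i.
have x0 : x i 0 = 0 by rewrite -(scale0r 0) (frameZ F) mul0r.
rewrite x0; apply: le_anti; rewrite (model_nonneg M) andbT -oppr_ge0 -(frameN F) -k'N kE.
rewrite (big_morph (x i) (frameD F i) x0) sumr_ge0 // => l.
rewrite !inE => /andP[_ /imsetP[l' _ ->]].
by rewrite (frameZ F) mulr_ge0.
Qed.

End WeylMoves.

Definition weyl_check (n : nat) (Ct L : seq (seq gold)) (pats : seq pattern)
    (A0 A : seq gold) : bool :=
  let J := with_opposites L in
  [&& act_check n Ct J, first_check n Ct J & form_check Ct J L pats A0 A].

Lemma weyl_entry (R : realType) (V : vectType R) (ip : {dot V for idfun})
    (Phi P : set V) (T : root_type) (Delta : (rank_of T).-tuple V)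
    (Ct L fs : seq (seq gold)) s pats A0 A cases :
  root_system ip Phi -> positive_system Phi P -> simple_system Phi Delta ->
  coxeter_orders ip (fun i j : 'I_(rank_of T) => coxeter_matrix T i j) Delta ->
  gram_check T Ct Ct -> model_check (rank_of T) Ct L ->
  (0 < table_value T)%N -> separation_check (rank_of T) (table_value T) L fs s ->
  weyl_check (rank_of T) Ct L pats A0 A ->
  cases_check (rank_of T) Ct (with_opposites L) A cases (table_value T) ->
  max_really_abelian_size P (table_value T) /\
  helly_number P (cone P) (table_value T).
Proof.
move=> PhiR PP D Dm gramP modelP N0 sepP /and3P[actP firstP formP] casesP.
apply: (table_model_entry PhiR PP D Dm gramP modelP) => b x F bg.
split=> [|S fS]; first exact: (separation_free modelP F sepP).
have [U cU <-] := lift_compatible gramP modelP F bg actP formP fS.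
have cU' := compatible_refine gramP modelP F bg actP firstP formP cU.
exact: (cases_bound gramP modelP F bg actP N0 firstP cU' casesP).
Qed.

(** * Tables and certificates for H4 *)

Definition cartan_H4 : seq (seq gold) := ([::
  [:: (2, 0); (-1, 0); (0, 0); (0, 0)]; [:: (-1, 0); (2, 0); (-1, 0); (0, 0)];
  [:: (0, 0); (-1, 0); (2, 0); (0, -1)]; [:: (0, 0); (0, 0); (0, -1); (2, 0)]])%coqZ.

Definition roots_H4 : seq (seq gold) := ([::
  [:: (0, 2); (1, 3); (2, 4); (2, 3)]; [:: (1, 1); (1, 3); (2, 4); (2, 3)];
  [:: (1, 1); (2, 2); (2, 4); (2, 3)]; [:: (1, 1); (2, 2); (3, 3); (2, 3)];
  [:: (1, 1); (2, 2); (3, 3); (1, 3)]; [:: (1, 1); (2, 2); (2, 3); (1, 3)];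
  [:: (1, 1); (2, 2); (2, 3); (2, 2)]; [:: (1, 1); (1, 2); (2, 3); (1, 3)];
  [:: (1, 1); (1, 2); (2, 3); (2, 2)]; [:: (0, 1); (1, 2); (2, 3); (1, 3)];
  [:: (0, 1); (1, 2); (2, 3); (2, 2)]; [:: (1, 1); (1, 2); (1, 3); (2, 2)];
  [:: (0, 1); (1, 2); (1, 3); (2, 2)]; [:: (1, 1); (1, 2); (1, 3); (1, 2)];
  [:: (1, 1); (1, 2); (2, 2); (1, 2)]; [:: (0, 1); (0, 2); (1, 3); (2, 2)];
  [:: (0, 1); (1, 2); (1, 3); (1, 2)]; [:: (1, 1); (2, 1); (2, 2); (1, 2)];
  [:: (0, 1); (1, 2); (2, 2); (1, 2)]; [:: (0, 1); (0, 2); (1, 3); (1, 2)];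
  [:: (1, 0); (2, 1); (2, 2); (1, 2)]; [:: (0, 1); (1, 1); (2, 2); (1, 2)];
  [:: (0, 1); (0, 2); (1, 2); (1, 2)]; [:: (1, 0); (1, 1); (2, 2); (1, 2)];
  [:: (0, 1); (1, 1); (1, 2); (1, 2)]; [:: (1, 0); (1, 1); (1, 2); (1, 2)];
  [:: (0, 1); (0, 2); (1, 2); (1, 1)]; [:: (0, 1); (1, 1); (1, 2); (1, 1)];
  [:: (0, 1); (0, 2); (0, 2); (1, 1)]; [:: (1, 0); (1, 1); (1, 2); (1, 1)];
  [:: (0, 1); (1, 1); (1, 1); (1, 1)]; [:: (0, 1); (0, 1); (0, 2); (1, 1)];
  [:: (1, 0); (1, 1); (1, 1); (1, 1)]; [:: (0, 1); (0, 1); (1, 1); (1, 1)];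
  [:: (0, 1); (1, 1); (1, 1); (0, 1)]; [:: (1, 0); (1, 1); (1, 1); (0, 1)];
  [:: (0, 0); (0, 1); (0, 2); (1, 1)]; [:: (0, 1); (0, 1); (1, 1); (0, 1)];
  [:: (1, 0); (1, 0); (1, 1); (1, 1)]; [:: (0, 0); (0, 1); (1, 1); (1, 1)];
  [:: (0, 1); (0, 1); (0, 1); (0, 1)]; [:: (0, 0); (1, 0); (1, 1); (1, 1)];
  [:: (1, 0); (1, 0); (1, 1); (0, 1)]; [:: (0, 0); (0, 1); (1, 1); (0, 1)];
  [:: (0, 1); (0, 1); (0, 1); (1, 0)]; [:: (0, 0); (1, 0); (1, 1); (0, 1)];
  [:: (0, 0); (0, 1); (0, 1); (0, 1)]; [:: (1, 0); (1, 0); (1, 0); (0, 1)];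
  [:: (0, 0); (0, 1); (0, 1); (1, 0)]; [:: (0, 0); (1, 0); (1, 0); (0, 1)];
  [:: (0, 0); (0, 0); (0, 1); (0, 1)]; [:: (1, 0); (1, 0); (1, 0); (0, 0)];
  [:: (0, 0); (0, 0); (0, 1); (1, 0)]; [:: (0, 0); (0, 0); (1, 0); (0, 1)];
  [:: (0, 0); (1, 0); (1, 0); (0, 0)]; [:: (1, 0); (1, 0); (0, 0); (0, 0)];
  [:: (0, 0); (0, 0); (0, 0); (1, 0)]; [:: (0, 0); (0, 0); (1, 0); (0, 0)];
  [:: (0, 0); (1, 0); (0, 0); (0, 0)]; [:: (1, 0); (0, 0); (0, 0); (0, 0)]])%coqZ.

Definition facets_H4 : seq (seq gold) := ([::
  [:: (0, 1); (1, 0); (-2, -3); (2, 3)]; [:: (0, -1); (-1, 0); (1, 1); (0, -1)];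
  [:: (-1, -1); (1, 0); (0, 1); (0, -1)]; [:: (0, 0); (0, -1); (1, 1); (0, -1)];
  [:: (0, 1); (0, -1); (0, 1); (-1, 0)]; [:: (0, 0); (0, 1); (0, -2); (1, 1)];
  [:: (-1, 0); (0, 0); (1, 1); (-1, -1)]; [:: (-1, -1); (1, 1); (0, 0); (-1, 0)];
  [:: (0, 1); (0, -1); (0, -1); (1, 1)]; [:: (1, 0); (0, 1); (-1, -1); (0, 1)];
  [:: (-1, 0); (1, 0); (-1, -1); (1, 1)]; [:: (-1, -2); (0, 0); (1, 3); (-2, -2)];
  [:: (0, -1); (-1, -1); (2, 3); (-2, -2)]; [:: (1, 1); (0, 1); (-2, -4); (3, 3)]])%coqZ.

Definition certs_H4_golden : seq cone_cert := flatten (map expand_certs [::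
  (([:: (0, 1); (0, 1); (0, 1); (1, 0)]%coqZ, (1, 2)%coqZ), [::
    0; 1; 2; 40; 13; 0; 1; 2; 44; 11; 0; 1; 3; 37; 14; 0; 1; 3; 44; 8; 0; 1; 4; 33; 14; 0; 1;
    4; 40; 7; 0; 1; 5; 31; 13; 0; 1; 5; 37; 7; 0; 1; 6; 31; 11; 0; 1; 6; 33; 8; 0; 7; 8; 28;
    1; 0; 7; 11; 26; 1; 0; 8; 13; 22; 1; 0; 11; 14; 19; 1; 0; 13; 14; 15; 1; 1; 0; 2; 46; 16;
    1; 0; 2; 48; 12; 1; 0; 3; 43; 18; 1; 0; 3; 48; 10; 1; 0; 4; 39; 18; 1; 0; 4; 46; 9; 1; 0;
    5; 36; 16; 1; 0; 5; 43; 9; 1; 0; 6; 36; 12; 1; 0; 6; 39; 10; 1; 9; 10; 28; 0; 1; 9; 12;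
    26; 0; 1; 10; 16; 22; 0; 1; 12; 18; 19; 0; 1; 15; 16; 18; 0; 2; 0; 1; 50; 19; 2; 0; 1; 52;
    15; 2; 0; 7; 36; 19; 2; 9; 10; 31; 0; 3; 0; 1; 53; 22; 3; 0; 1; 56; 15; 3; 1; 9; 33; 22;
    3; 1; 12; 33; 15; 3; 9; 12; 33; 0; 4; 0; 1; 57; 26; 4; 0; 1; 63; 19; 4; 0; 13; 43; 19; 4;
    1; 10; 37; 26; 4; 1; 16; 37; 19; 4; 8; 13; 43; 1; 4; 10; 16; 37; 0; 5; 0; 1; 62; 28; 5; 0;
    1; 67; 22; 5; 0; 11; 46; 28; 5; 0; 14; 46; 22; 5; 12; 18; 40; 0; 6; 0; 1; 66; 28; 6; 0; 1;
    69; 26; 6; 0; 13; 48; 28; 6; 0; 14; 48; 26; 6; 1; 16; 44; 28; 6; 13; 14; 48; 1; 6; 16; 18;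
    44; 0; 7; 0; 11; 50; 31; 7; 1; 31; 33; 15; 7; 9; 31; 33; 0; 8; 0; 7; 57; 37; 8; 0; 13; 52;
    31; 9; 1; 10; 53; 39; 9; 1; 12; 50; 36; 9; 7; 36; 39; 1; 10; 0; 36; 43; 19; 11; 0; 7; 62;
    40; 11; 0; 14; 56; 33; 12; 1; 9; 62; 46; 13; 0; 8; 66; 44; 13; 0; 14; 63; 37; 14; 18; 40;
    44; 0; 16; 13; 43; 48; 1; 18; 0; 46; 48; 28; 18; 1; 12; 69; 48]);
  (([:: (0, 1); (0, 1); (1, 0); (1, 0)]%coqZ, (1, 2)%coqZ), [::
    0; 1; 7; 13; 14; 0; 1; 8; 11; 14; 0; 1; 11; 8; 13; 0; 1; 13; 7; 11; 0; 1; 14; 7; 8; 0; 7;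
    13; 1; 5; 0; 7; 14; 1; 4; 0; 8; 11; 1; 6; 0; 8; 14; 1; 3; 0; 11; 13; 1; 2; 1; 0; 9; 16;
    18; 1; 0; 10; 12; 18; 1; 0; 16; 9; 12; 1; 0; 18; 9; 10; 1; 9; 18; 0; 4; 1; 10; 18; 0; 3;
    1; 12; 16; 0; 2; 2; 8; 15; 1; 10; 2; 9; 19; 0; 7; 2; 15; 19; 0; 1; 3; 7; 22; 1; 9; 3; 11;
    15; 1; 12; 3; 15; 22; 0; 1; 4; 8; 26; 1; 10; 4; 13; 19; 1; 16; 4; 19; 26; 0; 1; 5; 12; 28;
    0; 11; 5; 14; 22; 1; 18; 5; 22; 28; 0; 1; 6; 26; 28; 0; 1; 7; 15; 31; 0; 11; 8; 0; 19; 31;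
    37; 8; 19; 31; 0; 13; 9; 1; 15; 36; 39; 9; 15; 39; 1; 10; 10; 19; 36; 1; 16; 10; 19; 43;
    1; 9; 11; 0; 22; 33; 40; 12; 1; 22; 39; 46; 12; 22; 39; 1; 18; 13; 0; 26; 37; 44; 14; 0;
    28; 40; 44; 16; 1; 26; 43; 48; 16; 26; 43; 1; 18; 17; 31; 40; 0; 13; 17; 31; 44; 0; 11;
    18; 28; 48; 1; 12; 20; 1; 43; 39; 46; 20; 1; 46; 36; 43; 20; 36; 46; 1; 16; 20; 36; 48; 1;
    12; 20; 39; 43; 1; 18; 20; 39; 48; 1; 10; 20; 43; 46; 1; 9]);
  (([:: (0, 1); (0, 1); (1, 0); (1, 0)]%coqZ, (2, 1)%coqZ), [::
    0; 1; 2; 40; 44; 0; 1; 3; 37; 44; 0; 1; 4; 33; 40; 0; 1; 5; 31; 37; 0; 1; 6; 31; 33; 0; 1;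
    7; 26; 40; 0; 1; 7; 28; 37; 0; 1; 8; 22; 44; 0; 1; 8; 28; 33; 0; 1; 11; 19; 44; 0; 1; 11;
    26; 31; 0; 1; 13; 15; 40; 0; 1; 13; 22; 31; 0; 1; 14; 15; 37; 0; 1; 14; 19; 33; 1; 0; 2;
    46; 48; 1; 0; 3; 43; 48; 1; 0; 4; 39; 46; 1; 0; 5; 36; 43; 1; 0; 6; 36; 39; 1; 0; 9; 26;
    46; 1; 0; 9; 28; 43; 1; 0; 10; 22; 48; 1; 0; 10; 28; 39; 1; 0; 12; 19; 48; 1; 0; 12; 26;
    36; 1; 0; 16; 15; 46; 1; 0; 16; 22; 36; 1; 0; 18; 15; 43; 1; 0; 18; 19; 39; 2; 0; 1; 50;
    52; 3; 0; 1; 53; 56; 4; 0; 1; 57; 63; 5; 0; 1; 67; 62; 6; 0; 1; 69; 66; 7; 8; 33; 1; 53;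
    8; 31; 37; 1; 10; 10; 9; 43; 0; 57; 10; 16; 36; 0; 52; 10; 19; 43; 0; 39; 10; 36; 43; 0;
    8; 11; 22; 33; 1; 44; 11; 22; 40; 1; 31; 11; 33; 40; 1; 12; 12; 18; 39; 0; 56; 12; 22; 46;
    0; 36; 12; 39; 46; 0; 11; 13; 37; 44; 1; 16; 14; 11; 44; 1; 69; 14; 13; 40; 1; 67; 14; 28;
    40; 1; 37; 14; 28; 44; 1; 33; 15; 50; 53; 0; 1; 16; 10; 48; 0; 66; 16; 18; 43; 0; 63; 16;
    26; 48; 0; 36; 18; 16; 46; 0; 67; 18; 28; 46; 0; 43; 18; 28; 48; 0; 39; 18; 46; 48; 0; 14;
    19; 52; 57; 0; 1; 22; 56; 62; 0; 1; 26; 66; 63; 0; 1; 28; 69; 67; 0; 1]);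
  (([:: (0, 1); (0, 1); (1, 0); (1, 1)]%coqZ, (2, 2)%coqZ), [::
    0; 1; 7; 19; 14; 0; 1; 7; 22; 13; 0; 1; 8; 15; 14; 0; 1; 8; 26; 11; 0; 1; 11; 15; 13; 0;
    1; 11; 28; 8; 0; 1; 13; 19; 11; 0; 1; 13; 28; 7; 0; 1; 14; 22; 8; 0; 1; 14; 26; 7; 0; 7;
    13; 40; 1; 0; 7; 14; 37; 1; 0; 8; 11; 44; 1; 0; 8; 14; 33; 1; 0; 11; 13; 31; 1; 1; 0; 9;
    19; 18; 1; 0; 9; 22; 16; 1; 0; 10; 15; 18; 1; 0; 12; 15; 16; 1; 0; 12; 28; 10; 1; 0; 16;
    19; 12; 1; 0; 18; 22; 10; 1; 0; 18; 26; 9; 1; 9; 16; 46; 0; 1; 9; 18; 43; 0; 1; 10; 12;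
    48; 0; 1; 10; 18; 39; 0; 1; 12; 16; 36; 0; 2; 0; 15; 31; 10; 2; 0; 19; 31; 9; 2; 1; 15;
    36; 8; 3; 1; 15; 39; 11; 3; 1; 22; 39; 7; 4; 1; 26; 43; 8; 5; 0; 22; 40; 18; 5; 0; 28; 40;
    12; 6; 0; 26; 44; 18; 7; 0; 31; 40; 15; 7; 0; 33; 37; 15; 7; 8; 15; 1; 33; 8; 0; 31; 44;
    19; 8; 0; 37; 33; 19; 8; 7; 19; 1; 37; 9; 1; 36; 46; 15; 9; 1; 39; 43; 15; 9; 12; 15; 0;
    36; 10; 1; 36; 48; 19; 11; 7; 22; 1; 40; 11; 14; 22; 1; 33; 12; 1; 39; 48; 22; 12; 9; 22;
    0; 46; 13; 0; 37; 40; 26; 13; 0; 44; 31; 26; 13; 8; 26; 1; 44; 13; 14; 26; 1; 37; 14; 11;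
    28; 1; 44; 14; 13; 28; 1; 40; 16; 1; 43; 46; 26; 16; 10; 26; 0; 48; 18; 16; 28; 0; 46]);
  (([:: (0, 1); (0, 1); (1, 0); (1, 2)]%coqZ, (1, 3)%coqZ), [::
    0; 33; 37; 14; 1; 0; 33; 44; 8; 1; 0; 37; 40; 7; 1; 7; 37; 40; 0; 15; 8; 33; 44; 0; 19;
    10; 39; 48; 1; 19; 14; 33; 37; 0; 28; 18; 39; 43; 1; 28]);
  (([:: (0, 1); (1, 0); (1, 0); (1, 0)]%coqZ, (0, 2)%coqZ), [::
    0; 31; 1; 5; 6; 0; 33; 1; 4; 6; 0; 37; 1; 3; 5; 0; 40; 1; 2; 4; 0; 44; 1; 2; 3; 1; 36; 0;
    5; 6; 1; 39; 0; 4; 6; 1; 43; 0; 3; 5; 1; 46; 0; 2; 4; 1; 48; 0; 2; 3; 2; 8; 1; 10; 53; 2;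
    9; 0; 7; 57; 2; 15; 0; 1; 57; 2; 15; 0; 8; 43; 2; 15; 1; 10; 37; 2; 19; 0; 1; 53; 2; 19;
    1; 9; 33; 2; 36; 0; 7; 8; 2; 50; 0; 1; 4; 2; 52; 0; 1; 3; 3; 7; 1; 9; 62; 3; 11; 1; 12;
    50; 3; 15; 0; 1; 62; 3; 15; 0; 11; 46; 3; 15; 1; 12; 40; 3; 22; 0; 1; 50; 3; 39; 0; 7; 11;
    3; 53; 0; 1; 5; 3; 56; 0; 1; 2; 4; 8; 1; 10; 66; 4; 13; 1; 16; 52; 4; 19; 0; 1; 66; 4; 19;
    1; 16; 44; 4; 26; 0; 1; 52; 4; 26; 1; 10; 31; 4; 57; 0; 1; 6; 4; 63; 0; 1; 2; 5; 11; 1;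
    12; 69; 5; 18; 0; 14; 56; 5; 22; 0; 1; 69; 5; 22; 1; 18; 44; 5; 28; 0; 1; 56; 5; 28; 0;
    11; 39; 5; 46; 0; 11; 14; 5; 62; 0; 1; 6; 5; 67; 0; 1; 3; 6; 14; 1; 18; 63; 6; 16; 0; 13;
    67; 6; 26; 0; 1; 67; 6; 26; 0; 14; 46; 6; 26; 1; 18; 40; 6; 28; 0; 1; 63; 6; 28; 0; 13;
    43; 6; 66; 0; 1; 5; 6; 69; 0; 1; 4]);
  (([:: (0, 1); (1, 0); (1, 0); (1, 2)]%coqZ, (2, 2)%coqZ), [::
    0; 31; 40; 44; 1; 0; 33; 37; 44; 1; 0; 37; 33; 40; 1; 0; 40; 31; 37; 1; 0; 44; 31; 33; 1;
    1; 36; 46; 48; 0; 1; 39; 43; 48; 0; 1; 48; 36; 39; 0]);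
  (([:: (0, 1); (1, 0); (1, 1)]%coqZ, (0, 2)%coqZ), [::
    2; 11; 39; 19; 2; 12; 33; 19; 2; 13; 43; 15; 2; 16; 37; 15; 2; 31; 22; 10; 2; 31; 26; 9;
    2; 36; 22; 8; 2; 36; 26; 7; 2; 50; 37; 1; 2; 50; 43; 0; 2; 52; 33; 1; 2; 52; 39; 0; 3; 14;
    46; 15; 3; 18; 40; 15; 3; 33; 28; 9; 3; 39; 28; 7; 3; 53; 40; 1; 3; 53; 46; 0; 3; 56; 31;
    1; 3; 56; 36; 0; 4; 14; 48; 19; 4; 18; 44; 19; 4; 37; 28; 10; 4; 43; 28; 8; 4; 57; 44; 1;
    4; 57; 48; 0; 4; 63; 31; 1; 4; 63; 36; 0; 5; 13; 48; 22; 5; 16; 44; 22; 5; 40; 26; 12; 5;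
    46; 26; 11; 5; 62; 44; 1; 5; 62; 48; 0; 5; 67; 33; 1; 5; 67; 39; 0; 6; 66; 40; 1; 6; 66;
    46; 0; 6; 69; 37; 1; 6; 69; 43; 0]);
  (([:: (0, 1); (1, 0); (1, 1); (1, 1)]%coqZ, (1, 3)%coqZ), [::
    2; 1; 39; 7; 19; 3; 0; 31; 9; 22; 3; 1; 36; 7; 22; 4; 1; 36; 8; 26; 4; 1; 48; 13; 19; 5;
    0; 33; 12; 28; 5; 1; 48; 14; 22; 6; 0; 37; 16; 28]);
  (([:: (1, 0); (1, 1); (1, 1); (1, 3)]%coqZ, (3, 3)%coqZ), [::
    0; 22; 31; 44; 1; 0; 26; 31; 40; 1; 1; 15; 43; 46; 0; 1; 22; 36; 48; 0; 1; 26; 36; 46; 0])]).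

Definition search_H4_golden : search_tree := decode_tree ([::
  51; 12; 0; 13; 0; 32; 0; 0; 53; 14; 0; 17; 0; 32; 0; 0; 54; 9; 0; 11; 0; 34; 0; 0; 57; 15;
  0; 19; 0; 34; 0; 0; 58; 8; 0; 10; 0; 38; 0; 0; 64; 15; 0; 19; 0; 38; 0; 0; 67; 9; 0; 11; 0;
  45; 0; 0; 70; 12; 0; 13; 0; 45; 0; 0; 68; 14; 0; 17; 0; 41; 0; 0; 63; 8; 0; 10; 0; 41; 0; 0;
  32; 10; 6; 0; 0; 6; 23; 0; 20; 0; 0; 23; 0; 11; 7; 0; 0; 7; 27; 0; 16; 0; 0; 27; 0; 41; 0;
  45; 0; 34; 38; 0; 0; 38; 0; 12; 0; 20; 0; 0; 34; 20; 0; 10; 5; 0; 0; 5; 23; 0; 0; 38; 0; 45;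
  41; 0; 0; 41; 16; 0; 0; 29; 0; 7; 13; 0; 0; 13; 0; 16; 0; 15; 0; 0; 38; 16; 0; 41; 45; 0; 0;
  45; 20; 0; 0; 4; 11; 0; 0; 11; 0; 29; 0; 6; 17; 0; 0; 17; 0; 20; 0; 15; 0; 0; 41; 16; 0; 27;
  5; 0; 0; 45; 0; 3; 13; 0; 0; 13; 0; 5; 19; 0; 0; 19; 0; 23; 0; 14; 0; 0; 45; 20; 0; 23; 0;
  3; 17; 0; 0; 17; 0; 4; 19; 0; 0; 19; 0; 27; 0; 12; 0; 0; 37; 23; 6; 0; 0; 9; 7; 0; 0; 8; 6;
  0; 0; 6; 20; 0; 0; 7; 27; 0; 16; 0; 0; 27; 0; 47; 0; 49; 0; 40; 44; 0; 0; 44; 0; 16; 0; 17;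
  0; 0; 40; 20; 0; 8; 5; 0; 0; 5; 23; 0; 0; 44; 0; 29; 7; 0; 0; 49; 47; 0; 0; 47; 0; 12; 7; 0;
  0; 7; 0; 16; 0; 19; 0; 0; 44; 16; 0; 47; 49; 0; 0; 49; 20; 0; 0; 29; 0; 4; 9; 0; 0; 9; 0;
  14; 6; 0; 0; 6; 0; 20; 0; 19; 0; 0; 47; 16; 0; 27; 5; 0; 0; 49; 0; 3; 12; 0; 0; 12; 0; 5;
  15; 0; 0; 15; 0; 23; 0; 17; 0; 0; 49; 20; 0; 23; 0; 3; 14; 0; 0; 14; 0; 4; 15; 0; 0; 15; 0;
  29; 0; 11; 0; 0; 16; 14; 10; 13; 0; 0; 8; 0; 17; 0; 0; 17; 7; 0; 8; 0; 0; 8; 12; 15; 0; 0;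
  9; 0; 3; 0; 0; 10; 3; 0; 13; 0; 0; 15; 19; 0; 0; 19; 0; 9; 12; 0; 0; 12; 0; 0; 20; 15; 11;
  10; 0; 0; 10; 0; 6; 0; 0; 19; 6; 0; 8; 0; 0; 9; 8; 12; 0; 0; 12; 0; 5; 0; 0; 12; 8; 0; 6; 0;
  0; 11; 13; 0; 0; 13; 0; 8; 14; 0; 0; 14; 0; 0; 8; 9; 3; 12; 0; 0; 12; 0; 14; 0; 23; 0; 0;
  27; 4; 0; 19; 0; 0; 14; 0; 3; 4; 12; 0; 0; 5; 0; 10; 0; 0; 12; 4; 0; 15; 0; 0; 29; 17; 0; 0;
  17; 10; 0; 0; 5; 10; 0; 0; 23; 0; 0; 10; 19; 29; 0; 15; 0; 0; 29; 15; 0; 13; 0; 0; 17; 6; 0;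
  3; 0; 0; 27; 14; 0; 0; 3; 11; 0; 4; 0; 0; 11; 13; 0; 0; 13; 0; 4; 0; 0; 23; 14; 5; 0; 15; 0;
  0; 15; 5; 0; 0; 17; 5; 0; 0; 5; 6; 0; 0; 6; 0; 19; 0; 0; 14; 12; 15; 27; 0; 0; 27; 0; 13; 0;
  0; 15; 6; 0; 29; 0; 0; 27; 5; 0; 0; 5; 9; 0; 0; 9; 0; 3; 13; 0; 0; 0; 29; 15; 6; 0; 12; 0;
  0; 9; 19; 0; 0; 19; 11; 0; 0; 13; 0; 6; 0; 0; 3; 17; 5; 0; 0; 5; 6; 0; 0; 6; 0; 7; 9; 0; 0;
  0; 6; 5; 17; 0; 0; 15; 0; 4; 0; 0; 17; 5; 0; 19; 0; 0; 12; 9; 0; 13; 0; 0; 13; 11; 0; 0; 4;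
  9; 11; 0; 0; 19; 0; 0; 27; 9; 0; 0; 0])%num.

Definition certs_H4_one : seq cone_cert := flatten (map expand_certs [::
  (([:: (0, 1); (0, 1); (1, 0); (1, 0)]%coqZ, (2, 1)%coqZ), [::
    1; 0; 9; 26; 46; 2; 0; 9; 31; 45; 3; 0; 9; 30; 53; 3; 0; 9; 33; 49; 4; 0; 26; 9; 57; 4; 0;
    27; 9; 54; 5; 0; 28; 9; 62; 5; 0; 30; 9; 58; 7; 0; 31; 9; 65; 7; 0; 33; 9; 61; 10; 9; 43;
    0; 57; 10; 9; 45; 0; 54; 12; 9; 46; 0; 62; 12; 9; 49; 0; 58; 15; 9; 50; 0; 65; 15; 9; 53;
    0; 61]);
  (([:: (0, 1); (0, 1); (1, 0); (1, 1)]%coqZ, (2, 2)%coqZ), [::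
    1; 0; 9; 19; 18; 1; 0; 9; 22; 16; 1; 0; 18; 26; 9; 1; 9; 18; 43; 0; 2; 0; 9; 24; 19; 2; 0;
    19; 31; 9; 2; 9; 19; 50; 0; 3; 0; 9; 18; 24; 3; 0; 9; 21; 22; 3; 0; 22; 33; 9; 3; 0; 24;
    30; 9; 3; 9; 22; 53; 0; 3; 9; 24; 49; 0; 4; 0; 19; 9; 26; 5; 0; 18; 9; 30; 5; 0; 22; 9;
    28; 7; 0; 21; 9; 33; 7; 0; 24; 9; 31; 10; 9; 19; 0; 43; 12; 9; 18; 0; 49; 12; 9; 22; 0;
    46; 15; 9; 21; 0; 53]);
  (([:: (0, 1); (0, 1); (1, 0); (1, 2)]%coqZ, (1, 3)%coqZ), [::
    1; 26; 28; 0; 9; 1; 43; 46; 9; 0; 2; 27; 31; 0; 9; 2; 45; 50; 9; 0; 3; 30; 33; 0; 9; 3;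
    49; 53; 9; 0]);
  (([:: (0, 1); (1, 0); (1, 1)]%coqZ, (0, 2)%coqZ), [::
    1; 26; 30; 9; 1; 43; 49; 0; 2; 27; 33; 9; 2; 31; 26; 9; 2; 45; 53; 0; 3; 30; 31; 9; 3; 33;
    28; 9; 3; 49; 50; 0; 3; 53; 46; 0]);
  (([:: (0, 1); (1, 0); (1, 1); (1, 1)]%coqZ, (1, 3)%coqZ), [::
    1; 0; 27; 9; 18; 1; 0; 30; 9; 16; 1; 9; 45; 0; 18; 1; 9; 49; 0; 16; 1; 16; 58; 0; 9; 1;
    18; 54; 0; 9; 2; 0; 26; 9; 21; 2; 0; 33; 9; 19; 2; 9; 53; 0; 19; 2; 19; 61; 0; 9; 2; 21;
    57; 0; 9; 3; 0; 31; 9; 22; 3; 9; 46; 0; 24; 3; 9; 50; 0; 22; 3; 22; 65; 0; 9; 3; 24; 62;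
    0; 9]);
  (([:: (1, 0); (1, 0); (1, 1); (1, 1)]%coqZ, (0, 3)%coqZ), [::
    1; 54; 58; 0; 9; 2; 57; 61; 0; 9; 3; 65; 62; 0; 9]);
  (([:: (1, 0); (1, 1); (1, 1); (1, 3)]%coqZ, (3, 3)%coqZ), [::
    4; 9; 54; 57; 0; 5; 9; 58; 62; 0; 7; 9; 65; 61; 0])]).

Definition search_H4_one : search_tree := decode_tree ([::
  55; 0; 58; 0; 59; 0; 63; 0; 66; 0; 62; 0; 27; 0; 31; 0; 32; 0; 50; 0; 19; 0; 25; 0; 20; 0;
  51; 0; 44; 0; 34; 0; 54; 0; 23; 0; 0])%num.

(** Indices 1, 9 and 36 are the standard partners of the highest root at products [phi], 1 and 0. In
    the last case all pairs are orthogonal, and the candidates are already too few for a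
    branching. *)
Definition cases_H4 : seq (nat * (seq cone_cert * search_tree)) :=
  [:: (1, (certs_H4_golden, search_H4_golden)); (9, (certs_H4_one, search_H4_one));
      (36, ([::], Leaf))]%N.

Definition forms_H4 : seq gold := ([:: (0, 1); (1, 0); (0, 0)])%coqZ.
(** The values [2 cos theta] for 36, 60 and 90, then 72, 108, 120 and 144 degrees. The value -2 is
    absent since no two positive roots are opposite; at the last four angles a third root lies
    between the two. *)
Definition distinct_forms_H4 : seq gold :=
  (forms_H4 ++ [:: (-1, 1); (1, -1); (-1, 0); (0, -1)])%coqZ.

Lemma model_checks_H4 :
  [&& gram_check type_H4 cartan_H4 cartan_H4, model_check (rank_of type_H4) cartan_H4 roots_H4
    & separation_check (rank_of type_H4) (table_value type_H4) roots_H4 facets_H4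
        [:: 0; 3; 9; 12; 15; 18; 39; 41]].
Proof. by lazy. Qed.

Lemma weyl_checks_H4 :
  weyl_check (rank_of type_H4) cartan_H4 roots_H4 patterns_H distinct_forms_H4 forms_H4.
Proof. by lazy. Qed.

Lemma cases_check_H4 : cases_check (rank_of type_H4) cartan_H4 (with_opposites roots_H4)
  forms_H4 cases_H4 (table_value type_H4).
Proof. by lazy. Qed.

Theorem theorem10p15 (R : realType) (V : vectType R) (ip : {dot V for idfun}%R)
    (Phi P : set V) (T : root_type) :
  root_system ip Phi -> irreducible ip Phi -> positive_system Phi P ->
  valid_type T -> has_type ip Phi T ->
  max_really_abelian_size P (table_value T) /\
  helly_number P (cone P) (table_value T).
Proof.
move=> PhiR _ PP valid [Delta D Dm].
case: T valid Delta D Dm => [n|n|n||||||m||] valid Delta D Dm.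
- exact: type_A_entry valid PhiR PP D Dm.
- exact: type_BC_entry valid PhiR PP D Dm.
- exact: type_D_entry valid PhiR PP D Dm.
- have /and4P[gramP modelP adeP topP] := checks_E6.
  exact: (type_E_entry PhiR PP D Dm gramP modelP adeP topP isT).
- have /and4P[gramP modelP adeP topP] := checks_E7.
  exact: (type_E_entry PhiR PP D Dm gramP modelP adeP topP isT).
- have /and4P[gramP modelP adeP topP] := checks_E8.
  exact: (type_E_entry PhiR PP D Dm gramP modelP adeP topP isT).
- have /and4P[gramP modelP sepP packP] := checks_F4.
  exact: (packing_entry PhiR PP D Dm gramP modelP sepP packP).
- exact: (rank_two_entry PhiR PP D Dm).
- exact: (rank_two_entry PhiR PP D Dm).
- have /and4P[gramP modelP sepP packP] := checks_H3.
  exact: (packing_entry PhiR PP D Dm gramP modelP sepP packP).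
- have /and3P[gramP modelP sepP] := model_checks_H4.
  exact: (weyl_entry PhiR PP D Dm gramP modelP isT sepP weyl_checks_H4 cases_check_H4).
Qed.
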